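(* Let $\alpha>\frac12$, $\nu>0$ and $\xi=\frac{4\alpha\nu}{\pi(2\alpha-1)}$. As $k\to\infty$, $$\gamma(k)=\begin{cases}(c_{\alpha,\nu}+o(1))\,k^{-1}&\text{if }\alpha>\frac34,\\ (c_{\alpha,\nu}+o(1))\,\frac{\log k}{k}&\text{if }\alpha=\frac34,\\ (c_{\alpha,\nu}+o(1))\,k^{2-4\alpha}&\text{if }\frac12<\alpha<\frac34,\end{cases}$$ where $$c_{\alpha,\nu}:=\begin{cases}\dfrac{8\alpha\nu}{\pi(4\alpha-3)}&\text{if }\alpha>\frac34,\\[2mm] \dfrac{6\nu}{\pi}&\text{if }\alpha=\frac34,\\[2mm] \left(\dfrac{3\alpha-1}{2^{4\alpha+1}\alpha(\alpha-1)^2}+\dfrac{(\alpha-\frac12)B^-(\frac12;2\alpha+1,2\alpha-2)}{2(\alpha-1)\alpha}-\dfrac{B(2\alpha,3-4\alpha)}{4(\alpha-1)}\right)\xi^{4\alpha-2}&\text{if }\frac12<\alpha<\frac34.\end{cases}$$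
   Context: The function $\gamma(k)$. For integers $k\ge2$ and $\alpha\neq1$, with $\xi=\frac{4\alpha\nu}{\pi(2\alpha-1)}$, \begin{align*} \gamma(k)={}&\frac1{8\alpha(\alpha-1)\Gamma^+(k-2\alpha,\xi)}\Bigg(-\Gamma^+(k-2\alpha,\xi)-2\,\frac{\alpha(\alpha-1/2)^2\xi^2\,\Gamma^+(k-2\alpha-2,\xi)}{\alpha-1}+8\alpha(\alpha-1/2)\xi\,\Gamma^+(k-2\alpha-1,\xi)\\ &+4\xi^{4\alpha-2}\Gamma^+(k-6\alpha+2,\xi)\left(\frac{2^{-4\alpha}(3\alpha-1)}{\alpha-1}+(\alpha-1/2)B^-(1/2;1+2\alpha,-2+2\alpha)\right)\\ &+\xi^{k-2\alpha}\Gamma(2\alpha+1)e^{-\xi}U(2\alpha+1,1+k-2\alpha,\xi)-\xi^{4\alpha-2}\Gamma(2\alpha+1)\,G^{3,0}_{2,3}\!\left(\xi\,\Big|\begin{matrix}1,\,3-2\alpha\\ 3-4\alpha,\,-6\alpha+k+2,\,0\end{matrix}\right)\Bigg), \end{align*} and for $\alpha=1$, $\gamma(k)$ is the limit of this expression as $\alpha\to1$ (with $\nu$ fixed). Special functions. $\Gamma(z)$ is the gamma function; $\Gamma^+(a,b)=\int_b^\infty t^{a-1}e^{-t}\,dt$; $B(a,b)=\int_0^1u^{a-1}(1-u)^{b-1}du$; $B^-(x;a,b)=\int_0^xu^{a-1}(1-u)^{b-1}du$; $U(a,b,z)=\frac1{\Gamma(a)}\int_0^\infty e^{-zt}t^{a-1}(1+t)^{b-a-1}dt$.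 $G^{3,0}_{2,3}$ is Meijer's G-function: $G^{3,0}_{2,3}\!\left(z\,\Big|\begin{matrix}a_1,a_2\\ b_1,b_2,b_3\end{matrix}\right)=\frac1{2\pi i}\int_L\frac{\Gamma(b_1-t)\Gamma(b_2-t)\Gamma(b_3-t)}{\Gamma(a_1-t)\Gamma(a_2-t)}z^t\,dt$, where $L$ is the standard contour (an upward-oriented path having all poles of $\Gamma(b_j-t)$, $j=1,2,3$, on its right; equivalently a loop beginning and ending at $+\infty$ encircling these poles once clockwise). *)

(* Defs.v *)
From HB Require Import structures.
From mathcomp Require Import all_boot all_order all_algebra complex.
From mathcomp Require Import all_classical all_reals all_analysis.

Set Implicit Arguments.
Unset Strict Implicit.
Unset Printing Implicit Defensive.

Import Order.TTheory GRing.Theory Num.Theory.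
Import numFieldNormedType.Exports.

Local Open Scope classical_set_scope.
Local Open Scope ring_scope.
Local Open Scope complex_scope.

Definition Cintegral (R : realType) (D : set R) (f : R -> R[i]) : R[i] :=
  (\int[lebesgue_measure]_(x in D) complex.Re (f x)) +i*
  (\int[lebesgue_measure]_(x in D) complex.Im (f x)).

(* t ^ z = exp (z * ln t), for real t > 0. *)
Definition Cpow (R : realType) (t : R) (z : R[i]) : R[i] :=
  (t `^ complex.Re z)%:C *
  (cos (complex.Im z * ln t) +i* sin (complex.Im z * ln t)).

(* Euler's integral; it converges when Re z > 0. *)
Definition CGamma_integral (R : realType) (z : R[i]) : R[i] :=
  Cintegral `]0, +oo[ (fun t => Cpow t (z - 1) * (expR (- t))%:C).

(* The gamma function on the complex plane: Euler's integral for Re z > 0,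
   continued by Gamma(z) = Gamma(z + n) / (z (z + 1) ... (z + n - 1)), where
   n = 1 + floor (- Re z) makes Re (z + n) > 0.  At the poles z = 0, -1, ...
   the denominator vanishes and the value is 0. *)
Definition CGamma (R : realType) (z : R[i]) : R[i] :=
  if 0 < complex.Re z then CGamma_integral z
  else let n := (Num.truncn (- complex.Re z)).+1 in
    CGamma_integral (z + n%:R) / \prod_(i < n) (z + i%:R).

(* The gamma function takes real values on the real line. *)
Definition Gamma (R : realType) (x : R) : R := complex.Re (CGamma x%:C).

Definition upper_gamma (R : realType) (a b : R) : R :=
  \int[lebesgue_measure]_(t in `]b, +oo[) (t `^ (a - 1) * expR (- t)).

Definition Beta (R : realType) (a b : R) : R :=
  \int[lebesgue_measure]_(u in `]0, 1[) (u `^ (a - 1) * (1 - u) `^ (b - 1)).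

Definition lower_beta (R : realType) (x a b : R) : R :=
  \int[lebesgue_measure]_(u in `]0, x[) (u `^ (a - 1) * (1 - u) `^ (b - 1)).

(* The confluent hypergeometric function of the second kind, for a, z > 0. *)
Definition hyperU (R : realType) (a b z : R) : R :=
  (Gamma a)^-1 *
  \int[lebesgue_measure]_(t in `]0, +oo[)
     (expR (- (z * t)) * t `^ (a - 1) * (1 + t) `^ (b - a - 1)).

Definition meijerG_integrand (R : realType) (a1 a2 b1 b2 b3 z : R)
    (t : R[i]) : R[i] :=
  CGamma (b1%:C - t) * CGamma (b2%:C - t) * CGamma (b3%:C - t)
  / (CGamma (a1%:C - t) * CGamma (a2%:C - t)) * Cpow z t.

(* G^{3,0}_{2,3}(z | a1, a2; b1, b2, b3) for real parameters and z > 0.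
   The contour is the upward vertical line of abscissa c: the poles of
   Gamma(b_j - t), at t = b_j + n with n natural, all lie on its right. *)
Definition meijerG (R : realType) (a1 a2 b1 b2 b3 z : R) : R[i] :=
  let c := Num.min b1 (Num.min b2 b3) - 1 in
  ((2 * pi)%:C * (0 +i* 1))^-1 *
  Cintegral setT (fun y =>
    meijerG_integrand a1 a2 b1 b2 b3 z (c +i* y) * (0 +i* 1)).

Definition xi (R : realType) (alpha nu : R) : R :=
  4 * alpha * nu / (pi * (2 * alpha - 1)).

(* The Meijer function below has real parameters, and its integrand at the
   conjugate of t is the conjugate of its integrand at t, so that its value
   is real and taking Re loses nothing. *)
Definition gamma_formula (R : realType) (alpha nu : R) (k : nat) : R :=
  let K : R := k%:R in
  let x := xi alpha nu in
  (8 * alpha * (alpha - 1) * upper_gamma (K - 2 * alpha) x)^-1 *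
  (- upper_gamma (K - 2 * alpha) x
   - 2 * (alpha * (alpha - 1 / 2) ^+ 2 * x ^+ 2
          * upper_gamma (K - 2 * alpha - 2) x / (alpha - 1))
   + 8 * alpha * (alpha - 1 / 2) * x * upper_gamma (K - 2 * alpha - 1) x
   + 4 * x `^ (4 * alpha - 2) * upper_gamma (K - 6 * alpha + 2) x
     * (2 `^ (- 4 * alpha) * (3 * alpha - 1) / (alpha - 1)
        + (alpha - 1 / 2)
          * lower_beta (1 / 2) (1 + 2 * alpha) (- 2 + 2 * alpha))
   + x `^ (K - 2 * alpha) * Gamma (2 * alpha + 1) * expR (- x)
     * hyperU (2 * alpha + 1) (1 + K - 2 * alpha) x
   - x `^ (4 * alpha - 2) * Gamma (2 * alpha + 1)
     * complex.Re (meijerG 1 (3 - 2 * alpha)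
                   (3 - 4 * alpha) (- 6 * alpha + K + 2) 0 x)).

(* At alpha = 1 the limit is over alpha -> 1, alpha != 1, with nu fixed; xi
   varies along with alpha. *)
Definition gamma (R : realType) (alpha nu : R) (k : nat) : R :=
  if alpha == 1 then lim (gamma_formula a nu k @[a --> (1 : R)^'])
  else gamma_formula alpha nu k.

(* Meant for alpha > 1/2, as is gamma_rate. *)
Definition gamma_const (R : realType) (alpha nu : R) : R :=
  if 3 / 4 < alpha then 8 * alpha * nu / (pi * (4 * alpha - 3))
  else if alpha == 3 / 4 then 6 * nu / pi
  else ((3 * alpha - 1)
          / (2 `^ (4 * alpha + 1) * alpha * (alpha - 1) ^+ 2)
        + (alpha - 1 / 2) * lower_beta (1 / 2) (2 * alpha + 1) (2 * alpha - 2)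
          / (2 * (alpha - 1) * alpha)
        - Beta (2 * alpha) (3 - 4 * alpha) / (4 * (alpha - 1)))
       * xi alpha nu `^ (4 * alpha - 2).

Definition gamma_rate (R : realType) (alpha : R) (k : nat) : R :=
  if 3 / 4 < alpha then k%:R^-1
  else if alpha == 3 / 4 then ln k%:R / k%:R
  else k%:R `^ (2 - 4 * alpha).

(* Main.v *)
From HB Require Import structures.
From mathcomp Require Import all_boot all_order all_algebra complex.
From mathcomp Require Import all_classical all_reals all_analysis.
From mathcomp Require Import measurable_realfun.
From mathcomp Require Import ring lra.
Require Import Defs.
Set Implicit Arguments.
Unset Strict Implicit.
Unset Printing Implicit Defensive.
Import Order.TTheory GRing.Theory Num.Theory.
Import numFieldNormedType.Exports.
Local Open Scope classical_set_scope.
Local Open Scope ring_scope.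

(**
Substituting t = xi y in the incomplete gamma functions and in the integral for U
turns gamma(k) into the mean of Phi(1/Y) / (8 alpha (alpha - 1)), where Y > 1 has
density proportional to y^(k - 2 alpha - 1) e^(- xi y), for one function Phi on
(0, 1) independent of k and nu. As k grows, Y concentrates around k / xi, and only
the behaviour of Phi at 0 matters: it is of order r^(4 alpha - 2), r log(1/r) or r,
according to the position of alpha with respect to 3/4.

The Meijer function is brought to this form as follows. By the beta integral, its
Mellin-Barnes integrand on the line Re t = c is the Fourier transform of a positive
density in three variables; it decays like 1/y^2. The integral over the line is the
limit, as e tends to 0, of its average against e^(- e |y|), that is, of an average of
the density against the Poisson kernel of the phase; the kernel concentrates where the
phase vanishes, which eliminates one of the three variables. What remains is
  int_xi^oo t^(b2 - 1) e^(- t) int_(xi/t)^1 u^(b1 - 1) (1 - u)^(a2 - b1 - 1) du dt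
divided by Gamma(a2 - b1).

For alpha > 3/4 the leading terms of Phi cancel: integrating the derivative of
r^(2 - 4 alpha) Phi(r) from r to 1 expresses Phi / (8 alpha (alpha - 1)) through a
remainder of size |alpha - 1| u^2, in a form that stays bounded and converges as
alpha tends to 1. The moments of 1/Y follow from the recurrence for the incomplete
gamma function, and the powers and logarithms from tangent lines at xi / k.
*)

(** * Dominated convergence, affine substitutions, primitives on open intervals *)

(** The parameters of the Meijer function are special: [Gamma(b1 - t) / Gamma(a2 - t)] is a beta
    integral with second argument [2 alpha], [Gamma(- t) / Gamma(1 - t)] is [1 / (- t)], and
    [Gamma(b2 - t)] is Euler's integral. Of the two orders of decay along the contour, one comes
    from [1 / (- t)], the other from the functional equation applied to [Gamma(b2 - t)]; Stirling's
    formula does not enter.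

    For Phi the obstacle is the prefactor [1 / (alpha - 1)]. When [alpha > 3/4], the linear
    coefficient of Phi at 0 receives [2 alpha (4 alpha - 3)] from the elementary terms and
    [- 2 alpha / (4 alpha - 3)] from the truncated beta integral; the sum is [8 alpha (alpha - 1) (4
    alpha - 2) / (4 alpha - 3)], which contains the factor to be cancelled. The boundary value
    Phi(1) must contain it too, and there the coefficient has itself a pole at 1: a beta-like
    integral over []0, 1/2[] has to be expanded to second order in [alpha - 1].

    All comparison functions are at most quadratic in r, so two moments of 1/Y suffice. *)

Lemma dominated_integrable_fun d (T : measurableType d) (R : realType)
  (m : {measure set T -> \bar R}) (D : set T) (f g : T -> R) :
  measurable D -> measurable_fun D f -> m.-integrable D (EFin \o g) ->
  (forall x, D x -> `|f x| <= g x) -> m.-integrable D (EFin \o f).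
Proof.
move=> mD mf ig fg; apply: le_integrable ig => //.
  exact/measurable_EFinP.
move=> x Dx /=; rewrite lee_fin (le_trans (fg _ Dx))// ler_norm //.
Qed.

Lemma cvg_Rintegral_dominated d (T : measurableType d) (R : realType)
  (m : {measure set T -> \bar R}) (D : set T) (f : nat -> T -> R) (l g : T -> R) :
  measurable D -> m.-integrable D (EFin \o g) -> measurable_fun D l ->
  (\forall n \near \oo, measurable_fun D (f n)) ->
  (\forall n \near \oo, forall x, D x -> `|f n x| <= g x) ->
  {ae m, forall x, D x -> f n x @[n --> \oo] --> l x} ->
  \int[m]_(x in D) f n x @[n --> \oo] --> \int[m]_(x in D) l x.
Proof.
move=> mD ig ml [N1 _ mf] [N2 _ fg] fl.
rewrite -(cvg_shiftn (N1 + N2)).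
have [] := @dominated_convergence _ T R m D mD
   (fun n x => (f (n + (N1 + N2))%N x)%:E) (EFin \o l) (EFin \o g).
- by move=> n; apply/measurable_EFinP; apply: mf; rewrite /= addnA addnAC leq_addl.
- exact/measurable_EFinP.
- apply: filterS fl => x fl /fl {}fl; apply: cvg_EFin; first exact: nearW.
  by rewrite (cvg_shiftn _ (fun n => f n x)).
- by [].
- apply: aeW => x n Dx; rewrite /= lee_fin; apply: fg => //=.
  by rewrite addnA leq_addl.
move=> il _ cvgE; apply: fine_cvg.
rewrite /Rintegral fineK; last exact: integrable_fin_num.
exact: cvgE.
Qed.

(** A limit along a punctured neighbourhood is tested on sequences, which brings the continuous
    parameter back to the sequential theorem. *)
Lemma cvg_Rintegral_dnbhs d (T : measurableType d) (R : realType)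
  (m : {measure set T -> \bar R}) (D : set T) (f : R -> T -> R) (l g : T -> R) (a0 : R) :
  measurable D -> m.-integrable D (EFin \o g) -> measurable_fun D l ->
  (\forall a \near a0^', measurable_fun D (f a)) ->
  (\forall a \near a0^', forall x, D x -> `|f a x| <= g x) ->
  (forall x, D x -> f a x @[a --> a0^'] --> l x) ->
  \int[m]_(x in D) f a x @[a --> a0^'] --> \int[m]_(x in D) l x.
Proof.
move=> mD ig ml mf fg fl; apply/cvgr_dnbhsP => u [ua0 ucvg].
have uF : u n @[n --> \oo] --> a0^'.
  move=> P /= [e /= e0 eP].
  have /cvgrPdist_lt /(_ _ e0) := ucvg.
  by apply: filterS => n /= ?; apply: eP => //=.
apply: (cvg_Rintegral_dominated mD ig ml).
- exact: (uF _ mf).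
- exact: (uF _ fg).
- apply: aeW => x /fl; move/cvgr_dnbhsP; exact.
Qed.

Lemma gt0_muleBr (R : realType) (c : R) (A B : \bar R) : 0 < c ->
  (c%:E * (A - B) = c%:E * A - c%:E * B)%E.
Proof.
move=> c0; have c0E : (0 < c%:E)%E by rewrite lte_fin.
by case: A B => [a||] [b||]; rewrite /= ?gt0_muley ?gt0_muleNy//= -?EFinD -?EFinM ?mulrBr.
Qed.

Lemma fine_gt0_mule (R : realType) (c : R) (A : \bar R) : 0 < c ->
  fine (c%:E * A) = c * fine A.
Proof.
move=> c0; have c0E : (0 < c%:E)%E by rewrite lte_fin.
by case: A => [a||]; rewrite /= ?gt0_muley ?gt0_muleNy//= mulr0.
Qed.

Lemma gt0_mule_lty (R : realType) (c : R) (A : \bar R) : 0 < c ->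
  (c%:E * A < +oo)%E = (A < +oo)%E.
Proof.
move=> c0; have c0E : (0 < c%:E)%E by rewrite lte_fin.
by case: A => [a||]; rewrite /= ?gt0_muley ?gt0_muleNy//= !ltry.
Qed.

Lemma integrableD_EFin d (T : measurableType d) (R : realType)
  (m : {measure set T -> \bar R}) (D : set T) (f g : T -> R) : measurable D ->
  m.-integrable D (EFin \o f) -> m.-integrable D (EFin \o g) ->
  m.-integrable D (EFin \o (fun x => f x + g x)).
Proof. by move=> mD fi gi; exact: (integrableD mD fi gi). Qed.

Lemma integrableB_EFin d (T : measurableType d) (R : realType)
  (m : {measure set T -> \bar R}) (D : set T) (f g : T -> R) : measurable D ->
  m.-integrable D (EFin \o f) -> m.-integrable D (EFin \o g) ->
  m.-integrable D (EFin \o (fun x => f x - g x)).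
Proof. by move=> mD fi gi; exact: (integrableB mD fi gi). Qed.

Lemma integrableZl_EFin d (T : measurableType d) (R : realType)
  (m : {measure set T -> \bar R}) (D : set T) (k : R) (f : T -> R) : measurable D ->
  m.-integrable D (EFin \o f) -> m.-integrable D (EFin \o (fun x => k * f x)).
Proof. by move=> mD fi; exact: (integrableZl mD k fi). Qed.

Section lebesgue_dominated.
Context {R : realType}.
Local Notation mu := (@lebesgue_measure R).

Lemma lebesgue_dominated_integrable (D : set R) (f g : R -> R) :
  measurable D -> measurable_fun D f -> mu.-integrable D (EFin \o g) ->
  (forall x, D x -> `|f x| <= g x) -> mu.-integrable D (EFin \o f).
Proof. exact: (@dominated_integrable_fun _ (measurableTypeR R)). Qed.

Lemma cvg_lebesgue_dominated (D : set R) (f : nat -> R -> R) (l g : R -> R) :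
  measurable D -> mu.-integrable D (EFin \o g) -> measurable_fun D l ->
  (\forall n \near \oo, measurable_fun D (f n)) ->
  (\forall n \near \oo, forall x, D x -> `|f n x| <= g x) ->
  {ae mu, forall x, D x -> f n x @[n --> \oo] --> l x} ->
  \int[mu]_(x in D) f n x @[n --> \oo] --> \int[mu]_(x in D) l x.
Proof. exact: (@cvg_Rintegral_dominated _ (measurableTypeR R)). Qed.

Lemma cvg_lebesgue_dnbhs (D : set R) (f : R -> R -> R) (l g : R -> R) (a0 : R) :
  measurable D -> mu.-integrable D (EFin \o g) -> measurable_fun D l ->
  (\forall a \near a0^', measurable_fun D (f a)) ->
  (\forall a \near a0^', forall x, D x -> `|f a x| <= g x) ->
  (forall x, D x -> f a x @[a --> a0^'] --> l x) ->
  \int[mu]_(x in D) f a x @[a --> a0^'] --> \int[mu]_(x in D) l x.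
Proof. exact: (@cvg_Rintegral_dnbhs _ (measurableTypeR R)). Qed.

Lemma integrable_setT_restrict (D : set R) (f : R -> R) : measurable D ->
  mu.-integrable D (EFin \o f) -> mu.-integrable setT (EFin \o (f \_ D)).
Proof. by move=> mD fi; rewrite -restrict_EFin; exact: (@integrable_mkcond _ (measurableTypeR R) R mu D (EFin \o f) mD).1. Qed.

Lemma integrable_restrict_setT (D : set R) (f : R -> R) : measurable D ->
  mu.-integrable setT (EFin \o (f \_ D)) -> mu.-integrable D (EFin \o f).
Proof. by move=> mD; rewrite -restrict_EFin => fi; exact: (@integrable_mkcond _ (measurableTypeR R) R mu D (EFin \o f) mD).2. Qed.

Lemma lebesgue_integrableS (D E : set R) (f : R -> R) :
  measurable E -> measurable D -> D `<=` E ->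
  mu.-integrable E (EFin \o f) -> mu.-integrable D (EFin \o f).
Proof. exact: (@integrableS _ (measurableTypeR R)). Qed.

Lemma restrict0E (f : R -> R) (D : set R) x : (f \_ D) x = if x \in D then f x else 0.
Proof. by rewrite patchE. Qed.

Lemma lebesgue_integrableD (D : set R) (f g : R -> R) : measurable D ->
  mu.-integrable D (EFin \o f) -> mu.-integrable D (EFin \o g) ->
  mu.-integrable D (EFin \o (fun x => f x + g x)).
Proof. exact: (@integrableD_EFin _ (measurableTypeR R)). Qed.

Lemma lebesgue_integrableB (D : set R) (f g : R -> R) : measurable D ->
  mu.-integrable D (EFin \o f) -> mu.-integrable D (EFin \o g) ->
  mu.-integrable D (EFin \o (fun x => f x - g x)).
Proof. exact: (@integrableB_EFin _ (measurableTypeR R)). Qed.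

Lemma lebesgue_integrableZ (D : set R) (k : R) (f : R -> R) : measurable D ->
  mu.-integrable D (EFin \o f) -> mu.-integrable D (EFin \o (fun x => k * f x)).
Proof. exact: (@integrableZl_EFin _ (measurableTypeR R)). Qed.

End lebesgue_dominated.

(** * Affine changes of variable in Lebesgue integrals *)

Section affine.
Context {R : realType}.
Local Notation mu := (@lebesgue_measure R).

Lemma measurable_affine (c b : R) :
  measurable_fun setT ((fun x : R => c * x + b) : measurableTypeR R -> measurableTypeR R).
Proof. by apply: measurable_funD => //; apply: measurable_funM. Qed.

Lemma affine_preimage_itvoc (c b : R) (x y : R) : 0 < c ->
  (fun t => c * t + b) @^-1` `]x, y]%classic = `](x - b) / c, (y - b) / c]%classic.
Proof.
move=> c0; apply/seteqP; split => t /=; rewrite !in_itv/= ltr_pdivrMr// ler_pdivlMr//.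
  by move=> /andP[? ?]; apply/andP; split; lra.
by move=> /andP[? ?]; apply/andP; split; lra.
Qed.

(** The image of Lebesgue measure under [x |-> c x + b], multiplied by [c], gives half-open
    intervals their length; uniqueness of Lebesgue measure identifies the two. *)
Lemma ge0_integral_affine (c b : R) (f : R -> \bar R) : 0 < c ->
  measurable_fun setT f -> (forall x, 0 <= f x)%E ->
  (\int[mu]_x f x = c%:E * \int[mu]_x f (c * x + b)%R)%E.
Proof.
move=> c0 mf f0.
pose phi := (fun x : R => c * x + b) : measurableTypeR R -> measurableTypeR R.
have mphi : measurable_fun setT phi := measurable_affine c b.
pose nu := mscale (NngNum (ltW c0)) (pushforward mu phi).
have e := @ge0_integral_pushforward _ _ _ _ _ _ mphi mu setT f measurableT mf (fun x _ => f0 x).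
rewrite preimage_setT in e.
rewrite -[X in (_ * X)%E]e.
transitivity (\int[nu mphi]_x f x)%E; last first.
  by rewrite (ge0_integral_mscale _ _ (NngNum (ltW c0))).
apply: eq_measure_integral => A mA _.
apply: (@lebesgue_measure_unique _ (nu mphi)) => // _ [[x y] _ <-] /=.
rewrite /mscale/= /pushforward/= affine_preimage_itvoc//.
rewrite !lebesgue_measure_itv/= !lte_fin ltr_pM2r ?invr_gt0// ltrD2r.
case: ifPn => _; last by rewrite mule0.
rewrite -!EFinD -EFinM; congr EFin; field; rewrite gt_eqF//.
Qed.

Lemma ge0_integral_opp (f : R -> \bar R) :
  measurable_fun setT f -> (forall x, 0 <= f x)%E ->
  (\int[mu]_x f x = \int[mu]_x f (- x)%R)%E.
Proof.
move=> mf f0.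
have mphi : measurable_fun setT (-%R : measurableTypeR R -> measurableTypeR R).
  exact: oppr_measurable.
have e := @ge0_integral_pushforward _ _ _ _ _ _ mphi mu setT f measurableT mf (fun x _ => f0 x).
rewrite preimage_setT in e.
rewrite [RHS](_ : _ = \int[mu]_x ((f \o -%R) x))%E// -e.
by apply: eq_measure_integral => A mA _; apply/esym; apply: lebesgue_measureN.
Qed.

Lemma integral_affine (c b : R) (f : R -> \bar R) : 0 < c ->
  measurable_fun setT f ->
  (\int[mu]_x f x = c%:E * \int[mu]_x f (c * x + b)%R)%E.
Proof.
move=> c0 mf; rewrite integralE [X in (_ * X)%E]integralE.
rewrite (ge0_integral_affine b c0 (measurable_funepos mf))//.
rewrite (ge0_integral_affine b c0 (measurable_funeneg mf))//.
under [X in (_ = _ * (X - _))%E]eq_integral do rewrite funepos_comp/=.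
under [X in (_ = _ * (_ - X))%E]eq_integral do rewrite funeneg_comp/=.
exact/esym/gt0_muleBr.
Qed.

Lemma integral_opp (f : R -> \bar R) : measurable_fun setT f ->
  (\int[mu]_x f x = \int[mu]_x f (- x)%R)%E.
Proof.
move=> mf; rewrite integralE [RHS]integralE.
rewrite (ge0_integral_opp (measurable_funepos mf))//.
rewrite (ge0_integral_opp (measurable_funeneg mf))//.
under [X in (_ = X - _)%E]eq_integral do rewrite funepos_comp/=.
by under [X in (_ = _ - X)%E]eq_integral do rewrite funeneg_comp/=.
Qed.

Lemma Rintegral_affine (c b : R) (f : R -> R) : 0 < c ->
  measurable_fun setT f ->
  \int[mu]_x f x = c * \int[mu]_x f (c * x + b).
Proof.
move=> c0 mf; rewrite /Rintegral (integral_affine b c0); last exact/measurable_EFinP.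
exact: fine_gt0_mule.
Qed.

Lemma Rintegral_opp (f : R -> R) : measurable_fun setT f ->
  \int[mu]_x f x = \int[mu]_x f (- x).
Proof. by move=> mf; rewrite /Rintegral integral_opp//; exact/measurable_EFinP. Qed.

Lemma integrable_affine (c b : R) (f : R -> R) : 0 < c ->
  mu.-integrable setT (EFin \o f) ->
  mu.-integrable setT (EFin \o (fun x => f (c * x + b))).
Proof.
move=> c0 /integrableP[/measurable_EFinP mf fi]; apply/integrableP; split.
  apply/measurable_EFinP; apply: (measurableT_comp mf).
  exact: measurable_affine.
rewrite (ge0_integral_affine b c0) in fi; last 2 first.
- by apply: measurableT_comp => //; exact/measurable_EFinP.
- by move=> x.
by move: fi; rewrite gt0_mule_lty.
Qed.

Lemma integrable_opp (f : R -> R) :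
  mu.-integrable setT (EFin \o f) -> mu.-integrable setT (EFin \o (fun x => f (- x))).
Proof.
move=> /integrableP[/measurable_EFinP mf fi]; apply/integrableP; split.
  by apply/measurable_EFinP; apply: (measurableT_comp mf); exact: oppr_measurable.
by rewrite ge0_integral_opp// in fi; do 2 apply: measurableT_comp => //.
Qed.

Lemma integrable_onem (f : R -> R) :
  mu.-integrable setT (EFin \o f) -> mu.-integrable setT (EFin \o (fun x => f (1 - x))).
Proof.
move=> /(integrable_affine 1 ltr01)/integrable_opp; apply: eq_integrable => // x _ /=.
by rewrite mul1r addrC.
Qed.

Lemma Rintegral_onem (f : R -> R) : measurable_fun setT f ->
  \int[mu]_x f x = \int[mu]_x f (1 - x).
Proof.
move=> mf; rewrite (Rintegral_affine 1 ltr01 mf) mul1r Rintegral_opp.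
  by apply: eq_Rintegral => x _; rewrite mul1r addrC.
by apply: (measurableT_comp mf); exact: measurable_affine.
Qed.

End affine.

(** * The fundamental theorem of calculus on open and unbounded intervals *)

Section ftc_open.
Context {R : realType}.
Local Notation mu := (@lebesgue_measure R).

Section exhaustion.
Variables (D : set R) (f F : R -> R) (a b : nat -> R).
Hypotheses (mD : measurable D) (ab : forall n, a n < b n)
  (abD : forall n, `[a n, b n] `<=` D)
  (covD : forall x, D x -> \forall n \near \oo, a n <= x <= b n)
  (cf : forall x, D x -> {for x, continuous f})
  (dF : forall x, D x -> is_derive x 1 F (f x)).

Let FTC n : (\int[mu]_(x in `[a n, b n]) (f x)%:E = (F (b n) - F (a n))%:E)%E.
Proof.
rewrite (@continuous_FTC2 R f F)//.
- apply: continuous_in_subspaceT => x; rewrite inE => /abD/cf; exact.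
- have dx x : a n <= x <= b n -> derivable F x 1.
    by move=> axb; have [] := dF (@abD n x _); rewrite /= ?in_itv.
  have cx x : a n <= x <= b n -> F t @[t --> x] --> F x.
    by move=> /dx /derivable1_diffP /differentiable_continuous.
  split.
  + by move=> x; rewrite in_itv/= => /andP[ax xb]; apply: dx; rewrite !ltW.
  + by apply: cvg_at_right_filter; apply: cx; rewrite lexx ltW.
  + by apply: cvg_at_left_filter; apply: cx; rewrite lexx ltW.
- move=> x; rewrite in_itv/= => /andP[ax xb]; rewrite derive1E.
  have Dx : D x by apply: (@abD n); rewrite /= in_itv/= !ltW.
  by have [_ ->] := dF Dx.
Qed.

Let fn n x := f x * \1_(`[a n, b n]) x.

Let fn_cvg x : D x -> fn n x @[n --> \oo] --> f x.
Proof.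
move=> /covD axb; apply: cvg_near_cst; apply: filterS axb => n axb.
by rewrite /fn indicE mem_set ?mulr1//= in_itv.
Qed.

Let intfn n : (\int[mu]_(x in D) (fn n x)%:E = (F (b n) - F (a n))%:E)%E.
Proof.
rewrite -FTC -[in RHS](setIidr (@abD n)) integral_mkcondr.
apply: eq_integral => x _; rewrite restrict_EFin /fn /= patchE indicE.
by case: (_ \in _); rewrite ?mulr1 ?mulr0.
Qed.

(** Fatou's lemma on the truncations to [[a n, b n]], whose integrals are the increments of [F]:
    integrability of a nonnegative function is read off from its primitive. *)
Lemma ge0_exhaustion_integrable (M : R) :
  measurable_fun D f -> (forall x, D x -> 0 <= f x) ->
  (forall n, F (b n) - F (a n) <= M) ->
  mu.-integrable D (EFin \o f).
Proof.
move=> mf f0 FM.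
apply/integrableP; split; first exact/measurable_EFinP.
have -> : (\int[mu]_(x in D) `|(EFin \o f) x| = \int[mu]_(x in D) (f x)%:E)%E.
  by apply: eq_integral => x; rewrite inE => Dx /=; rewrite ger0_norm// f0.
have mfn n : measurable_fun D (EFin \o (fn n)).
  by apply/measurable_EFinP; apply: measurable_funM => //; exact: measurable_indic.
have fn0 n x : D x -> (0 <= (fn n x)%:E)%E.
  by move=> Dx; rewrite lee_fin mulr_ge0// f0.
have := fatou mu mD mfn fn0.
rewrite (_ : \int[mu]_(x in D) _ = \int[mu]_(x in D) (f x)%:E)%E; last first.
  apply: eq_integral => x; rewrite inE => Dx; rewrite is_cvg_limn_einfE.
    by apply/cvg_lim => //; apply: cvg_EFin; [exact: nearW|exact: fn_cvg].
  by apply/cvg_ex; exists (f x)%:E; apply: cvg_EFin; [exact: nearW|exact: fn_cvg].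
move=> /le_lt_trans; apply.
under eq_fun do rewrite intfn.
apply: (@le_lt_trans _ _ M%:E); last exact: ltry.
rewrite limn_einf_lim; apply: lime_le; first exact: is_cvg_einfs.
apply: nearW => n; apply: (@le_trans _ _ (F (b n) - F (a n))%:E); last by rewrite lee_fin.
by apply: ereal_inf_lbound; exists n => //=.
Qed.

(** Dominated convergence of the truncations, with [|f|] as dominating function. *)
Lemma exhaustion_Rintegral (A B : R) :
  mu.-integrable D (EFin \o f) ->
  F (a n) @[n --> \oo] --> A -> F (b n) @[n --> \oo] --> B ->
  \int[mu]_(x in D) f x = B - A.
Proof.
move=> fi FA FB.
have mf : measurable_fun D f by apply/measurable_EFinP; exact: measurable_int fi.
have /cvg_unique : \int[mu]_(x in D) fn n x @[n --> \oo] --> \int[mu]_(x in D) f x.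
  apply: (@cvg_Rintegral_dominated _ (measurableTypeR R) R mu D fn f (fun x => `|f x|)) => //.
  - exact: integrable_norm.
  - apply: nearW => n; apply: measurable_funM => //; exact: measurable_indic.
  - apply: nearW => n x Dx; rewrite /fn normrM ler_piMr// indicE.
    by case: (_ \in _); rewrite ?normr1 ?normr0.
  - by apply: aeW => x; exact: fn_cvg.
apply => //.
rewrite (_ : (fun n => _) = (fun n => F (b n) - F (a n))); first exact: cvgB.
by apply/funext => n; rewrite /Rintegral intfn.
Qed.

End exhaustion.

Lemma ge0_exhaustion_Rintegral (D : set R) (f F : R -> R) (a b : nat -> R) (A B : R) :
  measurable D -> (forall n, a n < b n) -> (forall n, `[a n, b n] `<=` D) ->
  (forall x, D x -> \forall n \near \oo, a n <= x <= b n) ->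
  (forall x, D x -> {for x, continuous f}) ->
  (forall x, D x -> is_derive x 1 F (f x)) ->
  measurable_fun D f -> (forall x, D x -> 0 <= f x) ->
  F (a n) @[n --> \oo] --> A -> F (b n) @[n --> \oo] --> B ->
  mu.-integrable D (EFin \o f) /\ \int[mu]_(x in D) f x = B - A.
Proof.
move=> mD ab abD covD cf dF mf f0 FA FB.
suff fi : mu.-integrable D (EFin \o f).
  by split => //; exact: (exhaustion_Rintegral mD ab abD covD cf dF fi FA FB).
have : bounded_fun (fun n => F (b n) - F (a n)).
  by apply: cvg_seq_bounded; apply/cvg_ex; exists (B - A); exact: cvgB.
move=> [M [_ /(_ (M + 1))]]; rewrite ltrDl ltr01 => /(_ isT) FM.
apply: (ge0_exhaustion_integrable mD ab abD covD cf dF (M := M + 1)) => // n.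
exact: (le_trans (ler_norm _) (FM n I)).
Qed.

Lemma invS_cvg0 k : ((n + k).+1%:R^-1 : R) @[n --> \oo] --> (0 : R).
Proof. by rewrite (cvg_shiftn k (fun n => (n.+1%:R^-1 : R))); exact: cvg_harmonic. Qed.

Section oy.
Variables (c : R) (f F : R -> R) (A B : R).
Let D : set R := `]c, +oo[%classic.
Hypotheses (cf : forall x, c < x -> {for x, continuous f})
  (dF : forall x, c < x -> is_derive x 1 F (f x))
  (FA : F x @[x --> c^'+] --> A) (FB : F x @[x --> +oo] --> B).

Let a n := c + (n.+1)%:R^-1.
Let b n := c + (n.+2)%:R.

Let ab n : a n < b n.
Proof.
rewrite /a /b ltrD2l; apply: (@le_lt_trans _ _ 1); last by rewrite ltr1n.
by rewrite invf_le1// ler1n.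
Qed.

Let abD n : `[a n, b n] `<=` D.
Proof.
move=> x; rewrite /D /= !in_itv /= andbT => /andP[ax _].
by apply: lt_le_trans ax; rewrite /a ltrDl invr_gt0.
Qed.

Let a_cvg : a n @[n --> \oo] --> c.
Proof. by rewrite -[X in _ --> X]addr0; apply: cvgD; [exact: cvg_cst|exact: cvg_harmonic]. Qed.

Let b_cvg : b n @[n --> \oo] --> +oo.
Proof.
apply/cvgryPge => M; near=> n.
rewrite /b -lerBlDl; apply: (@le_trans _ _ n%:R); last by rewrite ler_nat leqW.
by near: n; exact: nbhs_infty_ger.
Unshelve. all: end_near. Qed.

Let covD x : D x -> \forall n \near \oo, a n <= x <= b n.
Proof.
rewrite /D/= in_itv/= andbT => cx; near=> n; apply/andP; split.
  by apply: ltW; near: n; exact: (cvgr_lt _ a_cvg).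
by near: n; move/cvgryPge : b_cvg; exact.
Unshelve. all: end_near. Qed.

Let FaA : F (a n) @[n --> \oo] --> A.
Proof.
move/cvg_at_rightP : FA; apply; split; last exact: a_cvg.
by move=> n; rewrite /a ltrDl invr_gt0.
Qed.

Let FbB : F (b n) @[n --> \oo] --> B.
Proof. by move/cvg_pinftyP : FB; apply; exact: b_cvg. Qed.

Let cfD x : D x -> {for x, continuous f}.
Proof. by rewrite /D/= in_itv/= andbT; exact: cf. Qed.

Let dFD x : D x -> is_derive x 1 F (f x).
Proof. by rewrite /D/= in_itv/= andbT; exact: dF. Qed.

Lemma Rintegral_oy_FTC : mu.-integrable D (EFin \o f) -> \int[mu]_(x in D) f x = B - A.
Proof. by move=> fi; exact: (@exhaustion_Rintegral D f F a b (measurable_itv _) ab abD covD cfD dFD A B fi FaA FbB). Qed.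

Lemma ge0_Rintegral_oy_FTC : (forall x, c < x -> 0 <= f x) ->
  mu.-integrable D (EFin \o f) /\ \int[mu]_(x in D) f x = B - A.
Proof.
move=> f0; apply: (@ge0_exhaustion_Rintegral D f F a b A B (measurable_itv _) ab abD covD cfD dFD _ _ FaA FbB) => //.
  apply: open_continuous_measurable_fun; first exact: interval_open.
  by move=> x; rewrite inE; exact: cfD.
by move=> x; rewrite /D/= in_itv/= andbT; exact: f0.
Qed.

End oy.

Section oo.
Variables (c d : R) (f F : R -> R) (A B : R).
Let D : set R := `]c, d[%classic.
Hypotheses (cd : c < d) (cf : forall x, c < x < d -> {for x, continuous f})
  (dF : forall x, c < x < d -> is_derive x 1 F (f x))
  (FA : F x @[x --> c^'+] --> A) (FB : F x @[x --> d^'-] --> B).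

Let h n := (d - c) * (n + 2).+1%:R^-1.
Let a n := c + h n.
Let b n := d - h n.

Let h_gt0 n : 0 < h n. Proof. by rewrite mulr_gt0// ?subr_gt0// invr_gt0. Qed.

Let h_lt n : h n < (d - c) / 2.
Proof.
rewrite ltr_pM2l ?subr_gt0// ltf_pV2 ?posrE// ltr_nat.
by rewrite addn2.
Qed.

Let h_cvg : h n @[n --> \oo] --> (0 : R).
Proof. by rewrite -[X in _ --> X](mulr0 (d - c)); apply: cvgMr; exact: invS_cvg0. Qed.

Let ab n : a n < b n. Proof. have := h_lt n; rewrite /a /b; lra. Qed.

Let abD n : `[a n, b n] `<=` D.
Proof.
move=> x; rewrite /D /= !in_itv /= /a /b => /andP[ax bx].
have := h_gt0 n; lra.
Qed.

Let a_cvg : a n @[n --> \oo] --> c.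
Proof. by rewrite -[X in _ --> X]addr0; apply: cvgD; [exact: cvg_cst|exact: h_cvg]. Qed.

Let b_cvg : b n @[n --> \oo] --> d.
Proof. by rewrite -[X in _ --> X]subr0; apply: cvgB; [exact: cvg_cst|exact: h_cvg]. Qed.

Let covD x : D x -> \forall n \near \oo, a n <= x <= b n.
Proof.
rewrite /D/= in_itv/= => /andP[cx xd]; near=> n; apply/andP; split.
  by apply: ltW; near: n; exact: (cvgr_lt _ a_cvg).
by apply: ltW; near: n; exact: (cvgr_gt _ b_cvg).
Unshelve. all: end_near. Qed.

Let FaA : F (a n) @[n --> \oo] --> A.
Proof.
move/cvg_at_rightP : FA; apply; split; last exact: a_cvg.
by move=> n; rewrite /a ltrDl.
Qed.

Let FbB : F (b n) @[n --> \oo] --> B.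
Proof.
move/cvg_at_leftP : FB; apply; split; last exact: b_cvg.
by move=> n; rewrite /b gtrDl oppr_lt0.
Qed.

Let cfD x : D x -> {for x, continuous f}.
Proof. by rewrite /D/= in_itv/=; exact: cf. Qed.

Let dFD x : D x -> is_derive x 1 F (f x).
Proof. by rewrite /D/= in_itv/=; exact: dF. Qed.

Lemma Rintegral_oo_FTC : mu.-integrable D (EFin \o f) -> \int[mu]_(x in D) f x = B - A.
Proof. by move=> fi; exact: (@exhaustion_Rintegral D f F a b (measurable_itv _) ab abD covD cfD dFD A B fi FaA FbB). Qed.

Lemma ge0_Rintegral_oo_FTC : (forall x, c < x < d -> 0 <= f x) ->
  mu.-integrable D (EFin \o f) /\ \int[mu]_(x in D) f x = B - A.
Proof.
move=> f0; apply: (@ge0_exhaustion_Rintegral D f F a b A B (measurable_itv _) ab abD covD cfD dFD _ _ FaA FbB) => //.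
  apply: open_continuous_measurable_fun; first exact: interval_open.
  by move=> x; rewrite inE; exact: cfD.
Qed.

End oo.

End ftc_open.

(** * Gamma and beta densities *)

Section densities.
Context {R : realType}.
Local Notation mu := (@lebesgue_measure R).
Implicit Types (p q c t u x y : R).

Lemma continuous_powR p t : 0 < t -> {for t, continuous (fun s => s `^ p)}.
Proof.
move=> t0; apply/differentiable_continuous/derivable1_diffP.
by apply: derivable_powR; rewrite in_itv/= andbT.
Qed.

Lemma powR_le_expR p c : 0 < c ->
  exists2 K, 0 <= K & forall t, 1 <= t -> t `^ p <= K * expR (c * t).
Proof.
move=> c0; pose m := `|p| + 1.
have m0 : 0 < m by rewrite ltr_wpDl.
(* The inequality [ln s < s] at [s = c t / m] gives [m ln t <= c t - m ln (c / m)]; the 1 added to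
   [|p|] keeps [m] positive. *)
exists (expR (- (m * ln (c / m)))); first exact: expR_ge0.
move=> t t1; have t0 : 0 < t by apply: lt_le_trans t1.
rewrite /powR gt_eqF// -expRD ler_expR.
apply: (@le_trans _ _ (m * ln t)).
  apply: ler_wpM2r; first exact: ln_ge0.
  by rewrite /m (le_trans (ler_norm p))// lerDl.
have cm0 : 0 < c / m by rewrite divr_gt0.
have -> : m * ln t = - (m * ln (c / m)) + m * ln (c / m * t).
  by rewrite (@lnM _ (c / m) t) ?posrE// mulrDr addrA addNr add0r.
rewrite lerD2l; apply: (@le_trans _ _ (m * (c / m * t))).
  by rewrite ler_pM2l// ltW// ln_sublinear// mulr_gt0.
by rewrite mulrA [m * _]mulrC divfK// gt_eqF.
Qed.

Lemma cvg_expRMN c : 0 < c -> expR (- (c * t)) @[t --> +oo] --> (0 : R).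
Proof.
move=> c0; apply: (@cvg_comp _ _ _ (fun t => c * t) (fun z => expR (- z)) _ (+oo : set_system R)).
  exact: gt0_cvgMry.
exact: cvgr_expR.
Qed.

Lemma integrable_expRM c x : 0 < c ->
  mu.-integrable `]x, +oo[ (EFin \o (fun t => expR (- (c * t)))) /\
  \int[mu]_(t in `]x, +oo[) expR (- (c * t)) = expR (- (c * x)) / c.
Proof.
move=> c0.
have cF t : is_derive t 1 (fun t => - c^-1 * expR (- (c * t))) (expR (- (c * t))).
  by apply: is_derive_eq; rewrite /GRing.scale/=; field; rewrite gt_eqF.
have Fc t : {for t, continuous (fun t => - c^-1 * expR (- (c * t)))}.
  by apply/differentiable_continuous/derivable1_diffP; have [] := cF t.
have [] := @ge0_Rintegral_oy_FTC R x (fun t => expR (- (c * t)))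
  (fun t => - c^-1 * expR (- (c * t))) (- c^-1 * expR (- (c * x))) 0.
- move=> t _; apply: continuous_comp; last exact: continuous_expR.
  by apply: continuousN; apply: continuousM => //; exact: cst_continuous.
- by apply: cvg_at_right_filter; exact: Fc.
- by rewrite -[X in _ --> X](mulr0 (- c^-1)); apply: cvgMr; exact: cvg_expRMN.
- by move=> t _; exact: expR_ge0.
by move=> fi ->; split => //; rewrite sub0r mulNr opprK mulrC.
Qed.

Lemma measurable_fun_powR D p : measurable_fun D (fun t => t `^ p).
Proof. by apply: (@measurable_funS _ _ _ _ setT) => //; exact: measurable_powR. Qed.

Lemma integrable_powR0 c p : 0 < c -> 0 < p ->
  mu.-integrable `]0, c[ (EFin \o (fun t => t `^ (p - 1))) /\
  \int[mu]_(t in `]0, c[) (t `^ (p - 1)) = c `^ p / p.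
Proof.
move=> c0 p0.
have cF t : 0 < t < c -> is_derive t 1 (fun t => p^-1 * t `^ p) (t `^ (p - 1)).
  move=> /andP[t0 _]; have := is_derive1_powR p t0 => H.
  by apply: is_derive_eq; rewrite /GRing.scale/=; field; rewrite gt_eqF.
have [] := @ge0_Rintegral_oo_FTC R 0 c (fun t => t `^ (p - 1))
  (fun t => p^-1 * t `^ p) 0 (p^-1 * c `^ p).
- exact: c0.
- by move=> t /andP[t0 _]; exact: continuous_powR.
- by rewrite -[X in _ --> X](mulr0 p^-1); apply: cvgMr; exact: powR_cvg0.
- by apply: cvg_at_left_filter; apply: cvgMr; exact: (@continuous_powR p c c0).
- by move=> t _; exact: powR_ge0.
by move=> fi ->; rewrite subr0 mulrC.
Qed.

Lemma integrable_powR01 p : 0 < p ->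
  mu.-integrable `]0, 1[ (EFin \o (fun t => t `^ (p - 1))) /\
  \int[mu]_(t in `]0, 1[) (t `^ (p - 1)) = p^-1.
Proof. by move=> p0; have := integrable_powR0 ltr01 p0; rewrite powR1 mul1r. Qed.

(** Extended by zero to the whole line, like [bdens] below, so that affine substitutions and Fubini
    apply without domains. *)
Definition gdens (c x : R) : R -> R :=
  (fun t => t `^ (x - 1) * expR (- (c * t))) \_ `]0, +oo[.

Definition bdens (p q : R) : R -> R :=
  (fun u => u `^ (p - 1) * (1 - u) `^ (q - 1)) \_ `]0, 1[.

Lemma gdensE c x t : gdens c x t = if 0 < t then t `^ (x - 1) * expR (- (c * t)) else 0.
Proof. by rewrite /gdens patchE mem_setE in_itv/= andbT. Qed.

Lemma bdensE p q u : bdens p q u = if 0 < u < 1 then u `^ (p - 1) * (1 - u) `^ (q - 1) else 0.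
Proof. by rewrite /bdens patchE mem_setE in_itv/=. Qed.

Lemma gdens_ge0 c x t : 0 <= gdens c x t.
Proof. by rewrite gdensE; case: ifP => // _; rewrite mulr_ge0 ?powR_ge0 ?expR_ge0. Qed.

Lemma bdens_ge0 p q u : 0 <= bdens p q u.
Proof. by rewrite bdensE; case: ifP => // _; rewrite mulr_ge0 ?powR_ge0. Qed.

Lemma measurable_expRMN c (D : set R) : measurable_fun D (fun t => expR (- (c * t))).
Proof.
apply: measurable_funTS; apply: measurableT_comp => //.
by under eq_fun do rewrite -mulNr; exact: measurable_funM.
Qed.

Lemma measurable_gdens c x : measurable_fun setT (gdens c x).
Proof.
apply/(measurable_restrictT _ (measurable_itv _)).
by apply: measurable_funM; [exact: measurable_fun_powR|exact: measurable_expRMN].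
Qed.

Lemma measurable_bdens p q : measurable_fun setT (bdens p q).
Proof.
apply/(measurable_restrictT _ (measurable_itv _)).
apply: measurable_funM; first exact: measurable_fun_powR.
apply: measurable_funTS; apply: (measurableT_comp (@measurable_powR R _)).
exact: measurable_funB.
Qed.

(** Below 1 the power alone dominates; above 1 half of the exponential absorbs the power. *)
Lemma integrable_gdens c x : 0 < c -> 0 < x -> mu.-integrable setT (EFin \o gdens c x).
Proof.
move=> c0 x0.
have i1 := integrable_setT_restrict (measurable_itv _) (integrable_powR01 x0).1.
have c2 : 0 < c / 2 by rewrite divr_gt0.
have [K K0 HK] := powR_le_expR (x - 1) c2.
have i2 := integrable_setT_restrict (measurable_itv _) (integrable_expRM 0 c2).1.
apply: (lebesgue_dominated_integrable measurableT (measurable_gdens c x)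
  (g := fun t => ((fun t => t `^ (x - 1)) \_ `]0, 1[) t +
     K * ((fun t => expR (- (c / 2 * t))) \_ `]0, +oo[) t)).
  by apply: lebesgue_integrableD => //; apply: lebesgue_integrableZ.
move=> t _; rewrite ger0_norm ?gdens_ge0// gdensE !patchE !mem_setE !in_itv/= !andbT.
case: ltP => t0 /=; last by rewrite mulr0 addr0.
case: ltP => t1.
  rewrite -[leLHS]addr0 lerD ?mulr_ge0 ?expR_ge0// ler_piMr ?powR_ge0//.
  by rewrite -expR0 ler_expR oppr_le0 mulr_ge0// ltW.
rewrite add0r; apply: (le_trans (ler_wpM2r (expR_ge0 _) (HK _ t1))).
rewrite -[leLHS]mulrA; apply: ler_wpM2l => //; rewrite -expRD ler_expR; lra.
Qed.

Lemma powR_half_le p u : 1 / 2 <= u <= 1 -> u `^ p <= 2 `^ `|p|.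
Proof.
move=> /andP[u2 u1]; have u0 : 0 < u by apply: lt_le_trans u2; lra.
rewrite /powR !gt_eqF// ler_expR.
have lnu : ln u <= 0 by apply: ln_le0.
have l2 : - ln 2 <= ln u.
  by rewrite -lnV ?posrE// ler_ln ?posrE ?invr_gt0//; lra.
have ln20 : 0 <= ln 2 :> R by apply: ln_ge0; lra.
have := ler_norm (- p); rewrite normrN => H1.
have := normr_ge0 p => H2; nra.
Qed.

(** On each half of the interval one of the two factors is bounded, by [powR_half_le]; what remains
    is a pure power or its reflection under [u |-> 1 - u]. *)
Lemma integrable_bdens p q : 0 < p -> 0 < q -> mu.-integrable setT (EFin \o bdens p q).
Proof.
move=> p0 q0.
have ir r : 0 < r -> mu.-integrable setT (EFin \o bdens r 1).
  move=> r0; have := integrable_setT_restrict (measurable_itv _) (integrable_powR01 r0).1.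
  apply: eq_integrable => // u _ /=; congr EFin; rewrite bdensE patchE mem_setE in_itv/=.
  by rewrite subrr powRr0 mulr1.
have iq : mu.-integrable setT (EFin \o (fun u => bdens q 1 (1 - u))).
  by apply: integrable_onem; exact: ir.
apply: (lebesgue_dominated_integrable measurableT (measurable_bdens p q)
  (g := fun u => 2 `^ `|q - 1| * bdens p 1 u + 2 `^ `|p - 1| * bdens q 1 (1 - u))).
  by apply: lebesgue_integrableD => //; apply: lebesgue_integrableZ => //; exact: ir.
move=> u _; rewrite ger0_norm ?bdens_ge0// !bdensE !subrr !powRr0 !mulr1.
have -> : (0 < 1 - u < 1) = (0 < u < 1) by apply/idP/idP; lra.
case: ifP => [/andP[u0 u1]|_]; last by rewrite !mulr0 addr0.
have [u2|u2] := leP u (1 / 2).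
  apply: (@le_trans _ _ (2 `^ `|q - 1| * u `^ (p - 1))); last by rewrite lerDl mulr_ge0 ?powR_ge0.
  rewrite mulrC ler_wpM2r ?powR_ge0//; apply: powR_half_le; lra.
apply: (@le_trans _ _ (2 `^ `|p - 1| * (1 - u) `^ (q - 1))); last by rewrite lerDr mulr_ge0 ?powR_ge0.
rewrite ler_wpM2r ?powR_ge0//; apply: powR_half_le; lra.
Qed.

End densities.

(** * Fubini and Fourier integrals of densities *)

(* The library declares [m1 \x m2] sigma-finite for sigma-finite [m1] and [m2],
   but inference finds the instance meant for subprobabilities instead; the
   alias [sigma_prod] carries the right one. *)
Section sigma_prod.
Context d1 d2 (T1 : measurableType d1) (T2 : measurableType d2) (R : realType).
Variables (m1 : {sigma_finite_measure set T1 -> \bar R})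
          (m2 : {sigma_finite_measure set T2 -> \bar R}).

Definition sigma_prod : set (T1 * T2) -> \bar R := (m1 \x m2)%E.

HB.instance Definition _ := Measure.copy sigma_prod (m1 \x m2)%E.

Let sigma_prod_sigma_finite : sigma_finite setT sigma_prod.
Proof.
have /sigma_finiteP[F [TF ndF Foo]] := sigma_finiteT m1.
have /sigma_finiteP[G [TG ndG Goo]] := sigma_finiteT m2.
exists (fun n => F n `*` G n).
  apply/seteqP; split=> // -[x y] _.
  have : (\bigcup_n F n) x by rewrite -TF.
  have : (\bigcup_n G n) y by rewrite -TG.
  move=> [j _ Gjy] [i _ Fix]; exists (maxn i j) => //; split.
    by move: Fix; apply/subsetPset/ndF/leq_maxl.
  by move: Gjy; apply/subsetPset/ndG/leq_maxr.
move=> n; have [mFn Fn] := Foo n; have [mGn Gn] := Goo n.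
split; first exact: measurableX.
by rewrite /sigma_prod product_measure1E// lte_mul_pinfty// ge0_fin_numE.
Qed.

HB.instance Definition _ := Measure_isSigmaFinite.Build _ _ _ sigma_prod
  sigma_prod_sigma_finite.

End sigma_prod.

Section fubini.
Context d1 d2 (T1 : measurableType d1) (T2 : measurableType d2) (R : realType).
Variables (m1 : {sigma_finite_measure set T1 -> \bar R})
          (m2 : {sigma_finite_measure set T2 -> \bar R}).

Lemma integrable_prod_iterated (f : T1 * T2 -> R) : measurable_fun setT f ->
  (forall x, m2.-integrable setT (EFin \o (fun y => f (x, y)))) ->
  m1.-integrable setT (EFin \o (fun x => \int[m2]_y `|f (x, y)|)) ->
  (sigma_prod m1 m2).-integrable setT (EFin \o f).
Proof.
move=> mf fi Fi.
have mEf : measurable_fun setT (EFin \o f) by exact/measurable_EFinP.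
apply/(integrable12ltyP m1 m2 mEf).
rewrite (eq_integral (EFin \o (fun x => \int[m2]_y `|f (x, y)|))).
  have /integrableP[_] := Fi; apply: le_lt_trans; apply: ge0_le_integral => //.
  - by move=> x _ /=; rewrite lee_fin Rintegral_ge0.
  - by have := measurable_int _ Fi.
  - by apply: measurableT_comp => //; have := measurable_int _ Fi.
  - by move=> x _ /=; rewrite lee_fin ler_norm.
move=> x _ /=; rewrite /Rintegral fineK//.
apply: integrable_fin_num => //.
exact: (integrable_norm (fi x)).
Qed.

Lemma Rintegral_iterated1 (f : T1 * T2 -> R) :
  (sigma_prod m1 m2).-integrable setT (EFin \o f) ->
  \int[(sigma_prod m1 m2)]_z f z = \int[m1]_x \int[m2]_y f (x, y).
Proof.
move=> fi; rewrite /Rintegral -integral12_prod_meas1//; congr fine.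
apply: ae_eq_integral => //.
- exact: measurable_fubini_F fi.
- have := measurable_fubini_F fi => mF.
  apply/measurable_EFinP; apply: (measurableT_comp (f := @fine R)) => //.
have := ae_integrable1 fi; apply: filterS => x fix_ _.
by rewrite /fubini_F fineK//; exact: integrable_fin_num fix_.
Qed.

Lemma Rintegral_iterated2 (f : T1 * T2 -> R) :
  (sigma_prod m1 m2).-integrable setT (EFin \o f) ->
  \int[(sigma_prod m1 m2)]_z f z = \int[m2]_y \int[m1]_x f (x, y).
Proof.
move=> fi; rewrite /Rintegral -integral21_prod_meas1//; congr fine.
apply: ae_eq_integral => //.
- exact: measurable_fubini_G fi.
- have := measurable_fubini_G fi => mF.
  apply/measurable_EFinP; apply: (measurableT_comp (f := @fine R)) => //.
have := ae_integrable2 fi; apply: filterS => x fix_ _.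
by rewrite /fubini_G fineK//; exact: integrable_fin_num fix_.
Qed.

Lemma Rintegral_swap (f : T1 * T2 -> R) :
  (sigma_prod m1 m2).-integrable setT (EFin \o f) ->
  \int[m1]_x \int[m2]_y f (x, y) = \int[m2]_y \int[m1]_x f (x, y).
Proof. by move=> fi; rewrite -Rintegral_iterated1// Rintegral_iterated2. Qed.

Lemma measurable_Rintegral1 (f : T1 * T2 -> R) :
  (sigma_prod m1 m2).-integrable setT (EFin \o f) ->
  measurable_fun setT (fun x => \int[m2]_y f (x, y)).
Proof.
move=> fi; have := measurable_fubini_F fi => mF.
by apply: (measurableT_comp (f := @fine R)).
Qed.

Lemma integrable_Rintegral1 (f : T1 * T2 -> R) :
  (sigma_prod m1 m2).-integrable setT (EFin \o f) ->
  m1.-integrable setT (EFin \o (fun x => \int[m2]_y f (x, y))).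
Proof.
move=> fi; apply: (le_integrable measurableT _ _ (integrable_fubini_F fi)).
  by apply/measurable_EFinP; exact: measurable_Rintegral1.
move=> x _ /=; rewrite /fubini_F /Rintegral /=.
by case: (\int[m2]_y _)%E => [r||] //=; rewrite normr0 leey.
Qed.

Lemma integrable_tensor (f : T1 -> R) (g : T2 -> R) :
  m1.-integrable setT (EFin \o f) -> m2.-integrable setT (EFin \o g) ->
  (sigma_prod m1 m2).-integrable setT (EFin \o (fun z => f z.1 * g z.2)).
Proof.
move=> fi gi.
have mf : measurable_fun setT f by apply/measurable_EFinP; exact: measurable_int fi.
have mg : measurable_fun setT g by apply/measurable_EFinP; exact: measurable_int gi.
apply: integrable_prod_iterated.
- by apply: measurable_funM; apply: measurableT_comp.
- by move=> x; exact: (integrableZl_EFin (f x) measurableT gi).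
- have := integrableZl_EFin (\int[m2]_y `|g y|) measurableT (integrable_norm fi).
  apply: eq_integrable => // x _ /=; congr EFin.
  under [RHS]eq_Rintegral do rewrite normrM.
  by rewrite RintegralZl// 1?mulrC//; exact: (integrable_norm gi).
Qed.

Lemma Rintegral_tensor (f : T1 -> R) (g : T2 -> R) :
  m1.-integrable setT (EFin \o f) -> m2.-integrable setT (EFin \o g) ->
  \int[(sigma_prod m1 m2)]_z (f z.1 * g z.2) = (\int[m1]_x f x) * (\int[m2]_y g y).
Proof.
move=> fi gi; rewrite (Rintegral_iterated1 (integrable_tensor fi gi)).
rewrite -RintegralZr//; apply: eq_Rintegral => x _ /=.
by rewrite RintegralZl.
Qed.

End fubini.

(** * Fourier integrals along a phase *)

Section expint.
Context d (T : measurableType d) (R : realType).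
Local Open Scope complex_scope.

(** The integral of [g e^(i th)], stored as a pair of real integrals. *)
Definition expint (m : {measure set T -> \bar R}) (g th : T -> R) : R[i] :=
  (\int[m]_x (g x * cos (th x))) +i* (\int[m]_x (g x * sin (th x))).

Lemma integrable_weight_bounded (m : {measure set T -> \bar R}) (g h : T -> R) (M : R) :
  m.-integrable setT (EFin \o g) -> measurable_fun setT h ->
  (forall x, `|h x| <= M) -> m.-integrable setT (EFin \o (fun x => g x * h x)).
Proof.
move=> gi mh hM.
have mg : measurable_fun setT g by apply/measurable_EFinP; exact: measurable_int gi.
apply: (@dominated_integrable_fun _ T R m setT _ (fun x => M * `|g x|)) => //.
- exact: measurable_funM.
- apply: integrableZl_EFin => //; exact: (integrable_norm gi).
- by move=> x _; rewrite normrM mulrC ler_wpM2r.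
Qed.

Lemma integrable_weight_cos (m : {measure set T -> \bar R}) (g th : T -> R) :
  m.-integrable setT (EFin \o g) -> measurable_fun setT th ->
  m.-integrable setT (EFin \o (fun x => g x * cos (th x))).
Proof.
move=> gi mth; apply: (integrable_weight_bounded (M := 1)) => //; last by move=> x; exact: cos_max.
by apply: (measurableT_comp (f := @cos R)) => //; apply: continuous_measurable_fun; exact: continuous_cos.
Qed.

Lemma integrable_weight_sin (m : {measure set T -> \bar R}) (g th : T -> R) :
  m.-integrable setT (EFin \o g) -> measurable_fun setT th ->
  m.-integrable setT (EFin \o (fun x => g x * sin (th x))).
Proof.
move=> gi mth; apply: (integrable_weight_bounded (M := 1)) => //; last by move=> x; exact: sin_max.
by apply: (measurableT_comp (f := @sin R)) => //; apply: continuous_measurable_fun; exact: continuous_sin.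
Qed.

Lemma expint_shift (m : {measure set T -> \bar R}) (g th : T -> R) (a : R) :
  m.-integrable setT (EFin \o g) -> measurable_fun setT th ->
  expint m g (fun x => a + th x) = (cos a +i* sin a) * expint m g th.
Proof.
move=> gi mth; have ic := integrable_weight_cos gi mth; have is_ := integrable_weight_sin gi mth.
rewrite /expint /=; apply/eqP; rewrite eq_complex /=; apply/andP; split; apply/eqP.
  rewrite -!RintegralZl// -RintegralB//; [|exact: integrableZl_EFin..].
  by apply: eq_Rintegral => x _; rewrite cosD; ring.
rewrite -!RintegralZl// -RintegralD//; [|exact: integrableZl_EFin..].
by apply: eq_Rintegral => x _; rewrite sinD; ring.
Qed.

End expint.

Section expint_tensor.
Context d1 d2 (T1 : measurableType d1) (T2 : measurableType d2) (R : realType).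
Variables (m1 : {sigma_finite_measure set T1 -> \bar R})
          (m2 : {sigma_finite_measure set T2 -> \bar R}).

(** The exponential turns sums into products, so a product of gamma and beta integrals becomes a
    single Fourier integral: densities multiply and phases add. *)
Lemma expint_tensor (g1 th1 : T1 -> R) (g2 th2 : T2 -> R) :
  m1.-integrable setT (EFin \o g1) -> measurable_fun setT th1 ->
  m2.-integrable setT (EFin \o g2) -> measurable_fun setT th2 ->
  expint m1 g1 th1 * expint m2 g2 th2 =
  expint (sigma_prod m1 m2) (fun z => g1 z.1 * g2 z.2) (fun z => th1 z.1 + th2 z.2).
Proof.
move=> i1 t1 i2 t2.
have c1 := integrable_weight_cos i1 t1; have s1 := integrable_weight_sin i1 t1.
have c2 := integrable_weight_cos i2 t2; have s2 := integrable_weight_sin i2 t2.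
have cc := integrable_tensor c1 c2; have ss := integrable_tensor s1 s2.
have cs := integrable_tensor c1 s2; have sc := integrable_tensor s1 c2.
rewrite /expint; apply/eqP; rewrite eq_complex /=; apply/andP; split; apply/eqP.
  rewrite -!Rintegral_tensor// -RintegralB//.
  by apply: eq_Rintegral => x _; rewrite cosD; ring.
rewrite -!Rintegral_tensor// -RintegralD//.
by apply: eq_Rintegral => x _; rewrite sinD; ring.
Qed.

End expint_tensor.

(** * Products of Euler integrals *)

Section gamma_beta.
Context {R : realType}.
Local Notation mu := (@lebesgue_measure R).
Implicit Types (x y b q t u r : R).
Local Open Scope complex_scope.

Lemma gdens_scale x b r u : 0 < r ->
  r * (gdens 1 x (r * u) * gdens 1 b (r - r * u)) = gdens 1 (x + b) r * bdens x b u.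
Proof.
move=> r0; rewrite !gdensE bdensE r0 pmulr_rgt0//.
have -> : r - r * u = r * (1 - u) by ring.
rewrite pmulr_rgt0// subr_gt0.
case: ltP => u0 /=; last by rewrite mul0r !mulr0.
case: ltP => u1 /=; last by rewrite !mulr0.
rewrite !powRM ?subr_ge0 ?(ltW r0) ?(ltW u0) ?(ltW u1)//.
have -> : expR (- (1 * r)) = expR (- (1 * (r * u))) * expR (- (1 * (r * (1 - u)))).
  by rewrite -expRD; congr expR; ring.
have -> : x + b - 1 = (x - 1) + (b - 1) + 1 by ring.
have rn0 : r != 0 by rewrite gt_eqF.
rewrite (@powRD _ r (x - 1 + (b - 1)) 1) ?rn0 ?implybT//.
rewrite (@powRD _ r (x - 1) (b - 1)) ?rn0 ?implybT// powRr1 ?(ltW r0)//; ring.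
Qed.

(** Two gamma variables are described by their sum [r] and the proportion [u]: Fubini in [(t, r)],
    the second variable being [r - t], then [t = r u] and [gdens_scale]. The bounded factor [phi]
    will be the cosine or sine of [y ln t]; it makes the first argument complex while all integrals
    stay real. *)
Lemma Rintegral_gdens_mul x b (phi : R -> R) : 0 < x -> 0 < b ->
  measurable_fun setT phi -> (forall t, `|phi t| <= 1) ->
  (\int[mu]_t (gdens 1 x t * phi t)) * (\int[mu]_t gdens 1 b t) =
  \int[mu]_r (gdens 1 (x + b) r * \int[mu]_u (bdens x b u * phi (r * u))).
Proof.
move=> x0 b0 mphi phi1.
have igx := integrable_gdens ltr01 x0; have igb := integrable_gdens ltr01 b0.
have mgx := measurable_gdens 1 x; have mgb := measurable_gdens 1 b.
have igxphi : mu.-integrable setT (EFin \o (fun t => gdens 1 x t * phi t)).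
  exact: (@integrable_weight_bounded _ (measurableTypeR R) R mu _ _ 1).
pose F (z : measurableTypeR R * measurableTypeR R) := gdens 1 x z.1 * phi z.1 * gdens 1 b (z.2 - z.1).
have shiftE t : \int[mu]_r gdens 1 b (r - t) = \int[mu]_r gdens 1 b r.
  rewrite [RHS](Rintegral_affine (- t) ltr01 mgb) mul1r.
  by apply: eq_Rintegral => r _; rewrite mul1r.
have ishift t : mu.-integrable setT (EFin \o (fun r => gdens 1 b (r - t))).
  have := integrable_affine (- t) ltr01 igb.
  by apply: eq_integrable => // r _ /=; rewrite mul1r.
have mF : measurable_fun setT F.
  apply: measurable_funM; first apply: measurable_funM.
  - exact: (measurableT_comp mgx).
  - exact: (measurableT_comp mphi).
  - by apply: (measurableT_comp mgb); exact: measurable_funB.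
have iF : (sigma_prod mu mu).-integrable setT (EFin \o F).
  apply: integrable_prod_iterated => //.
    by move=> t; exact: (lebesgue_integrableZ (gdens 1 x t * phi t) measurableT (ishift t)).
  have := lebesgue_integrableZ (\int[mu]_r gdens 1 b r) measurableT (integrable_norm igxphi).
  apply: eq_integrable => // t _ /=; congr EFin.
  rewrite /F /=; under [RHS]eq_Rintegral => r _ do rewrite normrM (ger0_norm (gdens_ge0 _ _ _)).
  by rewrite RintegralZl// shiftE mulrC.
have := Rintegral_swap iF; rewrite /F /=.
under eq_Rintegral => t _ do rewrite RintegralZl// shiftE.
rewrite RintegralZr// => ->; apply: eq_Rintegral => r _.
have [r0|r0] := ltP 0 r; last first.
  rewrite gdensE ltNge r0 /= mul0r; under eq_Rintegral => t _.
    have -> : gdens 1 x t * phi t * gdens 1 b (r - t) = 0.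
      rewrite !gdensE; case: ltP => t0; last by rewrite !mul0r.
      by rewrite subr_gt0 ltNge (le_trans r0 (ltW t0)) mulr0.
    over.
  by rewrite Rintegral_cst// mul0r.
rewrite (Rintegral_affine 0 r0); last first.
  apply: measurable_funM; first exact: measurable_funM.
  by apply: (measurableT_comp mgb); exact: measurable_funB.
have ibphi : mu.-integrable setT (EFin \o (fun u => bdens x b u * phi (r * u))).
  apply: (@integrable_weight_bounded _ (measurableTypeR R) R mu _ _ 1) => //.
    exact: integrable_bdens.
  by apply: (measurableT_comp mphi); exact: measurable_funM.
have E u : gdens 1 x (r * u + 0) * phi (r * u + 0) * gdens 1 b (r - (r * u + 0)) =
    r^-1 * gdens 1 (x + b) r * (bdens x b u * phi (r * u)).
  rewrite addr0 [RHS]mulrA -[_ * _ * bdens _ _ _]mulrA -gdens_scale//; field.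
  by rewrite gt_eqF.
under eq_Rintegral => u _ do rewrite E.
by rewrite RintegralZl// !mulrA divff ?mul1r// gt_eqF.
Qed.

End gamma_beta.

(** * The complex gamma function *)

Section cgamma.
Context {R : realType}.
Local Notation mu := (@lebesgue_measure R).
Implicit Types (x y b q t u r : R) (z : R[i]).
Local Open Scope complex_scope.

Lemma measurable_Mln y : measurable_fun setT (fun t : R => y * ln t).
Proof. by apply: measurable_funM => //; exact: measurable_ln. Qed.

Lemma CGammaE x y : 0 < x -> CGamma (x +i* y) = expint mu (gdens 1 x) (fun t => y * ln t).
Proof.
move=> x0; rewrite /CGamma /= x0 /CGamma_integral /Cintegral /expint.
congr (_ +i* _); rewrite Rintegral_mkcond; apply: eq_Rintegral => t _;
  rewrite patchE gdensE mem_setE in_itv/= andbT; case: ltP => t0; rewrite ?mul0r//=;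
  rewrite !subr0 mul1r; ring.
Qed.

Definition CBeta x b y : R[i] := expint mu (bdens x b) (fun u => y * ln u).

Lemma Gamma_gt0E x : 0 < x -> Gamma x = \int[mu]_t gdens 1 x t.
Proof.
move=> x0; rewrite /Gamma (_ : x%:C = x +i* 0)// CGammaE//=.
by apply: eq_Rintegral => t _; rewrite mul0r cos0 mulr1.
Qed.

Lemma measurable_cosMln y : measurable_fun setT (fun t : R => cos (y * ln t)).
Proof.
apply: (measurableT_comp (f := @cos R)); last exact: measurable_Mln.
by apply: continuous_measurable_fun; exact: continuous_cos.
Qed.

Lemma measurable_sinMln y : measurable_fun setT (fun t : R => sin (y * ln t)).
Proof.
apply: (measurableT_comp (f := @sin R)); last exact: measurable_Mln.
by apply: continuous_measurable_fun; exact: continuous_sin.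
Qed.

Lemma integrable_gdens_cos x y : 0 < x ->
  mu.-integrable setT (EFin \o (fun t => gdens 1 x t * cos (y * ln t))).
Proof.
move=> x0; apply: (@integrable_weight_bounded _ (measurableTypeR R) R mu _ _ 1).
- exact: integrable_gdens.
- exact: measurable_cosMln.
- by move=> ?; exact: cos_max.
Qed.

Lemma integrable_gdens_sin x y : 0 < x ->
  mu.-integrable setT (EFin \o (fun t => gdens 1 x t * sin (y * ln t))).
Proof.
move=> x0; apply: (@integrable_weight_bounded _ (measurableTypeR R) R mu _ _ 1).
- exact: integrable_gdens.
- exact: measurable_sinMln.
- by move=> ?; exact: sin_max.
Qed.

Lemma integrable_bdens_cos x b y : 0 < x -> 0 < b ->
  mu.-integrable setT (EFin \o (fun t => bdens x b t * cos (y * ln t))).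
Proof.
move=> x0 b0; apply: (@integrable_weight_bounded _ (measurableTypeR R) R mu _ _ 1).
- exact: integrable_bdens.
- exact: measurable_cosMln.
- by move=> ?; exact: cos_max.
Qed.

Lemma integrable_bdens_sin x b y : 0 < x -> 0 < b ->
  mu.-integrable setT (EFin \o (fun t => bdens x b t * sin (y * ln t))).
Proof.
move=> x0 b0; apply: (@integrable_weight_bounded _ (measurableTypeR R) R mu _ _ 1).
- exact: integrable_bdens.
- exact: measurable_sinMln.
- by move=> ?; exact: sin_max.
Qed.

Lemma complex_mulE (a b c d : R) :
  (a +i* b) * (c +i* d) = (a * c - b * d) +i* (a * d + b * c).
Proof. by []. Qed.

Lemma complex_mulrC (a b c : R) : (a +i* b) * c%:C = (a * c) +i* (b * c).
Proof. by rewrite (_ : c%:C = c +i* 0)// complex_mulE !mulr0 subr0 add0r. Qed.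

(** The phase in [Rintegral_gdens_mul] is [y ln (r u) = y ln r + y ln u]; the addition formulas
    separate the gamma integral over [r] from the beta integral over [u]. *)
Lemma CGamma_Beta x b y : 0 < x -> 0 < b ->
  CGamma (x +i* y) * (Gamma b)%:C = CGamma ((x + b) +i* y) * CBeta x b y.
Proof.
move=> x0 b0; have xb0 := addr_gt0 x0 b0.
rewrite Gamma_gt0E// !CGammaE// /CBeta /expint complex_mulrC complex_mulE.
have ibc := integrable_bdens_cos y x0 b0; have ibs := integrable_bdens_sin y x0 b0.
have igc := integrable_gdens_cos y xb0; have igs := integrable_gdens_sin y xb0.
set C := \int[mu]_x0 (bdens x b x0 * cos (y * ln x0)).
set S := \int[mu]_x0 (bdens x b x0 * sin (y * ln x0)).
congr (_ +i* _).
- rewrite Rintegral_gdens_mul//; [|exact: measurable_cosMln|by move=> t; exact: cos_max].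
  rewrite -!RintegralZr// -RintegralB//; last 2 first.
  + by have := lebesgue_integrableZ C measurableT igc; apply: eq_integrable => // u _ /=; rewrite mulrC.
  + by have := lebesgue_integrableZ S measurableT igs; apply: eq_integrable => // u _ /=; rewrite mulrC.
  apply: eq_Rintegral => r _; rewrite gdensE; case: ltP => r0; last by rewrite !mul0r subr0.
  rewrite -!mulrA -mulrBr; congr (_ * _); rewrite -mulrBr; congr (_ * _).
  rewrite -!RintegralZl// -RintegralB//; [|exact: lebesgue_integrableZ..].
  apply: eq_Rintegral => u _; rewrite bdensE; case: ifP => [/andP[u0 _]|]; last by rewrite !mul0r !mulr0 subr0.
  by rewrite lnM ?posrE// mulrDr cosD; ring.
- rewrite Rintegral_gdens_mul//; [|exact: measurable_sinMln|by move=> t; exact: sin_max].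
  rewrite -!RintegralZr// -RintegralD//; last 2 first.
  + by have := lebesgue_integrableZ S measurableT igc; apply: eq_integrable => // u _ /=; rewrite mulrC.
  + by have := lebesgue_integrableZ C measurableT igs; apply: eq_integrable => // u _ /=; rewrite mulrC.
  apply: eq_Rintegral => r _; rewrite gdensE; case: ltP => r0; last by rewrite !mul0r addr0.
  rewrite -!mulrA -mulrDr; congr (_ * _); rewrite -mulrDr; congr (_ * _).
  rewrite -!RintegralZl// -RintegralD//; [|exact: lebesgue_integrableZ..].
  apply: eq_Rintegral => u _; rewrite bdensE; case: ifP => [/andP[u0 _]|]; last by rewrite !mul0r !mulr0 addr0.
  by rewrite lnM ?posrE// mulrDr sinD; ring.
Qed.

Lemma powRE1 x t : 0 < t -> t `^ x = t `^ (x - 1) * t.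
Proof.
move=> t0; rewrite -[X in _ = _ * X](powRr1 (ltW t0)) -powRD ?subrK//.
by rewrite (gt_eqF t0) implybT.
Qed.

Let powR_cos_derive x y t : 0 < t ->
  is_derive t 1 (fun t => t `^ x * cos (y * ln t))
    (t `^ (x - 1) * (x * cos (y * ln t) - y * sin (y * ln t))).
Proof.
move=> t0; have H1 := is_derive1_powR x t0; have H2 := is_derive1_ln t0.
apply: is_derive_eq; rewrite /GRing.scale/=.
by rewrite (powRE1 x t0); field; rewrite gt_eqF.
Qed.

Let powR_sin_derive x y t : 0 < t ->
  is_derive t 1 (fun t => t `^ x * sin (y * ln t))
    (t `^ (x - 1) * (x * sin (y * ln t) + y * cos (y * ln t))).
Proof.
move=> t0; have H1 := is_derive1_powR x t0; have H2 := is_derive1_ln t0.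
apply: is_derive_eq; rewrite /GRing.scale/=.
by rewrite (powRE1 x t0); field; rewrite gt_eqF.
Qed.

Lemma powR_bounded_cvg0 x (h : R -> R) (M : R) : 0 < x -> (forall t, `|h t| <= M) ->
  t `^ x * h t @[t --> 0^'+] --> 0.
Proof.
move=> x0 h1; apply/cvgr0Pnorm_lt => d d0.
have M10 : 0 < M + 1 by rewrite ltr_wpDl// (le_trans _ (h1 0)).
have dM := divr_gt0 d0 M10.
have /cvgr0Pnorm_lt/(_ _ dM) := powR_cvg0 x0.
apply: filterS => t; rewrite ltr_pdivlMr// => /le_lt_trans; apply.
by rewrite normrM ler_wpM2l// (le_trans (h1 t))// lerDl.
Qed.

Lemma continuous_powR_trig x y (a b : R) t : 0 < t ->
  {for t, continuous (fun t => t `^ x * (a * cos (y * ln t) + b * sin (y * ln t)))}.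
Proof.
move=> t0; apply/differentiable_continuous/derivable1_diffP.
have H1 := is_derive1_powR x t0; have H2 := is_derive1_ln t0.
exact: ex_derive.
Qed.

Lemma Rintegral_bdens1_trig x y (a b : R) (F : R -> R) (A B : R) : 0 < x ->
  (forall t, 0 < t -> is_derive t 1 F
     (t `^ (x - 1) * (a * cos (y * ln t) + b * sin (y * ln t)))) ->
  F t @[t --> 0^'+] --> A -> F t @[t --> 1^'-] --> B ->
  a * \int[mu]_u (bdens x 1 u * cos (y * ln u)) +
  b * \int[mu]_u (bdens x 1 u * sin (y * ln u)) = B - A.
Proof.
move=> x0 dF FA FB.
have ibc := lebesgue_integrableZ a measurableT (integrable_bdens_cos y x0 ltr01).
have ibs := lebesgue_integrableZ b measurableT (integrable_bdens_sin y x0 ltr01).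
have E u : a * (bdens x 1 u * cos (y * ln u)) + b * (bdens x 1 u * sin (y * ln u)) =
   ((fun t => t `^ (x - 1) * (a * cos (y * ln t) + b * sin (y * ln t))) \_ `]0, 1[) u.
  rewrite patchE mem_setE in_itv/= bdensE; case: ifP => _; last by rewrite !mul0r !mulr0 addr0.
  by rewrite subrr powRr0; ring.
rewrite -!RintegralZl//; [|exact: integrable_bdens_sin|exact: integrable_bdens_cos].
rewrite -RintegralD//.
under eq_Rintegral => u _ do rewrite E.
rewrite -Rintegral_mkcond; apply: (Rintegral_oo_FTC ltr01 _ _ FA FB).
- by move=> t /andP[t0 _]; exact: continuous_powR_trig.
- by move=> t /andP[t0 _]; exact: dF.
- apply: integrable_restrict_setT; first exact: measurable_itv.
  have := lebesgue_integrableD measurableT ibc ibs.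
  by apply: eq_integrable => // u _; rewrite /= E.
Qed.

(** [t ^ (x + iy)] is a primitive of [(x + iy) t ^ (x + iy - 1)] and goes from 0 at 0 to 1 at 1;
    [d1] and [d2] are the real and imaginary parts of this derivative. *)
Lemma CBeta1 x y : 0 < x -> (x +i* y) * CBeta x 1 y = 1.
Proof.
move=> x0; rewrite /CBeta /expint complex_mulE (_ : 1 = 1 +i* 0)//.
have lim1 (f : R -> R) : {for (1 : R), continuous f} -> f t @[t --> 1^'-] --> f 1.
  exact: cvg_at_left_filter.
have dc (f : R -> R) (t df : R) : is_derive t 1 f df -> {for t, continuous f}.
  by move=> [fd _]; exact/differentiable_continuous/derivable1_diffP.
have d1 t : 0 < t -> is_derive t 1 (fun t => t `^ x * cos (y * ln t))
    (t `^ (x - 1) * (x * cos (y * ln t) + - y * sin (y * ln t))).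
  by move=> t0; rewrite mulNr; exact: powR_cos_derive.
have d2 t : 0 < t -> is_derive t 1 (fun t => t `^ x * sin (y * ln t))
    (t `^ (x - 1) * (y * cos (y * ln t) + x * sin (y * ln t))).
  by move=> t0; rewrite [X in _ * X]addrC; exact: powR_sin_derive.
congr (_ +i* _).
- rewrite -mulNr (Rintegral_bdens1_trig x0 d1 (A := 0) (B := 1)) ?subr0//.
  + by apply: (powR_bounded_cvg0 (M := 1)) => // t; exact: cos_max.
  + have := lim1 _ (dc _ _ _ (powR_cos_derive x y ltr01)).
    by rewrite powR1 ln1 mulr0 cos0 mul1r.
- rewrite addrC (Rintegral_bdens1_trig x0 d2 (A := 0) (B := 0)) ?subr0//.
  + by apply: (powR_bounded_cvg0 (M := 1)) => // t; exact: sin_max.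
  + have := lim1 _ (dc _ _ _ (powR_sin_derive x y ltr01)).
    by rewrite powR1 ln1 mulr0 sin0 mulr0.
Qed.

Lemma Gamma1 : Gamma 1 = 1 :> R.
Proof.
rewrite Gamma_gt0E//.
transitivity (\int[mu]_(t in `]0, +oo[) expR (- (1 * t))); last first.
  by rewrite (integrable_expRM 0 ltr01).2 mulr0 oppr0 divr1 expR0.
rewrite [RHS]Rintegral_mkcond.
apply: eq_Rintegral => t _; rewrite patchE gdensE mem_setE in_itv/= andbT.
by rewrite subrr powRr0 mul1r.
Qed.

(** The case [b = 1] of the beta identity, where the beta integral is [1 / (x + iy)]. *)
Lemma CGammaS x y : 0 < x -> CGamma ((x + 1) +i* y) = (x +i* y) * CGamma (x +i* y).
Proof.
move=> x0; have := CGamma_Beta y x0 ltr01; rewrite Gamma1 mulr1 => ->.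
by rewrite mulrCA CBeta1// mulr1.
Qed.

Lemma GammaS x : 0 < x -> Gamma (x + 1) = x * Gamma x.
Proof.
move=> x0; rewrite /Gamma (_ : (x + 1)%:C = (x + 1) +i* 0)// CGammaS//.
by rewrite (_ : x%:C = x +i* 0)//; case: (CGamma _) => a b; rewrite complex_mulE /= mul0r subr0.
Qed.

(** For an argument at least 1 the density is at least [e^(- t)] beyond [t = 1]; the functional
    equation brings positivity down to all positive arguments. *)
Lemma Gamma_gt0 x : 0 < x -> 0 < Gamma x.
Proof.
have H y : 1 <= y -> 0 < Gamma y.
  move=> y1; have y0 : 0 < y by apply: lt_le_trans y1.
  rewrite Gamma_gt0E//; apply: (@lt_le_trans _ _ (expR (- (1 * 1)) / 1)).
    by rewrite divr1 expR_gt0.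
  have [i1 <-] := @integrable_expRM R 1 1 ltr01; rewrite Rintegral_mkcond.
  apply: le_Rintegral => //.
  - exact: integrable_setT_restrict.
  - exact: integrable_gdens.
  move=> t _; rewrite patchE gdensE mem_setE in_itv/= andbT.
  case: ltP => t1; last by case: ltP => // _; rewrite mulr_ge0 ?powR_ge0 ?expR_ge0.
  rewrite (lt_trans ltr01 t1) ler_peMl ?expR_ge0//.
  by rewrite -[leLHS](powRr0 t); apply: ler_powR; rewrite ?subr_ge0// ltW.
move=> x0; have := H (x + 1); rewrite GammaS// pmulr_rgt0//; apply.
by rewrite lerDr ltW.
Qed.

Lemma sqr_sin_le (t : R) : (sin t) ^+ 2 <= t ^+ 2.
Proof.
wlog t0 : t / 0 <= t.
  move=> H; have [/H//|/ltW t0] := leP 0 t.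
  by have := H (- t); rewrite oppr_ge0 sinN !sqrrN; exact.
have [<-|tn0] := eqVneq 0 t; first by rewrite sin0.
have tgt : 0 < t by rewrite lt_neqAle tn0.
have [|c _] := @MVT R sin cos 0 t tgt.
- by apply: continuous_subspaceT; exact: continuous_sin.
rewrite sin0 !subr0 => ->; rewrite exprMn ler_piMl ?sqr_ge0//.
Qed.

Lemma onem_cos_le (t : R) : 1 - cos t <= t ^+ 2 / 2.
Proof.
have := sqr_sin_le (t / 2); rewrite sin2cos2.
have -> : cos t = cos (t / 2) ^+ 2 + cos (t / 2) ^+ 2 - 1.
  by rewrite -mulr2n -cos_mulr2n mulr2n; congr cos; field.
by move: (cos (t / 2)) => a ha; lra.
Qed.

Lemma gdensM x t : gdens 1 x t * t = gdens 1 (x + 1) t.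
Proof.
rewrite !gdensE; case: ltP => t0; last by rewrite mul0r.
by rewrite addrK (powRE1 x t0); ring.
Qed.

Lemma gdensV x t : gdens 1 x t * t^-1 = gdens 1 (x - 1) t.
Proof.
rewrite !gdensE; case: ltP => t0; last by rewrite mul0r.
by rewrite (powRE1 (x - 1) t0); field; rewrite gt_eqF.
Qed.

(** The right-hand side is [4 (r - 1/r)^2] with [r] the square root of [t], symmetric under
    [t |-> 1/t]; for [r >= 1] it suffices that [ln r <= r - 1 <= r - 1/r]. The bound replaces a
    squared logarithm by powers, whose gamma integrals are explicit. *)
Lemma sqr_ln_le (t : R) : 0 < t -> (ln t) ^+ 2 <= 4 * (t - 2 + t^-1).
Proof.
have H (s : R) : 1 <= s -> (ln s) ^+ 2 <= 4 * (s - 2 + s^-1).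
  move=> s1; have s0 : 0 < s by apply: lt_le_trans s1.
  have [r r0 sE] : exists2 r, 0 < r & s = r ^+ 2.
    by exists (Num.sqrt s); rewrite ?sqrtr_gt0// sqr_sqrtr// ltW.
  have r1 : 1 <= r.
    by rewrite leNgt; apply/negP => r1; move: s1; rewrite sE expr2; nra.
  have lnr0 : 0 <= ln r by exact: ln_ge0.
  have lnr : ln r <= r - 1.
    by have := @le_ln1Dx R (r - 1); rewrite [1 + (r - 1)]addrC subrK; apply; lra.
  have w0 : 0 < r^-1 by rewrite invr_gt0.
  have w1 : r^-1 <= 1 by rewrite invf_le1.
  have rw : r * r^-1 = 1 by rewrite divff ?gt_eqF.
  rewrite sE lnXn// mulr2n -exprVn.
  have e : (r - r^-1) ^+ 2 = r ^+ 2 - 2 + r^-1 ^+ 2 by rewrite sqrrB rw; ring.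
  have h : ln r ^+ 2 <= (r - r^-1) ^+ 2 by rewrite ler_sqr ?nnegrE//; lra.
  by rewrite -e; move: (r - r^-1) h => z h; lra.
move=> t0; have [|t1] := leP 1 t; first exact: H.
have := H t^-1; rewrite lnV ?posrE// sqrrN invrK => h.
have -> : t - 2 + t^-1 = t^-1 - 2 + t by ring.
by apply: h; rewrite invf_ge1// ltW.
Qed.

(* A zero at [x + iy] propagates to [x + n + iy] by the functional equation, where
   the phase is too concentrated for the integral to vanish when [n] is large. *)
Lemma CGamma_neq0 x y : 0 < x -> CGamma (x +i* y) != 0.
Proof.
move=> x0; apply/eqP => G0.
have Gn n : CGamma ((x + n%:R) +i* y) = 0.
  elim: n => [|n IH]; first by rewrite addr0.
  by rewrite -natr1 addrA CGammaS ?IH ?mulr0// ltr_wpDr.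
(* Large enough for [2 y^2 < X - 1], which is the positivity condition met at the end. *)
pose n := (Num.truncn (2 * y ^+ 2)).+2.
pose X := x + n%:R.
have X1 : 2 * y ^+ 2 < X - 1.
  rewrite /X /n; have /andP[_] := truncn_itv (mulr_ge0 (ler0n R 2) (sqr_ge0 y)).
  by rewrite -[in (_.+2)%:R]natr1 => h; lra.
have X10 : 0 < X - 1 by apply: le_lt_trans X1; rewrite mulr_ge0// sqr_ge0.
have X0 : 0 < X by lra.
have := Gn n; rewrite -/X CGammaE// => /eqP; rewrite eq_complex => /andP[/eqP/= re0 /eqP/= im0].
(* Rotating by the phase at [t = X], where the density concentrates, makes the cosine close to 1 on
   most of the mass. *)
pose c := y * ln X.
have ig := integrable_gdens (@ltr01 R) X0.
have igc := integrable_gdens_cos y X0; have igs := integrable_gdens_sin y X0.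
have E t : gdens 1 X t * cos (y * ln t - c) =
    cos c * (gdens 1 X t * cos (y * ln t)) + sin c * (gdens 1 X t * sin (y * ln t)).
  by rewrite cosB; ring.
have iE : mu.-integrable setT (EFin \o (fun t => gdens 1 X t * cos (y * ln t - c))).
  have := lebesgue_integrableD measurableT (lebesgue_integrableZ (cos c) measurableT igc)
     (lebesgue_integrableZ (sin c) measurableT igs).
  by apply: eq_integrable => // t _ /=; rewrite E.
have I0 : \int[mu]_t (gdens 1 X t * cos (y * ln t - c)) = 0.
  under eq_Rintegral => t _ do rewrite E.
  by rewrite RintegralD ?RintegralZl ?re0 ?im0 ?mulr0 ?addr0//; exact: lebesgue_integrableZ.
have XS : 0 < X + 1 by lra.
have igS := integrable_gdens (@ltr01 R) XS; have igV := integrable_gdens (@ltr01 R) X10.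
(* A lower bound for the rotated integrand: [1 - cos z <= z^2 / 2] with [z = y ln (t / X)], then
   [sqr_ln_le]. Its integral is [Gamma X (1 - 2 y^2 / (X - 1))]. *)
pose h t := gdens 1 X t - 2 * y ^+ 2 * (X^-1 * gdens 1 (X + 1) t - 2 * gdens 1 X t + X * gdens 1 (X - 1) t).
have ih1 : mu.-integrable setT (EFin \o (fun t => X^-1 * gdens 1 (X + 1) t - 2 * gdens 1 X t + X * gdens 1 (X - 1) t)).
  by apply: lebesgue_integrableD => //; [apply: lebesgue_integrableB => //|]; exact: lebesgue_integrableZ.
have ih : mu.-integrable setT (EFin \o h).
  by apply: lebesgue_integrableB => //; exact: lebesgue_integrableZ.
have : \int[mu]_t h t <= 0.
  rewrite -I0; apply: le_Rintegral => // t _.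
  rewrite /h -gdensM -gdensV gdensE; case: ltP => t0; last by rewrite !mul0r !mulr0 subr0 addr0 mulr0 subr0.
  set g := t `^ _ * _; have g0 : 0 <= g by rewrite mulr_ge0 ?powR_ge0 ?expR_ge0.
  have -> : g - 2 * y ^+ 2 * (X^-1 * (g * t) - 2 * g + X * (g * t^-1)) =
    g * (1 - 2 * y ^+ 2 * (t / X - 2 + (t / X)^-1)) by rewrite invf_div; ring.
  apply: ler_wpM2l => //.
  have := onem_cos_le (y * ln t - c); have := sqr_ln_le (divr_gt0 t0 X0).
  rewrite ln_div ?posrE// /c -mulrBr exprMn => h1 h2.
  have := ler_wpM2l (sqr_ge0 y) h1 => h3; lra.
apply/negP; rewrite -ltNge /h RintegralB//; last exact: lebesgue_integrableZ.
rewrite RintegralZl// RintegralD//; last 2 first.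
- by apply: lebesgue_integrableB => //; exact: lebesgue_integrableZ.
- exact: lebesgue_integrableZ.
rewrite RintegralB//; [|exact: lebesgue_integrableZ..].
rewrite !RintegralZl// -!Gamma_gt0E// GammaS//.
have GX : Gamma X = (X - 1) * Gamma (X - 1) by rewrite -GammaS// subrK.
have GX0 := Gamma_gt0 X10; rewrite GX mulrA mulVf ?gt_eqF// mul1r.
nra.
Qed.

End cgamma.

(** * Averages of the Poisson kernel *)

Section poisson.
Context {R : realType}.
Local Notation mu := (@lebesgue_measure R).
Implicit Types (e a A s y t w : R).

Lemma Rintegral_expR_cos e a : 0 < e ->
  \int[mu]_(y in `]0, +oo[) (expR (- (e * y)) * cos (a * y)) = e / (e ^+ 2 + a ^+ 2).
Proof.
move=> e0; have D0 : e ^+ 2 + a ^+ 2 != 0.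
  by rewrite gt_eqF// ltr_pwDl ?sqr_ge0// exprn_gt0.
pose F := fun y => expR (- (e * y)) * ((e ^+ 2 + a ^+ 2)^-1 * (a * sin (a * y) - e * cos (a * y))).
have dF y : is_derive y 1 F (expR (- (e * y)) * cos (a * y)).
  rewrite /F; apply: is_derive_eq; rewrite /GRing.scale/=; field.
  by rewrite -?expr2.
have cf y : {for y, continuous (fun y => expR (- (e * y)) * cos (a * y))}.
  by apply/differentiable_continuous/derivable1_diffP; exact: ex_derive.
rewrite (@Rintegral_oy_FTC R 0 _ F (F 0) 0).
- by rewrite /F !mulr0 oppr0 expR0 sin0 cos0 mulr0 sub0r mul1r mulr1 sub0r mulrN opprK mulrC.
- by move=> y _.
- by apply: cvg_at_right_filter; apply/differentiable_continuous/derivable1_diffP; have [] := dF 0.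
- apply/cvgr0Pnorm_lt => d d0.
  pose M := `|(e ^+ 2 + a ^+ 2)^-1| * (`|a| + `|e|) + 1.
  have M0 : 0 < M by rewrite ltr_wpDl// mulr_ge0// addr_ge0.
  have /cvgr0Pnorm_lt/(_ (d / M) (divr_gt0 d0 M0)) := cvg_expRMN e0.
  apply: filterS => y; rewrite ltr_pdivlMr// => /le_lt_trans; apply.
  rewrite /F normrM ler_wpM2l// normrM (@le_trans _ _ (`|(e ^+ 2 + a ^+ 2)^-1| * (`|a| + `|e|)))//.
    rewrite ler_wpM2l// (le_trans (ler_normB _ _))// !normrM lerD// ler_piMr//.
      exact: sin_max.
    exact: cos_max.
  by rewrite lerDl.
- apply: (@lebesgue_dominated_integrable R _ _ (fun y => expR (- (e * y)))) => //.
  + apply: measurable_funTS; apply: continuous_measurable_fun; exact: cf.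
  + exact: (integrable_expRM 0 e0).1.
  + by move=> y _; rewrite normrM ger0_norm ?expR_ge0// ler_piMr ?expR_ge0// cos_max.
Qed.

Lemma atan_max t : `|atan t| <= pi / 2.
Proof. by rewrite ler_norml !ltW// ?atan_gtNpi2// atan_ltpi2. Qed.

(** The average over the third variable [w] of the Meijer density: [w ^ (s - 1)] is its weight and
    [ln w + A] the whole phase, [A] being the contribution of the two other variables. *)
Definition poisson01 s e A := \int[mu]_(w in `]0, 1[) (w `^ (s - 1) * (e / (e ^+ 2 + (ln w + A) ^+ 2))).

Lemma poisson01E s e A : 0 < s -> 0 < e ->
  mu.-integrable `]0, 1[ (EFin \o (fun w => w `^ (s - 1) * (e / (e ^+ 2 + (ln w + A) ^+ 2)))) /\
  poisson01 s e A = atan (A / e) - s * \int[mu]_(w in `]0, 1[) (w `^ (s - 1) * atan ((ln w + A) / e)).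
Proof.
move=> s0 e0.
have D0 w : 0 < e ^+ 2 + (ln w + A) ^+ 2 by rewrite ltr_pwDl ?sqr_ge0// exprn_gt0.
have mln : measurable_fun setT (fun w : R => ln w + A) by apply: measurable_funD => //; exact: measurable_ln.
have i1 : mu.-integrable `]0, 1[ (EFin \o (fun w => w `^ (s - 1) * (e / (e ^+ 2 + (ln w + A) ^+ 2)))).
  apply: (@lebesgue_dominated_integrable R _ _ (fun w => e^-1 * w `^ (s - 1))) => //.
  - apply: measurable_funM; first exact: measurable_fun_powR.
    apply: measurable_funTS; apply: measurable_funM => //.
    apply: (measurableT_comp (f := fun z : R => (e ^+ 2 + z ^+ 2)^-1)) => //.
    apply: continuous_measurable_fun => z.
    apply: cvgV; first by rewrite gt_eqF// ltr_pwDl ?sqr_ge0// exprn_gt0.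
    by apply: cvgD; [exact: cvg_cst|exact: exprn_continuous].
  - by apply: lebesgue_integrableZ => //; exact: (integrable_powR01 s0).1.
  - move=> w _; rewrite ger0_norm; last by rewrite mulr_ge0 ?powR_ge0// divr_ge0// ltW.
    rewrite mulrC ler_wpM2r ?powR_ge0// ler_pdivrMr//.
    rewrite mulrDr expr2 mulrA mulVf ?gt_eqF// mul1r lerDl mulr_ge0 ?sqr_ge0//.
    by rewrite invr_ge0 ltW.
have i2 : mu.-integrable `]0, 1[ (EFin \o (fun w => w `^ (s - 1) * atan ((ln w + A) / e))).
  apply: (@lebesgue_dominated_integrable R _ _ (fun w => pi / 2 * w `^ (s - 1))) => //.
  - apply: measurable_funM; first exact: measurable_fun_powR.
    apply: measurable_funTS; apply: (measurableT_comp (f := @atan R)).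
      by apply: continuous_measurable_fun => z; exact: continuous_atan.
    exact: measurable_funM.
  - by apply: lebesgue_integrableZ => //; exact: (integrable_powR01 s0).1.
  - move=> w _; rewrite normrM ger0_norm ?powR_ge0// mulrC ler_wpM2r ?powR_ge0//.
    exact: atan_max.
split=> //.
pose F w := w `^ s * atan ((ln w + A) / e).
pose f w := s * (w `^ (s - 1) * atan ((ln w + A) / e)) + w `^ (s - 1) * (e / (e ^+ 2 + (ln w + A) ^+ 2)).
have dF w : 0 < w -> is_derive w 1 F (f w).
  move=> w0; have H1 := is_derive1_powR s w0; have H2 := is_derive1_ln w0.
  rewrite /F; apply: is_derive_eq; rewrite /GRing.scale/= /f (powRE1 s w0).
  field.
  by rewrite (gt_eqF e0) (gt_eqF w0) gt_eqF//.
have fi : mu.-integrable `]0, 1[ (EFin \o f).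
  by apply: lebesgue_integrableD => //; exact: lebesgue_integrableZ.
have F0 : F w @[w --> 0^'+] --> 0.
  by apply: (powR_bounded_cvg0 (M := pi / 2)) => // w; exact: atan_max.
have F1 : F w @[w --> 1^'-] --> atan (A / e).
  have [dF1 _] := dF 1 ltr01.
  have -> : atan (A / e) = F 1 by rewrite /F powR1 ln1 add0r mul1r.
  by apply: cvg_at_left_filter; exact/differentiable_continuous/derivable1_diffP.
have cf w : 0 < w < 1 -> {for w, continuous f}.
  move=> /andP[w0 _].
  have cp := @continuous_powR R (s - 1) w w0.
  have cl : ln z + A @[z --> w] --> ln w + A by apply: cvgD; [exact: continuous_ln|exact: cvg_cst].
  apply: cvgD; apply: cvgM.
  - exact: cvg_cst.
  - apply: cvgM; first exact: cp.
    apply: (@cvg_comp _ _ _ (fun z => (ln z + A) / e) (@atan R)); last exact: continuous_atan.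
    by apply: cvgMl.
  - exact: cp.
  - apply: cvgM; first exact: cvg_cst.
    apply: cvgV; first by rewrite gt_eqF.
    apply: cvgD; first exact: cvg_cst.
    by apply: cvgM.
have : \int[mu]_(w in `]0, 1[) f w = atan (A / e) - 0.
  apply: (Rintegral_oo_FTC ltr01 cf _ F0 F1) => //.
  by move=> w /andP[w0 _]; exact: dF.
rewrite subr0 /f RintegralD ?RintegralZl//; last exact: lebesgue_integrableZ.
by rewrite -/(poisson01 s e A) => <-; rewrite [X in X - _]addrC addrK.
Qed.

(** Each of the two arctangent terms contributes at most [pi / 2]. The bound is uniform in [e] and
    [A], hence usable for dominated convergence in the two other variables. *)
Lemma poisson01_bounded s e A : 0 < s -> 0 < e -> 0 <= poisson01 s e A <= pi.
Proof.
move=> s0 e0; apply/andP; split.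
  apply: Rintegral_ge0 => w _; rewrite mulr_ge0 ?powR_ge0// divr_ge0// ?(ltW e0)//.
  by rewrite addr_ge0 ?sqr_ge0.
have [_ ->] := poisson01E A s0 e0.
have i1 := (integrable_powR01 s0).1.
have i2 : mu.-integrable `]0, 1[ (EFin \o (fun w => pi / 2 * w `^ (s - 1))).
  exact: lebesgue_integrableZ.
suff : `|\int[mu]_(w in `]0, 1[) (w `^ (s - 1) * atan ((ln w + A) / e))| <= pi / 2 * s^-1.
  move: (\int[mu]_(w in _) _) => I; rewrite ler_norml => /andP[h _].
  have h2 := atan_ltpi2 (A / e).
  have := ler_wpM2l (ltW s0) h; rewrite mulrN mulrCA divff ?gt_eqF// mulr1.
  by move: (atan _) (s * I) h2 => a b h2 h3; lra.
rewrite -(integrable_powR01 s0).2 -RintegralZl//.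
have i3 : mu.-integrable `]0, 1[ (EFin \o (fun w => w `^ (s - 1) * atan ((ln w + A) / e))).
  apply: (@lebesgue_dominated_integrable R _ _ (fun w => pi / 2 * w `^ (s - 1))) => //.
  - apply: measurable_funM; first exact: measurable_fun_powR.
    apply: measurable_funTS; apply: (measurableT_comp (f := @atan R)).
      by apply: continuous_measurable_fun => z; exact: continuous_atan.
    by apply: measurable_funM => //; apply: measurable_funD => //; exact: measurable_ln.
  - move=> w _; rewrite normrM ger0_norm ?powR_ge0// mulrC ler_wpM2r ?powR_ge0//.
    exact: atan_max.
apply: (le_trans (le_normr_Rintegral _ i3)) => //.
apply: le_Rintegral => //; first exact: (integrable_norm i3).
move=> w _; rewrite normrM ger0_norm ?powR_ge0// mulrC ler_wpM2r ?powR_ge0//.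
exact: atan_max.
Qed.

Lemma cvg_atan_sg t : atan (t * n.+1%:R) @[n --> \oo] --> pi / 2 * Num.sg t.
Proof.
have H (x : R) : 0 < x -> atan (x * n.+1%:R) @[n --> \oo] --> pi / 2.
  move=> x0; apply: (@cvg_comp _ _ _ (fun n : nat => x * n.+1%:R) (@atan R) _ (pinfty_nbhs R)); last exact: cvgy_atan.
  apply/cvgryPge => M; near=> n.
  rewrite mulrC -ler_pdivrMr//.
  apply: (@le_trans _ _ n%:R); last by rewrite ler_nat.
  by near: n; exact: nbhs_infty_ger.
have [t0|t0|t0] := ltgtP 0 t.
- by rewrite gtr0_sg// mulr1; exact: H.
- rewrite ltr0_sg// mulrN1.
  rewrite (_ : (fun n : nat => _) = (fun n => - atan (- t * n.+1%:R))).
    by apply: cvgN; apply: H; rewrite oppr_gt0.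
  by apply/funext => n; rewrite mulNr atanN opprK.
- by rewrite -t0; under eq_fun do rewrite mul0r atan0; rewrite sgr0 mulr0; exact: cvg_cst.
Unshelve. all: end_near. Qed.

(** The limit of [poisson01] as [e] tends to 0. The kernel has mass [pi] in the variable [ln w] and
    concentrates at [w = e^(- A)], where the weight [w ^ s] equals [e^(- s A)]; this point lies in
    []0, 1[] when [A > 0], and at the endpoint [A = 0] half of the mass is seen. *)
Definition step_exp s A : R :=
  if 0 < A then pi * expR (- (s * A)) else if A == 0 then pi / 2 else 0.

Lemma measurable_sgr : measurable_fun setT (@Num.sg R).
Proof.
rewrite (_ : Num.sg = (fun x : R => if x < 0 then -1 else if 0 < x then 1 else 0)).
  apply: measurable_fun_if => //; first exact: measurable_fun_ltr.
  by apply: measurable_funTS; apply: measurable_fun_if => //; exact: measurable_fun_ltr.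
apply/funext => x; case: ltgtP => x0.
- by rewrite ltr0_sg.
- by rewrite gtr0_sg.
- by rewrite x0 sgr0.
Qed.

Lemma cvg_poisson01 s A : 0 < s ->
  poisson01 s n.+1%:R^-1 A @[n --> \oo] --> step_exp s A.
Proof.
move=> s0.
under eq_fun => n do rewrite (poisson01E A s0 _).2 ?invr_gt0// invrK.
have i1 := (integrable_powR01 s0).1.
have : pi / 2 * Num.sg A - s * \int[mu]_(w in `]0, 1[) (w `^ (s - 1) * (pi / 2 * Num.sg (ln w + A))) = step_exp s A.
  (* The point where [ln w + A] changes sign; it lies below 1 exactly when [A > 0]. *)
  pose c := expR (- A); have c0 : 0 < c by exact: expR_gt0.
  have lnc : ln c = - A by rewrite expRK.
  have cs : c `^ s = expR (- (s * A)) by rewrite /powR gt_eqF// lnc mulrN.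
  have neg : A <= 0 -> s * \int[mu]_(w in `]0, 1[) (w `^ (s - 1) * (pi / 2 * Num.sg (ln w + A))) = - (pi / 2).
    move=> A0; have E w : w \in `]0, 1[%classic -> w `^ (s - 1) * (pi / 2 * Num.sg (ln w + A)) = - (pi / 2) * w `^ (s - 1).
      rewrite inE/= in_itv/= => w01; have := ln_lt0 w01 => h.
      by rewrite ltr0_sg; [ring|lra].
    under eq_Rintegral => w w01 do rewrite E//.
    by rewrite RintegralZl// (integrable_powR01 s0).2 mulrCA divff ?mulr1// gt_eqF.
  rewrite /step_exp; case: ltgtP => A0.
  - have c1 : c < 1 by rewrite -expR0 ltr_expR oppr_lt0.
    pose g := (fun w : R => w `^ (s - 1)).
    have [ic icE] := integrable_powR0 c0 s0.
    have ic' : mu.-integrable `]0, c] (EFin \o g).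
      apply/integrableP; split; first by apply/measurable_EFinP; exact: measurable_fun_powR.
      move/integrableP : ic => [_]; rewrite integral_itv_bndo_bndc//.
      by do 2 apply: measurableT_comp => //; exact: measurable_fun_powR.
    have E w : w \in `]0, 1[%classic -> w `^ (s - 1) * (pi / 2 * Num.sg (ln w + A)) =
      pi / 2 * (g w - (g \_ `]0, c]) w - (g \_ `]0, c[) w).
      rewrite inE/= in_itv/= => /andP[w0 w1]; rewrite !restrict0E !mem_setE !in_itv/= w0/=.
      rewrite -[A]opprK -lnc.
      case: (ltgtP w c) => wc.
      + by rewrite ltr0_sg ?subr_lt0 ?ltr_ln ?posrE// /g; ring.
      + by rewrite gtr0_sg ?subr_gt0 ?ltr_ln ?posrE// /g; ring.
      + by rewrite wc subrr sgr0 /g; ring.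
    have sub1 : `]0, c] `<=` `]0, (1 : R)[.
      by move=> w; rewrite /= !in_itv/= => /andP[-> /le_lt_trans]; apply.
    have sub2 : `]0, c[ `<=` `]0, (1 : R)[.
      by move=> w; rewrite /= !in_itv/= => /andP[-> /lt_trans]; apply.
    have j1 := lebesgue_integrableS measurableT (measurable_itv `]0, 1[) (@subsetT _ _) (integrable_setT_restrict (measurable_itv _) ic').
    have j2 := lebesgue_integrableS measurableT (measurable_itv `]0, 1[) (@subsetT _ _) (integrable_setT_restrict (measurable_itv _) ic).
    under eq_Rintegral => w w01 do rewrite E//.
    rewrite RintegralZl//; last by apply: lebesgue_integrableB => //; exact: lebesgue_integrableB.
    rewrite RintegralB//; last exact: lebesgue_integrableB.
    rewrite RintegralB// -!Rintegral_mkcondr (setIidr sub1) (setIidr sub2).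
    rewrite -Rintegral_itv_bndo_bndc// icE (integrable_powR01 s0).2 cs gtr0_sg//.
    by field; rewrite gt_eqF.
  - by rewrite (neg (ltW A0)) ltr0_sg//; ring.
  - by rewrite neg -A0 ?sgr0//; ring.
move=> <-; apply: cvgB; first exact: cvg_atan_sg.
apply: cvgMr; apply: (@cvg_lebesgue_dominated R _ _ _ (fun w => pi / 2 * w `^ (s - 1))) => //.
- exact: lebesgue_integrableZ.
- apply: measurable_funM; first exact: measurable_fun_powR.
  apply: measurable_funTS; apply: measurable_funM => //.
  apply: (measurableT_comp (f := @Num.sg R)); first exact: measurable_sgr.
  by apply: measurable_funD => //; exact: measurable_ln.
- apply: nearW => n; apply: measurable_funM; first exact: measurable_fun_powR.
  apply: measurable_funTS; apply: (measurableT_comp (f := @atan R)).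
    by apply: continuous_measurable_fun => z; exact: continuous_atan.
  by apply: measurable_funM => //; apply: measurable_funD => //; exact: measurable_ln.
- apply: nearW => n w _; rewrite normrM ger0_norm ?powR_ge0// mulrC ler_wpM2r ?powR_ge0//.
  exact: atan_max.
- by apply: aeW => w _; apply: cvgMr; exact: cvg_atan_sg.
Qed.

End poisson.

(** * Cosine transforms and their exponential averages *)

Section poisson_average.
Context {R : realType} d (T : measurableType d).
Local Notation mu := (@lebesgue_measure R).
Variables (m : {sigma_finite_measure set T -> \bar R}) (g th : T -> R).
Hypotheses (gi : m.-integrable setT (EFin \o g)) (mth : measurable_fun setT th).
Implicit Types (e y : R).

Definition cosint (y : R) : R := \int[m]_z (g z * cos (y * th z)).

Let integrable_weighted (E : R -> R) : mu.-integrable setT (EFin \o E) ->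
  (sigma_prod mu m).-integrable setT (EFin \o (fun z => E z.1 * g z.2 * cos (z.1 * th z.2))).
Proof.
move=> Ei; apply: (@integrable_weight_bounded _ _ R (sigma_prod mu m) _ _ 1).
- exact: (@integrable_tensor _ _ (measurableTypeR R) T R mu m E g).
- apply: (measurableT_comp (f := @cos R)); first by apply: continuous_measurable_fun; exact: continuous_cos.
  apply: measurable_funM => //; exact: (measurableT_comp mth).
- by move=> z; exact: cos_max.
Qed.

Let cosint_integrable y : m.-integrable setT (EFin \o (fun z => g z * cos (y * th z))).
Proof. by apply: integrable_weight_cos => //; exact: measurable_funM. Qed.

(** A Gaussian weight in [y] makes the integrand integrable on the product, so Fubini gives
    measurability of the weighted transform; multiplying by [e^(y^2)] removes the weight. *)
Lemma measurable_cosint : measurable_fun setT cosint.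
Proof.
have := measurable_Rintegral1 (integrable_weighted (@integrableT_gauss R)).
move=> h; rewrite (_ : cosint = (fun y => expR (y ^+ 2) *
    \int[m]_z (gauss_fun y * g z * cos (y * th z)))).
  apply: measurable_funM => //; apply: continuous_measurable_fun => y.
  by apply: continuous_comp; [exact: exprn_continuous|exact: continuous_expR].
apply/funext => y; under eq_Rintegral do rewrite -mulrA.
by rewrite RintegralZl// mulrA /gauss_fun -expRD subrr expR0 mul1r.
Qed.

Lemma cosintN y : cosint (- y) = cosint y.
Proof. by apply: eq_Rintegral => z _; rewrite mulNr cosN. Qed.

(** The damping makes the integrand jointly integrable; after exchanging the integrals, the inner
    one is the Laplace transform of a cosine. *)
Lemma Rintegral_expR_cosint e : 0 < e ->
  \int[mu]_(y in `]0, +oo[) (expR (- (e * y)) * cosint y) =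
  \int[m]_z (g z * (e / (e ^+ 2 + th z ^+ 2))).
Proof.
move=> e0; have [iE _] := integrable_expRM (0 : R) e0.
have := Rintegral_swap (integrable_weighted (integrable_setT_restrict (measurable_itv _) iE)).
rewrite /= => h; rewrite [LHS]Rintegral_mkcond; transitivity (\int[mu]_y \int[m]_z
  (((fun t => expR (- (e * t))) \_ `]0, +oo[) y * g z * cos (y * th z))).
  apply: eq_Rintegral => y _; under [RHS]eq_Rintegral do rewrite -mulrA.
  rewrite RintegralZl// !restrict0E; case: ifP => _; by rewrite ?mul0r.
rewrite h; apply: eq_Rintegral => z _.
rewrite -(Rintegral_expR_cos (th z) e0) -RintegralZl//; last first.
  apply: (@lebesgue_dominated_integrable R _ _ _ (measurable_itv _) _ iE).
    apply: measurable_funTS; apply: continuous_measurable_fun => y.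
    by apply/differentiable_continuous/derivable1_diffP; exact: ex_derive.
  by move=> y _; rewrite normrM ger0_norm ?expR_ge0// ler_piMr ?expR_ge0// cos_max.
rewrite [RHS]Rintegral_mkcond; apply: eq_Rintegral => y _; rewrite !restrict0E.
by case: ifP => _; rewrite ?mul0r ?mulr0//; rewrite [th z * y]mulrC; ring.
Qed.

End poisson_average.

Section even.
Context {R : realType}.
Local Notation mu := (@lebesgue_measure R).

Lemma Rintegral_even (f : R -> R) : mu.-integrable setT (EFin \o f) ->
  (forall y, f (- y) = f y) -> \int[mu]_y f y = 2 * \int[mu]_(y in `]0, +oo[) f y.
Proof.
move=> fi fe; have mf : measurable_fun setT f by apply/measurable_EFinP; exact: measurable_int fi.
have fiS (D : set R) : measurable D -> mu.-integrable D (EFin \o f).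
  by move=> mD; apply: lebesgue_integrableS fi.
have U : `]-oo, 0] `|` `]0, +oo[ = [set: R].
  apply/seteqP; split => // y _ /=; rewrite !in_itv/= andbT.
  by case: (leP y 0); [left|right].
have -> : \int[mu]_y f y = \int[mu]_(y in `]-oo, 0]) f y + \int[mu]_(y in `]0, +oo[) f y.
  rewrite -U Rintegral_setU//; first by rewrite U.
  by apply/disj_setPS => y [/=]; rewrite !in_itv/= andbT ltNge => ->.
suff -> : \int[mu]_(y in `]-oo, 0]) f y = \int[mu]_(y in `]0, +oo[) f y by ring.
rewrite Rintegral_itv_obnd_cbnd; last exact: fiS.
rewrite [LHS]Rintegral_mkcond [RHS]Rintegral_mkcond [LHS]Rintegral_opp; last first.
  by apply/(measurable_restrictT _ (measurable_itv _)); exact: measurable_funTS.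
by apply: eq_Rintegral => y _; rewrite !restrict0E !mem_setE !in_itv/= oppr_le0 andbT fe.
Qed.

Lemma integrable_invDsqr : mu.-integrable setT (EFin \o (fun y : R => (1 + y ^+ 2)^-1)).
Proof.
have D0 (y : R) : 0 < 1 + y ^+ 2 by rewrite ltr_wpDr ?sqr_ge0.
have cf : continuous (fun y : R => (1 + y ^+ 2)^-1).
  move=> y; apply: cvgV; first by rewrite gt_eqF.
  by apply: cvgD; [exact: cvg_cst|exact: exprn_continuous].
have [ip _] : mu.-integrable `]0, +oo[ (EFin \o (fun y : R => (1 + y ^+ 2)^-1)) /\
    \int[mu]_(y in `]0, +oo[) (1 + y ^+ 2)^-1 = pi / 2 - 0.
  apply: (@ge0_Rintegral_oy_FTC R 0 _ (@atan R)).
  - by move=> y _; exact: cf.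
  - by rewrite -{2}(@atan0 R); apply: cvg_at_right_filter; exact: continuous_atan.
  - exact: cvgy_atan.
  - by move=> y _; rewrite invr_ge0 ltW.
have i1 := integrable_setT_restrict (measurable_itv _) ip.
have i2 := integrable_opp i1.
have i3 := integrable_indic_itv (-1 : R) 1 false true.
apply: (@lebesgue_dominated_integrable R _ _ _ measurableT _
  (lebesgue_integrableD measurableT (lebesgue_integrableD measurableT i1 i2) i3)).
  by apply: continuous_measurable_fun.
move=> y _; rewrite ger0_norm ?invr_ge0 ?(ltW (D0 y))// !restrict0E !mem_setE !in_itv/= !andbT.
rewrite oppr_gt0 sqrrN; case: (ltgtP y 0) => y0.
- by rewrite add0r lerDl indicE.
- by rewrite addr0 lerDl indicE.
- rewrite y0 expr0n/= addr0 invr1 !add0r indicE mem_set//=; last by rewrite in_itv/=; lra.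
Qed.

End even.

(** * The Meijer function as a double integral *)

(* Read with [A], [B], [C] the squared moduli of [CGamma (s + b2 + iy)],
   [CBeta (s + b1 + iy, q)] and [CBeta (s + iy, 1)], and [D = 1 + y ^ 2]. *)
Lemma decay_product (R : realType) (A B C D S1 S2 K1 K2 : R) :
  0 <= A -> 0 <= B -> 0 <= C -> 0 <= D -> D <= S1 -> D <= S2 ->
  A * S2 <= 2 * K1 ^+ 2 -> B <= 2 * K2 ^+ 2 -> C * S1 = 1 ->
  1 * (A * B * C) * D ^+ 2 <= (2 * K1 * K2) ^+ 2.
Proof.
move=> A0 B0 C0 D0 h1 h2 e2 e1 e3.
have g3 : C * D <= 1 by rewrite -e3 ler_wpM2l.
have g2 : A * D <= 2 * K1 ^+ 2 by apply: le_trans e2; rewrite ler_wpM2l.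
have -> : 1 * (A * B * C) * D ^+ 2 = (A * D) * B * (C * D) by ring.
have -> : (2 * K1 * K2) ^+ 2 = (2 * K1 ^+ 2) * (2 * K2 ^+ 2) * 1 by ring.
apply: ler_pM => //; rewrite ?mulr_ge0//.
by apply: ler_pM => //; rewrite mulr_ge0.
Qed.

(** * The Mellin-Barnes integrand on its contour *)

Section meijer_integrand.
Context {R : realType}.
Local Notation mu := (@lebesgue_measure R).
Local Notation T := ((measurableTypeR R * measurableTypeR R) * measurableTypeR R)%type.
Local Notation m2 := (sigma_prod mu mu).
Local Notation m3 := (sigma_prod m2 mu).
Local Open Scope complex_scope.
Variables (b1 b2 q x : R).
Hypotheses (q0 : 0 < q) (x0 : 0 < x).

(** The abscissa chosen in [meijerG]. Lying one unit to the left of the first pole, it makes [s],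
    [s + b1] and [s + b2] at least 1, whence [1 + y^2 <= s^2 + y^2] in the decay bound. *)
Let c := Num.min b1 (Num.min b2 0) - 1.
Let s := - c.

Let s1 : 1 <= s. Proof. by rewrite /s /c; case: (leP b1); case: (leP b2); lra. Qed.
Let sb1 : 1 <= s + b1. Proof. by rewrite /s /c; case: (leP b1); case: (leP b2); lra. Qed.
Let sb2 : 1 <= s + b2. Proof. by rewrite /s /c; case: (leP b1); case: (leP b2); lra. Qed.

Let s0 : 0 < s. Proof. exact: lt_le_trans ltr01 s1. Qed.
Let sb10 : 0 < s + b1. Proof. exact: lt_le_trans ltr01 sb1. Qed.
Let sb20 : 0 < s + b2. Proof. exact: lt_le_trans ltr01 sb2. Qed.

(* By [CGamma_Beta], the Mellin-Barnes integrand on the line [Re t = - s] is the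
   Fourier transform of the density [mj_weight] along the phase [mj_phase]. *)
Definition mj_weight (z : T) : R :=
  gdens 1 (s + b2) z.1.1 * bdens (s + b1) q z.1.2 * bdens s 1 z.2.
Definition mj_phase (z : T) : R := ln z.1.1 + ln z.1.2 - ln x + ln z.2.

Let iW2 := @integrable_tensor _ _ (measurableTypeR R) (measurableTypeR R) R mu mu _ _
  (integrable_gdens ltr01 sb20) (integrable_bdens sb10 q0).

Lemma integrable_mj_weight : m3.-integrable setT (EFin \o mj_weight).
Proof.
exact: (@integrable_tensor _ _ _ _ R m2 mu _ _ iW2 (integrable_bdens s0 ltr01)).
Qed.

Lemma measurable_mj_phase : measurable_fun setT mj_phase.
Proof.
have ml : measurable_fun setT (@ln R) by exact: measurable_ln.
apply: measurable_funD; first apply: measurable_funB => //; first apply: measurable_funD.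
- by apply: (measurableT_comp ml); apply: measurableT_comp.
- by apply: (measurableT_comp ml); apply: measurableT_comp.
- by apply: (measurableT_comp ml).
Qed.

Let NC (z : R[i]) : R := complex.Re z ^+ 2 + complex.Im z ^+ 2.

Let NCM z w : NC (z * w) = NC z * NC w.
Proof. by case: z => a b; case: w => a' b'; rewrite /NC complex_mulE /=; ring. Qed.

Let mj_expint y : expint m3 mj_weight (fun z => y * mj_phase z) =
  (cos (- y * ln x) +i* sin (- y * ln x)) *
  (CGamma ((s + b2) +i* y) * CBeta (s + b1) q y * CBeta s 1 y).
Proof.
rewrite CGammaE// /CBeta.
rewrite (@expint_tensor _ _ (measurableTypeR R) (measurableTypeR R) R mu mu)//;
  [|exact: integrable_gdens|exact: measurable_Mln|exact: integrable_bdens|exact: measurable_Mln].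
have mph : measurable_fun setT (fun z : measurableTypeR R * measurableTypeR R => y * ln z.1 + y * ln z.2).
  by apply: measurable_funD; [exact: (measurableT_comp (measurable_Mln y))|exact: (measurableT_comp (measurable_Mln y))].
rewrite (@expint_tensor _ _ _ (measurableTypeR R) R m2 mu _ _ _ _ iW2 mph (integrable_bdens s0 ltr01) (measurable_Mln y)).
rewrite -expint_shift//; last 2 first.
- exact: integrable_mj_weight.
- apply: measurable_funD; first apply: measurable_funD;
    apply: (measurableT_comp (measurable_Mln y)) => //; exact: measurableT_comp.
congr expint; apply/funext => z; rewrite /mj_phase; ring.
Qed.

(** For [t = c + iy] the arguments are [s + b - iy], hence the frequency [- y]. The pair of
    parameters 1 and 0 leaves [1 / (s - iy)], which is [CBeta s 1 (- y)]; the quotient of gamma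
    factors at [b1] and [b1 + q] is a beta integral up to [Gamma q]; and [x ^ t] adds [- ln x] to
    the phase. *)
Lemma mj_integrandE y : (Gamma q)%:C *
    meijerG_integrand 1 (b1 + q) b1 b2 0 x (c +i* y) =
  (x `^ c)%:C * expint m3 mj_weight (fun z => - y * mj_phase z).
Proof.
rewrite mj_expint opprK /meijerG_integrand.
have sub (b : R) : b%:C - (c +i* y) = (s + b) +i* (- y).
  by rewrite (_ : b%:C = b +i* 0)// /s; apply/eqP; rewrite eq_complex /= sub0r eqxx andbT addrC.
rewrite !sub addr0 CGammaS// addrA.
have := CGamma_Beta (- y) sb10 q0; set G1 := CGamma _; set Ga := CGamma _ => H.
have Ga0 : Ga != 0 by apply: CGamma_neq0; rewrite addr_gt0.
have G30 := CGamma_neq0 (- y) s0.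
have S0 : s +i* (- y) != 0 by rewrite eq_complex /= negb_and gt_eqF.
have -> : CBeta s 1 (- y) = (s +i* - y)^-1.
  by apply: (mulfI S0); rewrite CBeta1// divff.
have -> : Cpow x (c +i* y) = (x `^ c)%:C * (cos (y * ln x) +i* sin (y * ln x)) by [].
move: (CGamma (s +i* - y)) G30 H => G3 G30 H.
move: (cos (y * ln x) +i* sin (y * ln x)) (CGamma _) (x `^ c)%:C => P G2 X.
transitivity (X * P * ((G1 * (Gamma q)%:C) * G2 * G3 / ((s +i* - y) * G3 * Ga))); first by ring.
rewrite H; field; by rewrite Ga0 G30 S0.
Qed.

(** One factor of order [1 / |y|] is [CBeta s 1 y]; the other comes from writing the gamma factor as
    [CGamma (s + b2 + 1 + iy) / (s + b2 + iy)]. The remaining beta factor is only bounded. *)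
Lemma mj_cosint_bound : exists2 K, 0 <= K &
  forall y, `|cosint m3 mj_weight mj_phase y| <= K / (1 + y ^+ 2).
Proof.
have sb21 : 0 < s + b2 + 1 by rewrite addr_gt0.
pose K1 := \int[mu]_t gdens 1 (s + b2 + 1) t; pose K2 := \int[mu]_t bdens (s + b1) q t.
have NE (g th : R -> R) : mu.-integrable setT (EFin \o g) -> measurable_fun setT th ->
    (forall t, 0 <= g t) -> NC (expint mu g th) <= 2 * (\int[mu]_t g t) ^+ 2.
  move=> gi mth g0; rewrite /NC /expint /=.
  have bd (h : R -> R) : mu.-integrable setT (EFin \o (fun t => g t * h t)) -> (forall t, `|h t| <= 1) ->
      (\int[mu]_t (g t * h t)) ^+ 2 <= (\int[mu]_t g t) ^+ 2.
    move=> ghi h1; rewrite -[leLHS]real_normK ?num_real// ler_sqr ?nnegrE ?normr_ge0//; last exact: Rintegral_ge0.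
    apply: (le_trans (le_normr_Rintegral _ ghi)) => //.
    apply: le_Rintegral => //; first exact: (integrable_norm ghi).
    by move=> t _; rewrite normrM ger0_norm// ler_piMr.
  rewrite mulr_natl mulr2n lerD//; apply: bd.
  - exact: (@integrable_weight_cos _ (measurableTypeR R)).
  - by move=> t; exact: cos_max.
  - exact: (@integrable_weight_sin _ (measurableTypeR R)).
  - by move=> t; exact: sin_max.
have K10 : 0 <= K1 by apply: Rintegral_ge0 => t _; exact: gdens_ge0.
have K20 : 0 <= K2 by apply: Rintegral_ge0 => t _; exact: bdens_ge0.
exists (2 * K1 * K2); first by rewrite !mulr_ge0.
move=> y; rewrite -/(complex.Re (expint m3 mj_weight (fun z => y * mj_phase z))).
have y2 : 0 <= y ^+ 2 by exact: sqr_ge0.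
have D0 : 0 < 1 + y ^+ 2 by rewrite ltr_wpDr.
suff : NC (expint m3 mj_weight (fun z => y * mj_phase z)) * (1 + y ^+ 2) ^+ 2 <= (2 * K1 * K2) ^+ 2.
  set E := expint _ _ _ => h; rewrite ler_pdivlMr// -[leLHS]ger0_norm; last by rewrite mulr_ge0 ?(ltW D0).
  rewrite -ler_sqr ?nnegrE ?mulr_ge0 ?normr_ge0 ?(ltW D0)// normrM normr_id (ger0_norm (ltW D0)).
  rewrite exprMn real_normK ?num_real//; apply: le_trans h.
  by rewrite ler_wpM2r ?sqr_ge0// /NC lerDl sqr_ge0.
rewrite mj_expint !NCM.
have -> : NC (cos (- y * ln x) +i* sin (- y * ln x)) = 1 by rewrite /NC /= cos2Dsin2.
have e3 : NC (CBeta s 1 y) * (s ^+ 2 + y ^+ 2) = 1.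
  have -> : s ^+ 2 + y ^+ 2 = NC (s +i* y) by [].
  by rewrite mulrC -NCM CBeta1// /NC /= expr0n/= addr0 expr1n.
have e2 : NC (CGamma ((s + b2) +i* y)) * ((s + b2) ^+ 2 + y ^+ 2) <= 2 * K1 ^+ 2.
  have -> : (s + b2) ^+ 2 + y ^+ 2 = NC ((s + b2) +i* y) by [].
  rewrite mulrC -NCM -CGammaS// CGammaE//; apply: NE.
  - exact: integrable_gdens.
  - exact: measurable_Mln.
  - by move=> t; exact: gdens_ge0.
have e1 : NC (CBeta (s + b1) q y) <= 2 * K2 ^+ 2.
  apply: NE; [exact: integrable_bdens|exact: measurable_Mln|by move=> t; exact: bdens_ge0].
have N0 z : 0 <= NC z by rewrite /NC addr_ge0 ?sqr_ge0.
have h1 : 1 + y ^+ 2 <= s ^+ 2 + y ^+ 2 by rewrite lerD2r exprn_ege1.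
have h2 : 1 + y ^+ 2 <= (s + b2) ^+ 2 + y ^+ 2 by rewrite lerD2r exprn_ege1.
exact: (decay_product (N0 _) (N0 _) (N0 _) (ltW D0) h1 h2 e2 e1 e3).
Qed.

(** The factor [i] of [dt = i dy] cancels that of [1 / (2 pi i)], and the sign of the frequency
    disappears because the cosine transform is even. *)
Lemma meijerG_Re_cosint : complex.Re (meijerG 1 (b1 + q) b1 b2 0 x) =
  (2 * pi)^-1 * (Gamma q)^-1 * x `^ c * \int[mu]_y cosint m3 mj_weight mj_phase y.
Proof.
have Gq0 := Gamma_gt0 q0.
have ReE y : complex.Re (meijerG_integrand 1 (b1 + q) b1 b2 0 x (c +i* y)) =
    (Gamma q)^-1 * x `^ c * cosint m3 mj_weight mj_phase y.
  have := mj_integrandE y; case: (meijerG_integrand _ _ _ _ _ _ _) => u v.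
  rewrite [X in X = _]mulrC complex_mulrC; case E : (expint _ _ _) => [u' v'].
  rewrite [X in _ = X]mulrC complex_mulrC => -[e _].
  have -> : cosint m3 mj_weight mj_phase y = u'.
    by rewrite -cosintN -[RHS]/(complex.Re (u' +i* v')) -E.
  by rewrite /= -mulrA [_ * u']mulrC -e mulrC mulfK// gt_eqF.
have pi2 : (2 * pi : R) != 0 by rewrite mulf_neq0// gt_eqF// pi_gt0.
rewrite /meijerG -/c /Cintegral.
have -> : ((2 * pi)%:C * (0 +i* 1))^-1 = 0 +i* (- (2 * pi)^-1) :> R[i].
  apply: (@mulfI _ ((2 * pi)%:C * (0 +i* 1))).
    by rewrite mulrC complex_mulrC eq_complex /= negb_and mul1r pi2 orbT.
  rewrite divff; last by rewrite mulrC complex_mulrC eq_complex /= negb_and mul1r pi2 orbT.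
  rewrite [(2 * pi)%:C * _]mulrC complex_mulrC complex_mulE mul0r mul1r mulr0 add0r mulrN divff// opprK.
  by rewrite mul0r mulr0 addr0.
rewrite complex_mulE /= mul0r sub0r mulNr opprK -!mulrA; congr (_ * _).
rewrite !mulrA -RintegralZl//; last first.
  have [K K0 HK] := mj_cosint_bound.
  apply: (@lebesgue_dominated_integrable R _ _ (fun y => K * (1 + y ^+ 2)^-1)) => //.
  - exact: measurable_cosint integrable_mj_weight measurable_mj_phase.
  - by apply: lebesgue_integrableZ => //; exact: integrable_invDsqr.
apply: eq_Rintegral => y _; rewrite -ReE.
by case: (meijerG_integrand _ _ _ _ _ _ _) => u v; rewrite complex_mulE /= mulr0 addr0 mulr1.
Qed.

End meijer_integrand.

(** * Truncated beta integrals *)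

Section tail_beta.
Context {R : realType}.
Local Notation mu := (@lebesgue_measure R).
Implicit Types (p q r u : R).

(** For [0 < q] the truncation keeps the integral finite at every real [p]; it is used with
    [p = 3 - 4 alpha], negative when [alpha > 3/4]. *)
Definition tail_beta p q r := \int[mu]_(u in `]r, 1[) (u `^ (p - 1) * (1 - u) `^ (q - 1)).

Lemma measurable_beta_weight p q (D : set R) :
  measurable_fun D (fun u => u `^ (p - 1) * (1 - u) `^ (q - 1)).
Proof.
apply: measurable_funM; first exact: measurable_fun_powR.
apply: measurable_funTS; apply: (measurableT_comp (@measurable_powR R _)).
exact: measurable_funB.
Qed.

Lemma powR_le1D p r u : 0 < r -> r <= u <= 1 -> u `^ p <= 1 + r `^ p.
Proof.
move=> r0 /andP[ru u1]; have u0 : 0 < u by apply: lt_le_trans ru.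
have [p0|p0] := leP 0 p.
  apply: (@le_trans _ _ 1); last by rewrite lerDl powR_ge0.
  by rewrite -[leRHS](powRr0 u); apply: ger_powR => //; rewrite u0.
apply: (@le_trans _ _ (r `^ p)); last by rewrite lerDr.
by rewrite /powR !gt_eqF// ler_expR ler_nM2l// ler_ln ?posrE.
Qed.

Lemma powR_div s r u : 0 < r -> 0 < u -> (r / u) `^ s = r `^ s / u `^ s.
Proof.
move=> r0 u0; rewrite powRM ?invr_ge0 ?(ltW r0) ?(ltW u0)//; congr (_ * _).
by rewrite -(powR_inv1 (ltW u0)) -powRrM mulN1r powRN.
Qed.

Lemma integrable_tail_beta p q r : 0 < q -> 0 < r ->
  mu.-integrable `[r, 1[ (EFin \o (fun u => u `^ (p - 1) * (1 - u) `^ (q - 1))).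
Proof.
move=> q0 r0.
have i1 := lebesgue_integrableZ (1 + r `^ (p - 1)) measurableT (integrable_bdens (@ltr01 R) q0).
have i2 := lebesgue_integrableS measurableT (measurable_itv `[r, 1[) (@subsetT _ _) i1.
apply: (@lebesgue_dominated_integrable R _ _ _ (measurable_itv _) _ i2).
  exact: measurable_beta_weight.
move=> u; rewrite /= in_itv/= => /andP[ru u1]; have u0 : 0 < u by apply: lt_le_trans ru.
rewrite bdensE u0 u1 /= subrr powRr0 mul1r ger0_norm ?mulr_ge0 ?powR_ge0//.
by rewrite ler_wpM2r ?powR_ge0// powR_le1D// ru ltW.
Qed.

Lemma integrable_tail_beta_oo p q r : 0 < q -> 0 < r ->
  mu.-integrable `]r, 1[ (EFin \o (fun u => u `^ (p - 1) * (1 - u) `^ (q - 1))).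
Proof.
move=> q0 r0; apply: (lebesgue_integrableS _ _ _ (integrable_tail_beta p q0 r0)) => //.
by move=> u; rewrite /= !in_itv/= => /andP[/ltW -> ->].
Qed.

Lemma tail_beta_ge0 p q r : 0 <= tail_beta p q r.
Proof. by apply: Rintegral_ge0 => u _; rewrite mulr_ge0 ?powR_ge0. Qed.

Lemma tail_beta_eq0 p q r : 1 <= r -> tail_beta p q r = 0.
Proof. by move=> r1; rewrite /tail_beta set_itv_ge ?Rintegral_set0// bnd_simp -leNgt. Qed.

(** The half weight at [u = r] is the mean of the strict and the large indicator, so that integrals
    against [step_exp] become means of integrals over []r, 1[] and [[r, 1[], which agree. *)
Lemma step_expE s r u : 0 < r -> 0 < u ->
  step_exp s (ln u - ln r) = pi / 2 * (r / u) `^ s * ((r < u)%R%:R + (r <= u)%R%:R).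
Proof.
move=> r0 u0; rewrite /step_exp subr_gt0 ltr_ln ?posrE// subr_eq0.
have pE : (r / u) `^ s = expR (- (s * (ln u - ln r))).
  rewrite /powR gt_eqF ?divr_gt0// ln_div ?posrE//; congr expR; ring.
case: (ltgtP r u) => ru /=.
- by rewrite pE; field.
- case: eqP => [e|_]; last by rewrite addr0 mulr0.
  by move: ru; rewrite -(ltr_ln (x := u)) ?posrE// e ltxx.
- by rewrite ru eqxx divff ?gt_eqF// powR1 add0r !mulr1.
Qed.

Lemma Rintegral_bdens_step s p q r : 0 < q -> 0 < r ->
  \int[mu]_u (bdens (s + p) q u * step_exp s (ln u - ln r)) = pi * r `^ s * tail_beta p q r.
Proof.
move=> q0 r0; pose t u := u `^ (p - 1) * (1 - u) `^ (q - 1).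
have i1 := integrable_setT_restrict (measurable_itv _) (integrable_tail_beta p q0 r0).
have i2 := integrable_setT_restrict (measurable_itv _) (integrable_tail_beta_oo p q0 r0).
have E u : bdens (s + p) q u * step_exp s (ln u - ln r) =
    pi / 2 * r `^ s * ((t \_ `]r, 1[) u + (t \_ `[r, 1[) u).
  rewrite !restrict0E !mem_setE !in_itv/= bdensE.
  have [u0|u0] := ltP 0 u; last first.
    have -> : (r < u) = false by lra.
    have -> : (r <= u) = false by lra.
    by rewrite mul0r addr0 mulr0.
  have [u1|u1] := ltP u 1; last by rewrite !andbF mul0r addr0 mulr0.
  rewrite !andbT /= step_expE// /t.
  have -> : u `^ (s + p - 1) = u `^ s * u `^ (p - 1).
    by rewrite -powRD ?(gt_eqF u0) ?implybT// addrA.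
  rewrite powR_div//.
  have us0 : u `^ s != 0 by rewrite gt_eqF// powR_gt0.
  by case: (ltgtP r u) => ru /=; field; rewrite us0.
under eq_Rintegral => u _ do rewrite E.
rewrite RintegralZl//; last exact: lebesgue_integrableD.
rewrite RintegralD// -!Rintegral_mkcond -Rintegral_itv_obnd_cbnd; last exact: integrable_tail_beta_oo.
by rewrite /tail_beta -/t; field.
Qed.

Lemma measurable_step_exp (s : R) : measurable_fun setT (step_exp s).
Proof.
apply: measurable_fun_if => //; first exact: measurable_fun_ltr.
  apply: measurable_funTS; apply: measurable_funM => //.
  by apply: measurable_expRMN.
apply: measurable_funTS; apply: measurable_fun_if => //.
exact: measurable_fun_eqr.
Qed.

End tail_beta.

(** * Elimination of the third variable *)

Section meijer_value.
Context {R : realType}.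
Local Notation mu := (@lebesgue_measure R).
Local Notation m2 := (sigma_prod mu mu).
Local Notation m3 := (sigma_prod m2 mu).
Variables (b1 b2 q x : R).
Hypotheses (q0 : 0 < q) (x0 : 0 < x).

Let s := - (Num.min b1 (Num.min b2 0) - 1).

Let s1 : 1 <= s. Proof. by rewrite /s; case: (leP b1); case: (leP b2); lra. Qed.
Let sb1 : 1 <= s + b1. Proof. by rewrite /s; case: (leP b1); case: (leP b2); lra. Qed.
Let sb2 : 1 <= s + b2. Proof. by rewrite /s; case: (leP b1); case: (leP b2); lra. Qed.

Let s0 : 0 < s. Proof. exact: lt_le_trans ltr01 s1. Qed.
Let sb10 : 0 < s + b1. Proof. exact: lt_le_trans ltr01 sb1. Qed.
Let sb20 : 0 < s + b2. Proof. exact: lt_le_trans ltr01 sb2. Qed.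

Let W2 (z : measurableTypeR R * measurableTypeR R) : R := gdens 1 (s + b2) z.1 * bdens (s + b1) q z.2.
Let A2 (z : measurableTypeR R * measurableTypeR R) : R := ln z.1 + ln z.2 - ln x.

Let iW2 : m2.-integrable setT (EFin \o W2).
Proof.
exact: (@integrable_tensor _ _ (measurableTypeR R) (measurableTypeR R) R mu mu _ _
  (integrable_gdens ltr01 sb20) (integrable_bdens sb10 q0)).
Qed.

Let mA2 : measurable_fun setT A2.
Proof.
have ml : measurable_fun setT (@ln R) by exact: measurable_ln.
by apply: measurable_funB => //; apply: measurable_funD; apply: (measurableT_comp ml).
Qed.

Let mW2 : measurable_fun setT W2.
Proof. by apply/measurable_EFinP; exact: measurable_int iW2. Qed.

Let C := cosint m3 (mj_weight b1 b2 q) (mj_phase x).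

Let avgE e : 0 < e -> \int[mu]_(y in `]0, +oo[) (expR (- (e * y)) * C y) =
  \int[m2]_z (W2 z * poisson01 s e (A2 z)) /\ measurable_fun setT (fun z => W2 z * poisson01 s e (A2 z)).
Proof.
move=> e0; rewrite /C Rintegral_expR_cosint//; last 2 first.
- exact: integrable_mj_weight.
- exact: measurable_mj_phase.
pose h z := e / (e ^+ 2 + mj_phase x z ^+ 2).
have D0 (w : R) : 0 < e ^+ 2 + w ^+ 2 by rewrite ltr_pwDl ?sqr_ge0// exprn_gt0.
have hi : m3.-integrable setT (EFin \o (fun z => mj_weight b1 b2 q z * h z)).
  apply: (@integrable_weight_bounded _ _ R m3 _ _ e^-1).
  - exact: integrable_mj_weight.
  - apply: measurable_funM => //.
    apply: (measurableT_comp (f := fun w : R => (e ^+ 2 + w ^+ 2)^-1)); last exact: measurable_mj_phase.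
    apply: continuous_measurable_fun => w; apply: cvgV; first by rewrite gt_eqF.
    by apply: cvgD; [exact: cvg_cst|exact: exprn_continuous].
  - move=> z; rewrite /h ger0_norm ?(divr_ge0 (ltW e0) (ltW (D0 _)))// ler_pdivrMr// mulrDr expr2 mulrA mulVf ?gt_eqF// mul1r.
    by rewrite lerDl mulr_ge0 ?sqr_ge0// invr_ge0 ltW.
have E z : \int[mu]_w (mj_weight b1 b2 q (z, w) * h (z, w)) = W2 z * poisson01 s e (A2 z).
  rewrite /poisson01 -RintegralZl//; last exact: (poisson01E _ _ _).1.
  rewrite [RHS]Rintegral_mkcond; apply: eq_Rintegral => w _.
  rewrite restrict0E mem_setE in_itv/= /mj_weight /h /mj_phase /= -/s (bdensE s 1 w).
  case: ifP => _; last by rewrite mulr0 mul0r.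
  rewrite subrr powRr0 mulr1 /W2 /A2 -!mulrA; congr (_ * (_ * (_ * (_ / (_ + _ ^+ 2))))); ring.
have := measurable_Rintegral1 hi; rewrite (Rintegral_iterated1 hi).
under eq_Rintegral => z _ do rewrite E.
by under eq_fun => z do rewrite E.
Qed.

(** The damped half-line integral is followed along [e = 1 / (n + 1)] in two ways: on the frequency
    side the bound of order [1 / (1 + y^2)] dominates, on the density side [pi] times the density
    does. The factor 2 comes from evenness. *)
Lemma Rintegral_cosint_mj : \int[mu]_y C y =
  2 * \int[m2]_z (W2 z * step_exp s (A2 z)).
Proof.
have [K K0 HK] := mj_cosint_bound b1 b2 x q0.
have mC : measurable_fun setT C.
  exact: measurable_cosint (integrable_mj_weight _ _ _) (measurable_mj_phase _).
have iK : mu.-integrable setT (EFin \o (fun y => K * (1 + y ^+ 2)^-1)).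
  by apply: lebesgue_integrableZ => //; exact: integrable_invDsqr.
have iC : mu.-integrable setT (EFin \o C) 
  by apply: (lebesgue_dominated_integrable measurableT mC iK) => y _; exact: HK.
rewrite Rintegral_even//; last by move=> y; exact: cosintN.
congr (2 * _).
have l1 : \int[mu]_(y in `]0, +oo[) (expR (- (n.+1%:R^-1 * y)) * C y) @[n --> \oo] -->
    \int[mu]_(y in `]0, +oo[) C y.
  apply: (@cvg_lebesgue_dominated R _ _ _ (fun y => K * (1 + y ^+ 2)^-1)) => //.
  - exact: lebesgue_integrableS iK.
  - exact: measurable_funTS.
  - apply: nearW => n; apply: measurable_funM; first exact: measurable_expRMN.
    exact: measurable_funTS.
  - apply: nearW => n y; rewrite /= in_itv/= andbT => y0; rewrite normrM.
    apply: (le_trans _ (HK y)); rewrite ler_piMl// ger0_norm ?expR_ge0//.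
    by rewrite -expR0 ler_expR oppr_le0 mulr_ge0// ltW.
  - apply: aeW => y _; rewrite -[X in _ --> X]mul1r; apply: cvgMl.
    have h : - (n.+1%:R^-1 * y) @[n --> \oo] --> (0 : R).
      by rewrite -oppr0 -(mul0r y); apply: cvgN; apply: cvgMl; exact: cvg_harmonic.
    by have := cvg_comp _ _ h (@continuous_expR R 0); rewrite expR0; apply.
have l2 : \int[m2]_z (W2 z * poisson01 s n.+1%:R^-1 (A2 z)) @[n --> \oo] -->
    \int[m2]_z (W2 z * step_exp s (A2 z)).
  apply: (@cvg_Rintegral_dominated _ _ R m2 _ _ _ (fun z => pi * W2 z)) => //.
  - exact: (@integrableZl_EFin _ _ _ m2).
  - apply: measurable_funM => //; exact: (measurableT_comp (measurable_step_exp s)).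
  - by apply: nearW => n; apply: (avgE _).2; rewrite invr_gt0.
  - apply: nearW => n z _; rewrite normrM (ger0_norm (_ : 0 <= W2 z)); last first.
      by rewrite mulr_ge0 ?gdens_ge0 ?bdens_ge0.
    rewrite mulrC ler_wpM2r ?mulr_ge0 ?gdens_ge0 ?bdens_ge0//.
    have n0 : 0 < n.+1%:R^-1 :> R by rewrite invr_gt0.
    have /andP[h1 h2] := @poisson01_bounded R s n.+1%:R^-1 (A2 z) s0 n0.
    by rewrite ger0_norm.
  - by apply: aeW => z _; apply: cvgMr; exact: cvg_poisson01.
apply: (cvg_unique _ l1) => //.
have e n : \int[m2]_z (W2 z * poisson01 s n.+1%:R^-1 (A2 z)) =
    \int[mu]_(y in `]0, +oo[) (expR (- (n.+1%:R^-1 * y)) * C y).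
  by rewrite (avgE _).1 ?invr_gt0.
by move: l2; rewrite (eq_cvg _ _ e).
Qed.

Let step_exp_le (A : R) : `|step_exp s A| <= pi.
Proof.
rewrite /step_exp; case: ltgtP => h; rewrite ?eqxx ?normr0 ?pi_ge0//.
  rewrite normrM ger0_norm ?pi_ge0// ger0_norm ?expR_ge0// ler_piMr ?pi_ge0//.
  by rewrite -expR0 ler_expR oppr_le0 mulr_ge0// ltW.
by rewrite ger0_norm ?divr_ge0 ?pi_ge0// ler_pdivrMr// ler_peMr ?pi_ge0//; lra.
Qed.

(** The powers of exponent [s], which record the position of the contour, cancel:
    [t^s u^s (x / (t u))^s x^(- s) = 1]. The domain []x, +oo[] appears because the truncated beta
    integral vanishes for [x / t >= 1]. *)
Lemma meijerG_ReE : complex.Re (meijerG 1 (b1 + q) b1 b2 0 x) =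
  (Gamma q)^-1 * \int[mu]_(t in `]x, +oo[) (t `^ (b2 - 1) * expR (- t) * tail_beta b1 q (x / t)).
Proof.
have iS : m2.-integrable setT (EFin \o (fun z => W2 z * step_exp s (A2 z))).
  apply: (@integrable_weight_bounded _ _ R m2 _ _ pi) => //.
  exact: (measurableT_comp (measurable_step_exp s)).
have E t : \int[mu]_u (W2 (t, u) * step_exp s (A2 (t, u))) =
   pi * x `^ s * ((fun t => t `^ (b2 - 1) * expR (- t) * tail_beta b1 q (x / t)) \_ `]x, +oo[) t.
  rewrite restrict0E mem_setE in_itv/= andbT /W2 /A2 /=.
  have [t0|t0] := ltP 0 t; last first.
    have -> : (x < t) = false by apply/negbTE; rewrite -leNgt (le_trans t0)// ltW.
    under eq_Rintegral => u _ do rewrite gdensE ltNge t0 /= !mul0r.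
    by rewrite Rintegral_cst// mul0r mulr0.
  have r0 : 0 < x / t by rewrite divr_gt0.
  have EE u : gdens 1 (s + b2) t * bdens (s + b1) q u * step_exp s (ln t + ln u - ln x) =
     gdens 1 (s + b2) t * (bdens (s + b1) q u * step_exp s (ln u - ln (x / t))).
    by rewrite mulrA ln_div ?posrE//; congr (_ * step_exp s _); ring.
  under eq_Rintegral => u _ do rewrite EE.
  rewrite RintegralZl//; last first.
    apply: (@integrable_weight_bounded _ (measurableTypeR R) R mu _ _ pi) => //.
      exact: integrable_bdens.
    apply: (measurableT_comp (measurable_step_exp s)).
    by apply: measurable_funB => //; exact: measurable_ln.
  rewrite Rintegral_bdens_step// gdensE t0 mul1r.
  case: (ltP x t) => xt; last by rewrite tail_beta_eq0 ?mulr0// ler_pdivlMr// mul1r.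
  have -> : t `^ (s + b2 - 1) = t `^ s * t `^ (b2 - 1).
    by rewrite -powRD ?(gt_eqF t0) ?implybT// addrA.
  rewrite powR_div//.
  have ts0 : t `^ s != 0 by rewrite gt_eqF// powR_gt0.
  by field.
have xs0 : x `^ s != 0 by rewrite gt_eqF// powR_gt0.
have pi0 : (pi : R) != 0 by rewrite gt_eqF// pi_gt0.
have iO : mu.-integrable setT (EFin \o ((fun t => t `^ (b2 - 1) * expR (- t) * tail_beta b1 q (x / t)) \_ `]x, +oo[)).
  apply: (eq_integrable _ _ _ _ (lebesgue_integrableZ (pi * x `^ s)^-1 measurableT (integrable_Rintegral1 iS))) => //.
  move=> t _ /=; congr EFin; rewrite E mulrA mulVf ?mul1r//.
  by rewrite mulf_neq0.
rewrite meijerG_Re_cosint// -/C Rintegral_cosint_mj (Rintegral_iterated1 iS).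
under eq_Rintegral => t _ do rewrite E.
rewrite RintegralZl// [in RHS]Rintegral_mkcond.
have -> : Num.min b1 (Num.min b2 0) - 1 = - s by rewrite /s opprK.
rewrite powRN; move: (\int[mu]_t _) => I; move: xs0; move: (x `^ s) => X xs0.
have G0 : Gamma q != 0 by rewrite gt_eqF// Gamma_gt0.
move: G0; move: (Gamma q) => G G0; move: pi0; move: (pi : R) => P P0.
by field; rewrite G0 xs0 P0.
Qed.

End meijer_value.

(** * Averages against a truncated gamma density *)

Section tail_average.
Context {R : realType}.
Local Notation mu := (@lebesgue_measure R).
Implicit Types (x p q y : R) (f g : R -> R).

Definition tail_weight x p y := y `^ (p - 1) * expR (- (x * y)).

Definition tail_int x p f := \int[mu]_(y in `]1, +oo[) (tail_weight x p y * f y^-1).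

(* The mean of [f (1 / Y)] when [Y > 1] has density proportional to
   [y ^ (p - 1) exp (- x y)]. *)
Definition tail_avg x p f := tail_int x p f / tail_int x p (fun=> 1).

(** These functions are integrable against every tail weight and stable under the operations that
    build the averaged function. *)
Definition unit_bounded f := measurable_fun (`]0, 1[ : set R) f /\
  exists M, forall r, 0 < r < 1 -> `|f r| <= M.

Lemma unit_boundedD f g : unit_bounded f -> unit_bounded g ->
  unit_bounded (fun r => f r + g r).
Proof.
move=> [mf [M fM]] [mg [N gN]]; split; first exact: measurable_funD.
by exists (M + N) => r r01; rewrite (le_trans (ler_normD _ _))// lerD ?fM ?gN.
Qed.

Lemma unit_boundedM f g : unit_bounded f -> unit_bounded g ->
  unit_bounded (fun r => f r * g r).
Proof.
move=> [mf [M fM]] [mg [N gN]]; split; first exact: measurable_funM.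
by exists (M * N) => r r01; rewrite normrM ler_pM ?fM ?gN.
Qed.

Lemma unit_bounded_cst c : unit_bounded (fun=> c).
Proof. by split; [exact: measurable_cst|exists `|c|]. Qed.

Lemma unit_boundedZ c f : unit_bounded f -> unit_bounded (fun r => c * f r).
Proof. by move=> bf; apply: unit_boundedM bf; exact: unit_bounded_cst. Qed.

Lemma unit_boundedB f g : unit_bounded f -> unit_bounded g ->
  unit_bounded (fun r => f r - g r).
Proof.
move=> bf bg; have := unit_boundedD bf (unit_boundedZ (-1) bg).
by under eq_fun do rewrite mulN1r.
Qed.

Lemma unit_bounded_powR q : 0 <= q -> unit_bounded (fun r => r `^ q).
Proof.
move=> q0; split; first exact: measurable_fun_powR.
exists 1 => r /andP[r0 r1]; rewrite ger0_norm ?powR_ge0//.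
by rewrite -(powRr0 r) ger_powR// r0 ltW.
Qed.

Lemma unit_bounded_id : unit_bounded (fun r => r).
Proof. by split=> //; exists 1 => r /andP[r0 r1]; rewrite ger0_norm ltW. Qed.

Lemma continuous_expRMN x y : {for y, continuous (fun y => expR (- (x * y)))}.
Proof.
apply: continuous_comp; last exact: continuous_expR.
by apply: continuousN; apply: continuousM => //; exact: cst_continuous.
Qed.

Lemma tail_weight_ge0 x p y : 0 <= tail_weight x p y.
Proof. by rewrite mulr_ge0 ?powR_ge0 ?expR_ge0. Qed.

Lemma measurable_tail_weight x p (D : set R) : measurable_fun D (tail_weight x p).
Proof. by apply: measurable_funM; [exact: measurable_fun_powR|exact: measurable_expRMN]. Qed.

Lemma integrable_tail_weight x p : 0 < x ->
  mu.-integrable `]1, +oo[ (EFin \o tail_weight x p).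
Proof.
move=> x0; have x20 : 0 < x / 2 by rewrite divr_gt0.
have [K K0 HK] := powR_le_expR (p - 1) x20.
apply: (@lebesgue_dominated_integrable R _ _ (fun y => K * expR (- (x / 2 * y)))) => //.
- exact: measurable_tail_weight.
- by apply: lebesgue_integrableZ => //; exact: (integrable_expRM 1 x20).1.
- move=> y; rewrite /= in_itv/= andbT => y1; rewrite ger0_norm ?tail_weight_ge0//.
  apply: (@le_trans _ _ (K * expR (x / 2 * y) * expR (- (x * y)))).
    by rewrite ler_wpM2r ?expR_ge0// HK// ltW.
  rewrite -mulrA -expRD le_eqVlt; apply/orP; left; apply/eqP; congr (_ * expR _); lra.
Qed.

Lemma inv_gt1 y : 1 < y -> 0 < y^-1 < 1.
Proof. by move=> y1; rewrite invr_gt0 invf_lt1// (lt_trans ltr01). Qed.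

Lemma measurable_comp_inv f : measurable_fun (`]0, 1[ : set R) f ->
  measurable_fun (`]1, +oo[ : set R) (fun y => f y^-1).
Proof.
move=> mf; apply: (@measurable_comp _ _ _ (measurableTypeR R) (measurableTypeR R) (measurableTypeR R) `]0, 1[ f `]1, +oo[ (fun y => y^-1)) => //.
  move=> _ [y /= + <-]; rewrite !in_itv/= andbT; exact: inv_gt1.
apply: (eq_measurable_fun (fun y => y `^ (-1))); last exact: measurable_fun_powR.
move=> y; rewrite inE/= in_itv/= andbT => y1.
by rewrite powR_inv1// (le_trans ler01)// ltW.
Qed.

Lemma integrable_tail_int x p f : 0 < x -> unit_bounded f ->
  mu.-integrable `]1, +oo[ (EFin \o (fun y => tail_weight x p y * f y^-1)).
Proof.
move=> x0 [mf [M fM]].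
apply: (@lebesgue_dominated_integrable R _ _ (fun y => M * tail_weight x p y)) => //.
- apply: measurable_funM; [exact: measurable_tail_weight|exact: measurable_comp_inv].
- by apply: lebesgue_integrableZ => //; exact: integrable_tail_weight.
- move=> y; rewrite /= in_itv/= andbT => y1; rewrite normrM ger0_norm ?tail_weight_ge0//.
  by rewrite mulrC ler_wpM2r ?tail_weight_ge0// fM// inv_gt1.
Qed.

Lemma tail_intD x p f g : 0 < x -> unit_bounded f -> unit_bounded g ->
  tail_int x p (fun r => f r + g r) = tail_int x p f + tail_int x p g.
Proof.
move=> x0 bf bg; rewrite /tail_int -RintegralD//; [|exact: integrable_tail_int..].
by apply: eq_Rintegral => y _; rewrite mulrDr.
Qed.

Lemma tail_intZ x p c f : 0 < x -> unit_bounded f ->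
  tail_int x p (fun r => c * f r) = c * tail_int x p f.
Proof.
move=> x0 bf; rewrite /tail_int -RintegralZl//; last exact: integrable_tail_int.
by apply: eq_Rintegral => y _; rewrite mulrCA.
Qed.

Lemma tail_intB x p f g : 0 < x -> unit_bounded f -> unit_bounded g ->
  tail_int x p (fun r => f r - g r) = tail_int x p f - tail_int x p g.
Proof.
move=> x0 bf bg; rewrite -mulN1r -(tail_intZ _ _ x0 bg) -tail_intD//; last exact: unit_boundedZ.
by congr tail_int; apply/funext => r; rewrite mulN1r.
Qed.

Lemma eq_tail_int x p f g : (forall r, 0 < r < 1 -> f r = g r) ->
  tail_int x p f = tail_int x p g.
Proof.
move=> fg; apply: eq_Rintegral => y; rewrite inE/= in_itv/= andbT => y1.
by rewrite fg// inv_gt1.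
Qed.

Lemma le_tail_int x p f g : 0 < x -> unit_bounded f -> unit_bounded g ->
  (forall r, 0 < r < 1 -> f r <= g r) -> tail_int x p f <= tail_int x p g.
Proof.
move=> x0 bf bg fg; apply: le_Rintegral => //; [exact: integrable_tail_int..|].
move=> y /=; rewrite in_itv/= andbT => y1.
by rewrite ler_wpM2l ?tail_weight_ge0// fg// inv_gt1.
Qed.

Lemma tail_int_powR x p q : tail_int x p (fun r => r `^ q) = tail_int x (p - q) (fun=> 1).
Proof.
apply: eq_Rintegral => y; rewrite inE/= in_itv/= andbT => y1.
have y0 : 0 < y by apply: lt_trans y1.
rewrite mulr1 /tail_weight mulrAC; congr (_ * _).
by rewrite -(powR_inv1 (ltW y0)) -powRrM mulN1r -powRD ?(gt_eqF y0) ?implybT//; congr powR; lra.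
Qed.

Lemma tail_int_exprn x p n : tail_int x p (fun r => r ^+ n) = tail_int x (p - n%:R) (fun=> 1).
Proof.
rewrite -tail_int_powR; apply: eq_tail_int => r /andP[r0 _].
by rewrite powR_mulrn// ltW.
Qed.

(** Integrating the derivative of [y^p e^(- x y)] over []1, +oo[]; under [t = x y] this is the
    recurrence of the upper incomplete gamma function, with boundary term [e^(- x)]. *)
Lemma tail_int_rec x p : 0 < x ->
  x * tail_int x (p + 1) (fun=> 1) = p * tail_int x p (fun=> 1) + expR (- x).
Proof.
move=> x0; have b1 := unit_bounded_cst 1.
pose f y := p * tail_weight x p y - x * tail_weight x (p + 1) y.
have i1 := integrable_tail_weight p x0; have i2 := integrable_tail_weight (p + 1) x0.
have if_ : mu.-integrable `]1, +oo[ (EFin \o f).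
  by apply: lebesgue_integrableB => //; apply: lebesgue_integrableZ.
have dF y : 1 < y -> is_derive y 1 (fun y => y `^ p * expR (- (x * y))) (f y).
  move=> y1; have y0 : 0 < y by apply: lt_trans y1.
  have := is_derive1_powR p y0 => H.
  apply: is_derive_eq; rewrite /GRing.scale/= /f /tail_weight.
  have -> : y `^ (p + 1 - 1) = y `^ p by rewrite addrK.
  by move: (expR _) => e; ring.
have : \int[mu]_(y in `]1, +oo[) f y = 0 - expR (- x).
  apply: (Rintegral_oy_FTC _ dF) => //.
  - have ct q (y : R) : 0 < y -> {for y, continuous (tail_weight x q)}.
      move=> y0; apply: continuousM; first exact: continuous_powR.
      by apply: continuous_expRMN.
    move=> y y1; have y0 : 0 < y by apply: lt_trans y1.
    by apply: continuousB; apply: continuousM; [exact: cst_continuous|exact: ct|exact: cst_continuous|exact: ct].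
  - have := @continuous_powR R p 1 ltr01 => h1; have := @continuous_expRMN x 1 => h2.
    have -> : expR (- x) = 1 `^ p * expR (- (x * 1)) by rewrite powR1 mul1r mulr1.
    by apply: cvg_at_right_filter; exact: (continuousM h1 h2).
  - have x20 : 0 < x / 2 by rewrite divr_gt0.
    have [K K0 HK] := powR_le_expR p x20.
    apply: (@squeeze_cvgr _ _ _ _ (fun=> 0) (fun y => K * expR (- (x / 2 * y)))).
    + near=> y; have y1 : 1 <= y by near: y; exact: nbhs_pinfty_ge.
      rewrite mulr_ge0 ?powR_ge0 ?expR_ge0//=.
      apply: (@le_trans _ _ (K * expR (x / 2 * y) * expR (- (x * y)))).
        by rewrite ler_wpM2r ?expR_ge0// HK.
      rewrite -mulrA -expRD le_eqVlt; apply/orP; left; apply/eqP; congr (_ * expR _); lra.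
    + exact: cvg_cst.
    + by rewrite -[X in _ --> X](mulr0 K); apply: cvgMr; exact: cvg_expRMN.
rewrite /f RintegralB//; [|exact: lebesgue_integrableZ..].
rewrite !RintegralZl//.
have E z : tail_int x z (fun=> 1) = \int[mu]_(y in `]1, +oo[) tail_weight x z y.
  by apply: eq_Rintegral => y _; rewrite mulr1.
by rewrite !E; move: (\int[mu]_(y in _) _) (\int[mu]_(y in _) _) => I J; lra.
Unshelve. all: by end_near. Qed.

Lemma tail_int1_ge x p : 0 < x -> 1 <= p -> expR (- x) / x <= tail_int x p (fun=> 1).
Proof.
move=> x0 p1; have := (integrable_expRM 1 x0).2; rewrite mulr1 => <-.
apply: le_Rintegral => //; first exact: (integrable_expRM 1 x0).1.
  exact: integrable_tail_int (unit_bounded_cst 1).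
move=> y /=; rewrite in_itv/= andbT => y1; rewrite !mulr1 /tail_weight.
by rewrite ler_peMl ?expR_ge0// -[leLHS](powRr0 y) ler_powR ?subr_ge0// ltW.
Qed.

Lemma tail_int1_gt0 x p : 0 < x -> 1 <= p -> 0 < tail_int x p (fun=> 1).
Proof.
by move=> x0 p1; apply: lt_le_trans (tail_int1_ge x0 p1); rewrite divr_gt0 ?expR_gt0.
Qed.

End tail_average.

(** * The special functions as tail integrals *)

Section substitutions.
Context {R : realType}.
Local Notation mu := (@lebesgue_measure R).
Implicit Types (x p q a c r : R) (f : R -> R).

Lemma measurable_expRN (D : set R) : measurable_fun D (fun t : R => expR (- t)).
Proof.
have := @measurable_expRMN R 1 D; rewrite (_ : (fun t => _) = (fun t : R => expR (- t)))//.
by apply/funext => t; rewrite mul1r.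
Qed.

Lemma Rintegral_oy_scale c f : 0 < c -> measurable_fun (`]c, +oo[ : set R) f ->
  \int[mu]_(t in `]c, +oo[) f t = c * \int[mu]_(y in `]1, +oo[) f (c * y).
Proof.
move=> c0 mf; rewrite Rintegral_mkcond (Rintegral_affine 0 c0); last first.
  exact/(@measurable_restrictT _ _ (measurableTypeR R) (measurableTypeR R) _ f (measurable_itv _)).
congr (_ * _); rewrite [RHS]Rintegral_mkcond; apply: eq_Rintegral => y _.
rewrite !restrict0E !mem_setE !in_itv/= !andbT addr0.
by rewrite -[X in X < _]mulr1 ltr_pM2l.
Qed.

Lemma Rintegral_oy_shift f : measurable_fun (`]0, +oo[ : set R) f ->
  \int[mu]_(t in `]0, +oo[) f t = \int[mu]_(y in `]1, +oo[) f (y - 1).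
Proof.
move=> mf; rewrite Rintegral_mkcond (Rintegral_affine (- 1) ltr01); last first.
  exact/(@measurable_restrictT _ _ (measurableTypeR R) (measurableTypeR R) _ f (measurable_itv _)).
rewrite mul1r [RHS]Rintegral_mkcond; apply: eq_Rintegral => y _.
rewrite !restrict0E !mem_setE !in_itv/= !andbT mul1r.
by rewrite subr_gt0.
Qed.

(** A section integral of a nonnegative function of two variables, hence measurable by Tonelli even
    when [bdens p q] is not integrable at 0. *)
Lemma measurable_tail_beta p q : measurable_fun (`]0, 1[ : set R) (tail_beta p q).
Proof.
pose F (z : measurableTypeR R * measurableTypeR R) : \bar R :=
  (if z.1 < z.2 then bdens p q z.2 else 0)%:E.
have mF : measurable_fun setT F.
  apply/measurable_EFinP; apply: measurable_fun_if => //.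
  - exact: measurable_fun_ltr.
  - by apply: measurable_funTS; apply: (measurableT_comp (measurable_bdens p q)).
have F0 z : (0 <= F z)%E by rewrite lee_fin; case: ifP => // _; exact: bdens_ge0.
have mI := @measurable_fun_fubini_tonelli_F _ _ (measurableTypeR R) (measurableTypeR R) R mu F mF F0.
apply: (eq_measurable_fun (fun r => fine (fubini_F mu F r))); last first.
  by apply: measurable_funTS; apply: (measurableT_comp (f := @fine R)).
move=> r; rewrite inE/= in_itv/= => /andP[r0 r1].
rewrite /tail_beta Rintegral_mkcond; congr fine; apply: eq_integral => u _.
rewrite /F /= restrict0E mem_setE in_itv/= bdensE.
case: ltP => ru //=; rewrite (lt_trans r0 ru)/=.
by case: ifP.
Qed.

Lemma upper_gammaE p x : 0 < x -> upper_gamma p x = x `^ p * tail_int x p (fun=> 1).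
Proof.
move=> x0; rewrite /upper_gamma (Rintegral_oy_scale x0); last first.
  apply: measurable_funM; first exact: measurable_fun_powR.
  exact: measurable_expRN.
rewrite /tail_int -!RintegralZl//; last 2 first.
- exact: integrable_tail_int (unit_bounded_cst _).
- have := lebesgue_integrableZ (x `^ (p - 1)) (measurable_itv `]1, +oo[) (integrable_tail_weight p x0).
  apply: eq_integrable => // y; rewrite inE/= in_itv/= andbT => y1; congr EFin.
  by rewrite powRM ?(ltW x0)// ?(le_trans ler01 (ltW y1))// /tail_weight mulrA.
apply: eq_Rintegral => y; rewrite inE/= in_itv/= andbT => y1.
rewrite powRM ?(ltW x0)// ?(le_trans ler01 (ltW y1))// /tail_weight (powRE1 p x0) mulr1.
by move: (_ `^ _) (_ `^ _) (expR _) => A B C; ring.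
Qed.

Lemma unit_bounded_onem a : 0 <= a -> unit_bounded (fun r : R => (1 - r) `^ a).
Proof.
move=> a0; split.
  apply: measurable_funTS; apply: (measurableT_comp (@measurable_powR R _)).
  exact: measurable_funB.
exists 1 => r /andP[r0 r1]; rewrite ger0_norm ?powR_ge0//.
by rewrite -[leRHS](powRr0 (1 - r)) ger_powR// ?ltW//; lra.
Qed.

(** With [y = 1 + t] the algebraic factors become [(y - 1)^a y^(p - 1 - a) = y^(p - 1) (1 - 1/y)^a],
    and the shift of the exponential is compensated by [e^(- x)]. *)
Lemma hyperU_tail_int a p x : 0 < x -> 0 < a ->
  Gamma (a + 1) * expR (- x) * hyperU (a + 1) (1 + p) x =
  tail_int x p (fun r => (1 - r) `^ a).
Proof.
move=> x0 a0; have G0 : Gamma (a + 1) != 0 by rewrite gt_eqF// Gamma_gt0// addr_gt0.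
have mf : measurable_fun (`]0, +oo[ : set R) (fun t => expR (- (x * t)) * t `^ (a + 1 - 1) * (1 + t) `^ (1 + p - (a + 1) - 1)).
  apply: measurable_funM; first by apply: measurable_funM; [exact: measurable_expRMN|exact: measurable_fun_powR].
  apply: measurable_funTS; apply: (measurableT_comp (@measurable_powR R _)).
  exact: measurable_funD.
rewrite /hyperU (Rintegral_oy_shift mf).
move: (Gamma (a + 1)) G0 => G G0; rewrite mulrACA mulfV// mul1r.
have E y : 1 < y -> expR (- x) * (expR (- (x * (y - 1))) * (y - 1) `^ (a + 1 - 1) * (1 + (y - 1)) `^ (1 + p - (a + 1) - 1)) = 
    tail_weight x p y * (1 - y^-1) `^ a.
  move=> y1; have y0 : 0 < y by apply: lt_trans y1.
  have -> : 1 - y^-1 = (y - 1) / y by field; rewrite gt_eqF.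
  rewrite powR_div ?subr_gt0// !addrK /tail_weight.
  have -> : 1 + (y - 1) = y by ring.
  have -> : y `^ (1 + p - (a + 1) - 1) = y `^ (p - 1) / y `^ a.
    by rewrite -powRN -powRD ?(gt_eqF y0) ?implybT//; congr powR; ring.
  have -> : expR (- (x * y)) = expR (- x) * expR (- (x * (y - 1))).
    by rewrite -expRD; congr expR; ring.
  by move: (expR _) (expR _) (_ `^ _) (_ `^ _) ((_ `^ _)^-1) => A B C D F; ring.
have bf := unit_bounded_onem (ltW a0).
rewrite -RintegralZl//; last first.
  have := lebesgue_integrableZ (expR (- x))^-1 (measurable_itv `]1, +oo[) (integrable_tail_int p x0 bf).
  apply: eq_integrable => // y; rewrite inE/= in_itv/= andbT => y1; congr EFin.
  by rewrite -E// mulKf// gt_eqF// expR_gt0.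
by apply: eq_Rintegral => y; rewrite inE/= in_itv/= andbT => y1; exact: E.
Qed.

(** For [u > r] and [b <= 1] the product [r^(1 - b) u^(b - 1)] is at most 1, which leaves the
    integrable function [(1 - u)^(q - 1)]. *)
Lemma unit_bounded_tail_beta b q : 0 < q -> b <= 1 ->
  unit_bounded (fun r => r `^ (1 - b) * tail_beta b q r).
Proof.
move=> q0 b1; split.
  by apply: measurable_funM; [exact: measurable_fun_powR|exact: measurable_tail_beta].
have i1 := integrable_bdens (@ltr01 R) q0.
exists (\int[mu]_u bdens 1 q u) => r /andP[r0 r1].
rewrite ger0_norm ?mulr_ge0 ?powR_ge0 ?tail_beta_ge0//.
rewrite /tail_beta -RintegralZl//; last exact: integrable_tail_beta_oo.
rewrite Rintegral_mkcond; apply: le_Rintegral => //.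
  apply: integrable_setT_restrict => //; apply: lebesgue_integrableZ => //.
  exact: integrable_tail_beta_oo.
move=> u _; rewrite restrict0E mem_setE in_itv/= bdensE subrr powRr0 mul1r.
have [ru|ru] := ltP r u; last by case: ifP => // _; exact: powR_ge0.
have u0 : 0 < u by apply: lt_trans ru.
rewrite u0/=; case: ifP => // u1; rewrite mulrA ler_piMl ?powR_ge0//.
have -> : b - 1 = - (1 - b) by ring.
rewrite powRN ler_pdivrMr ?powR_gt0// mul1r; apply: ge0_ler_powR; rewrite ?nnegrE ?subr_ge0//; exact: ltW.
Qed.

(** Substitution [t = x y]. The factor [r^(1 - b)] is split off from the weight so that the averaged
    function is bounded; with [b = 3 - 4 alpha] and [p = k - 6 alpha + 2] the remaining weight
    exponent is [k - 2 alpha], as in all the other terms. *)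
Lemma meijerG_tail_int p q b x : 0 < x -> 0 < q -> b <= 1 ->
  Gamma q * complex.Re (meijerG 1 (b + q) b p 0 x) =
  x `^ p * tail_int x (p + 1 - b) (fun r => r `^ (1 - b) * tail_beta b q r).
Proof.
move=> x0 q0 b1; have G0 : Gamma q != 0 by rewrite gt_eqF// Gamma_gt0.
have bf := unit_bounded_tail_beta q0 b1.
have mf : measurable_fun (`]x, +oo[ : set R) (fun t => t `^ (p - 1) * expR (- t) * tail_beta b q (x / t)).
  apply: measurable_funM; first apply: measurable_funM; first exact: measurable_fun_powR.
    exact: measurable_expRN.
  apply: (@measurable_comp _ _ _ (measurableTypeR R) (measurableTypeR R) (measurableTypeR R) `]0, 1[ (tail_beta b q) `]x, +oo[ (fun t => x / t)) => //.
  - move=> _ [t /= + <-]; rewrite !in_itv/= andbT => xt; have t0 : 0 < t by apply: lt_trans xt.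
    by rewrite divr_gt0//= ltr_pdivrMr// mul1r.
  - exact: measurable_tail_beta.
  - apply: (eq_measurable_fun (fun t => x * t `^ (- 1))).
      move=> t; rewrite inE/= in_itv/= andbT => xt.
      by rewrite powR_inv1// ltW// (lt_trans x0).
    by apply: measurable_funM => //; exact: measurable_fun_powR.
have -> := meijerG_ReE b p q0 x0.
rewrite (Rintegral_oy_scale x0 mf); move: (Gamma q) G0 => G G0; rewrite mulrA mulfV// mul1r.
have E y : 1 < y -> x * ((x * y) `^ (p - 1) * expR (- (x * y)) * tail_beta b q (x / (x * y))) =
   x `^ p * (tail_weight x (p + 1 - b) y * (y^-1 `^ (1 - b) * tail_beta b q y^-1)).
  move=> y1; have y0 : 0 < y by apply: lt_trans y1.
  have -> : x / (x * y) = y^-1 by field; rewrite !gt_eqF.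
  rewrite powRM ?(ltW x0) ?(ltW y0)// /tail_weight (powRE1 p x0).
  have -> : y `^ (p - 1) = y `^ (p + 1 - b - 1) * y^-1 `^ (1 - b).
    rewrite -(powR_inv1 (ltW y0)) -powRrM mulN1r -powRD ?(gt_eqF y0) ?implybT//; congr powR; ring.
  by move: (_ `^ _) (_ `^ _) (_ `^ _) (expR _) (tail_beta _ _ _) => A B C D F; ring.
rewrite /tail_int -!RintegralZl//.
- by apply: eq_Rintegral => y; rewrite inE/= in_itv/= andbT; exact: E.
- exact: (integrable_tail_int _ x0 bf).
- have := lebesgue_integrableZ (x^-1 * x `^ p) (measurable_itv `]1, +oo[) (integrable_tail_int (p + 1 - b) x0 bf).
  apply: eq_integrable => // y; rewrite inE/= in_itv/= andbT => y1; congr EFin.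
  by rewrite -[x^-1 * _ * _]mulrA -(E _ y1) mulKf// gt_eqF.
Qed.

End substitutions.

(** * The averaged function *)

Section symbol.
Context {R : realType}.
Implicit Types (a nu r x p : R).

Definition symbol_coef a : R := 2 `^ (- 4 * a) * (3 * a - 1) / (a - 1)
  + (a - 1 / 2) * lower_beta (1 / 2) (1 + 2 * a) (- 2 + 2 * a).

(** The function Phi. The incomplete gamma functions give the powers of [r] by their shifts, the
    function U gives [(1 - r)^(2 a)], and the Meijer function gives the last term, whose factor
    [2 a] is [Gamma (2 a + 1) / Gamma (2 a)]. *)
Definition gamma_symbol a r : R :=
  - 1 - 2 * a * (a - 1 / 2) ^+ 2 / (a - 1) * r ^+ 2 + 8 * a * (a - 1 / 2) * r
  + 4 * symbol_coef a * r `^ (4 * a - 2) + (1 - r) `^ (2 * a)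
  - 2 * a * (r `^ (4 * a - 2) * tail_beta (3 - 4 * a) (2 * a) r).

Lemma unit_bounded_tail_beta_a a : 1 / 2 < a ->
  unit_bounded (fun r => r `^ (4 * a - 2) * tail_beta (3 - 4 * a) (2 * a) r).
Proof.
move=> a12; have -> : 4 * a - 2 = 1 - (3 - 4 * a) by ring.
apply: unit_bounded_tail_beta; lra.
Qed.

Lemma unit_bounded_symbol a : 1 / 2 < a -> unit_bounded (gamma_symbol a).
Proof.
move=> a12; have bX := @unit_bounded_id R.
apply: unit_boundedB; last by apply: unit_boundedZ; exact: unit_bounded_tail_beta_a.
apply: unit_boundedD; last by apply: unit_bounded_onem; lra.
apply: unit_boundedD; last by apply: unit_boundedZ; apply: unit_bounded_powR; lra.
apply: unit_boundedD; last exact: unit_boundedZ.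
apply: unit_boundedB; first exact: unit_bounded_cst.
by apply: unit_boundedZ; exact: unit_boundedM.
Qed.

Lemma xi_gt0 a nu : 1 / 2 < a -> 0 < nu -> 0 < xi a nu.
Proof.
move=> a12 nu0; rewrite /xi divr_gt0//; first by rewrite !mulr_gt0//; lra.
by rewrite mulr_gt0 ?pi_gt0//; lra.
Qed.

Lemma tail_int_symbol a x p : 0 < x -> 1 / 2 < a ->
  tail_int x p (gamma_symbol a) = - tail_int x p (fun=> 1)
    - 2 * a * (a - 1 / 2) ^+ 2 / (a - 1) * tail_int x p (fun r => r ^+ 2)
    + 8 * a * (a - 1 / 2) * tail_int x p (fun r => r)
    + 4 * symbol_coef a * tail_int x p (fun r => r `^ (4 * a - 2))
    + tail_int x p (fun r => (1 - r) `^ (2 * a))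
    - 2 * a * tail_int x p (fun r => r `^ (4 * a - 2) * tail_beta (3 - 4 * a) (2 * a) r).
Proof.
move=> x0 a12; have b1 := unit_bounded_cst (1 : R); have bX := @unit_bounded_id R.
have bp : unit_bounded (fun r : R => r `^ (4 * a - 2)) by apply: unit_bounded_powR; lra.
have bo : unit_bounded (fun r : R => (1 - r) `^ (2 * a)) by apply: unit_bounded_onem; lra.
have bt := unit_bounded_tail_beta_a a12.
have b2 := unit_boundedM bX bX.
  have c2 := unit_boundedZ (2 * a * (a - 1 / 2) ^+ 2 / (a - 1)) b2.
  have c1 := unit_boundedZ (8 * a * (a - 1 / 2)) bX.
  have cp := unit_boundedZ (4 * symbol_coef a) bp.
  have ct := unit_boundedZ (2 * a) bt.
  have d1 := unit_boundedB (unit_bounded_cst (- 1)) c2.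
  have d2 := unit_boundedD d1 c1; have d3 := unit_boundedD d2 cp; have d4 := unit_boundedD d3 bo.
  rewrite /gamma_symbol (tail_intB p x0 d4 ct) (tail_intD p x0 d3 bo) (tail_intD p x0 d2 cp).
  rewrite (tail_intD p x0 d1 c1) (tail_intB p x0 (unit_bounded_cst (- 1)) c2).
  rewrite (tail_intZ p _ x0 b2) (tail_intZ p _ x0 bX) (tail_intZ p _ x0 bp) (tail_intZ p _ x0 bt).
  rewrite (_ : tail_int x p (fun=> - 1) = - tail_int x p (fun=> 1))//.
  by have := tail_intZ p (- 1) x0 b1; rewrite !mulN1r => <-.
Qed.

(** Every term carries the same factor [xi ^ (k - 2 a)] after substitution; it cancels against the
    one in the prefactor. *)
Lemma gamma_formulaE a nu k : 1 / 2 < a -> a != 1 -> 0 < nu ->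
  gamma_formula a nu k =
  (8 * a * (a - 1))^-1 * tail_avg (xi a nu) (k%:R - 2 * a) (gamma_symbol a).
Proof.
move=> a12 a1 nu0; have x0 := xi_gt0 a12 nu0; rewrite /gamma_formula.
move: (xi a nu) x0 => x x0; set K : R := k%:R.
have a0 : 0 < a by lra.
have q0 : 0 < 2 * a by lra.
have b1' : 3 - 4 * a <= 1 by lra.
have xp (s t : R) : x `^ s * x `^ t = x `^ (s + t).
  by rewrite -powRD// (gt_eqF x0) implybT.
pose p := K - 2 * a; set X := x `^ p.
have u0 : upper_gamma (K - 2 * a) x = X * tail_int x p (fun=> 1) by exact: upper_gammaE.
have u1 : x * upper_gamma (K - 2 * a - 1) x = X * tail_int x p (fun r => r).
  rewrite upper_gammaE// mulrA -{1}(powRr1 (ltW x0)) xp.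
  rewrite -(eq_tail_int x p (f := fun r => r ^+ 1))// tail_int_exprn.
  by congr (_ `^ _ * tail_int _ _ _); rewrite /p; ring.
have u2 : x ^+ 2 * upper_gamma (K - 2 * a - 2) x = X * tail_int x p (fun r => r ^+ 2).
  rewrite upper_gammaE// mulrA -(powR_mulrn 2 (ltW x0)) xp tail_int_exprn.
  by congr (_ `^ _ * tail_int _ _ _); rewrite /p; ring.
have u3 : x `^ (4 * a - 2) * upper_gamma (K - 6 * a + 2) x =
    X * tail_int x p (fun r => r `^ (4 * a - 2)).
  rewrite upper_gammaE// mulrA xp tail_int_powR; congr (_ `^ _ * tail_int _ _ _); rewrite /p; ring.
have u4 : x `^ p * Gamma (2 * a + 1) * expR (- x) * hyperU (2 * a + 1) (1 + K - 2 * a) x =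
    X * tail_int x p (fun r => (1 - r) `^ (2 * a)).
  rewrite -(hyperU_tail_int p x0 q0) (_ : 1 + K - 2 * a = 1 + p); last by rewrite /p; ring.
  move: (Gamma _) (hyperU _ _ _) (expR _) => G U e; by rewrite !mulrA.
have u5 : x `^ (4 * a - 2) * Gamma (2 * a + 1) *
    complex.Re (meijerG 1 (3 - 2 * a) (3 - 4 * a) (- 6 * a + K + 2) 0 x) =
    X * (2 * a * tail_int x p (fun r => r `^ (4 * a - 2) * tail_beta (3 - 4 * a) (2 * a) r)).
  rewrite (GammaS q0).
  have -> : 3 - 2 * a = 3 - 4 * a + 2 * a by ring.
  move: (meijerG_tail_int (- 6 * a + K + 2) x0 q0 b1').
  move: (complex.Re _) (Gamma (2 * a)) => Z G M.
  have -> : x `^ (4 * a - 2) * (2 * a * G) * Z = 2 * a * x `^ (4 * a - 2) * (G * Z) by ring.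
  rewrite M; have -> : 1 - (3 - 4 * a) = 4 * a - 2 by ring.
  have -> : - 6 * a + K + 2 + 1 - (3 - 4 * a) = p by rewrite /p; ring.
  have -> : X = x `^ (4 * a - 2) * x `^ (- 6 * a + K + 2).
    by rewrite xp; congr powR; rewrite /p; ring.
  by move: (_ `^ _) (_ `^ _) (tail_int _ _ _) => A B C; ring.
have T := tail_int_symbol p x0 a12.
rewrite /tail_avg -/p T -/symbol_coef.
set U0 := upper_gamma (K - 2 * a) x in u0 *.
set U1 := upper_gamma (K - 2 * a - 1) x in u1 *.
set U2 := upper_gamma (K - 2 * a - 2) x in u2 *.
set U3 := upper_gamma (K - 6 * a + 2) x in u3 *.
rewrite u4 u5 -/(symbol_coef a).
have X0 : X != 0 by rewrite gt_eqF// powR_gt0.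
have a10 : a - 1 != 0 by rewrite subr_eq0.
have a00 : a != 0 by rewrite gt_eqF.
transitivity ((8 * a * (a - 1) * U0)^-1 * (- U0 - 2 * a * (a - 1 / 2) ^+ 2 / (a - 1) * (x ^+ 2 * U2)
   + 8 * a * (a - 1 / 2) * (x * U1) + 4 * symbol_coef a * (x `^ (4 * a - 2) * U3)
   + X * tail_int x p (fun r => (1 - r) `^ (2 * a))
   - X * (2 * a * tail_int x p (fun r => r `^ (4 * a - 2) * tail_beta (3 - 4 * a) (2 * a) r)))).
  rewrite -/(symbol_coef a); congr (_ * _).
  clear T xp u0 u1 u2 u3 u4 u5.
  move: (symbol_coef a) (x `^ (4 * a - 2)) => S Y.
  set V1 := tail_int _ _ _; set V2 := tail_int _ _ _.
  move: V1 V2 U0 U1 U2 U3 X X0 => V1 V2 U0 U1 U2 U3 X X0; ring.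
rewrite u0 u1 u2 u3 !invfM.
clear T xp u0 u1 u2 u3 u4 u5.
set I0 := tail_int x p (fun=> 1); set I1 := tail_int x p (fun r => r).
set I2 := tail_int x p (fun r => r ^+ 2); set I3 := tail_int x p (fun r => r `^ _).
set I4 := tail_int x p (fun r => (1 - r) `^ _); set I5 := tail_int x p _.
move: (symbol_coef a) I0 I0^-1 I1 I2 I3 I4 I5 X X0 => S I0 J I1 I2 I3 I4 I5 X X0.
by field; rewrite X0 a00 a10.
Qed.

End symbol.

(** * Means, moments and tangent bounds *)

Section tail_avg_theory.
Context {R : realType}.
Implicit Types (x p q c b : R) (f g : R -> R).

Lemma tail_avgD x p f g : 0 < x -> unit_bounded f -> unit_bounded g ->
  tail_avg x p (fun r => f r + g r) = tail_avg x p f + tail_avg x p g.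
Proof. by move=> x0 bf bg; rewrite /tail_avg tail_intD// mulrDl. Qed.

Lemma tail_avgZ x p c f : 0 < x -> unit_bounded f ->
  tail_avg x p (fun r => c * f r) = c * tail_avg x p f.
Proof. by move=> x0 bf; rewrite /tail_avg tail_intZ// mulrA. Qed.

Lemma tail_avgB x p f g : 0 < x -> unit_bounded f -> unit_bounded g ->
  tail_avg x p (fun r => f r - g r) = tail_avg x p f - tail_avg x p g.
Proof. by move=> x0 bf bg; rewrite /tail_avg tail_intB// mulrBl. Qed.

Lemma tail_avg_cst x p c : 0 < x -> 1 <= p -> tail_avg x p (fun=> c) = c.
Proof.
move=> x0 p1; have I0 := tail_int1_gt0 x0 p1.
have := tail_avgZ p c x0 (unit_bounded_cst 1); rewrite mulr1 => ->.
by rewrite /tail_avg divff ?mulr1// gt_eqF.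
Qed.

Lemma eq_tail_avg x p f g : (forall r, 0 < r < 1 -> f r = g r) ->
  tail_avg x p f = tail_avg x p g.
Proof. by move=> fg; rewrite /tail_avg (eq_tail_int _ _ fg). Qed.

Lemma le_tail_avg x p f g : 0 < x -> 1 <= p -> unit_bounded f -> unit_bounded g ->
  (forall r, 0 < r < 1 -> f r <= g r) -> tail_avg x p f <= tail_avg x p g.
Proof.
move=> x0 p1 bf bg fg; apply: ler_wpM2r; first by rewrite invr_ge0 ltW// tail_int1_gt0.
exact: le_tail_int.
Qed.

Lemma normB_tail_avg x p c d f g h : 0 < x -> 1 <= p ->
  unit_bounded f -> unit_bounded g -> unit_bounded h ->
  (forall r, 0 < r < 1 -> `|f r - c * g r| <= d * h r) ->
  `|tail_avg x p f - c * tail_avg x p g| <= d * tail_avg x p h.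
Proof.
move=> x0 p1 bf bg bh H.
have bg' := unit_boundedZ c bg; have bh' := unit_boundedZ d bh.
have bfg := unit_boundedB bf bg'; have bN := unit_boundedZ (- 1) bh'.
rewrite -!tail_avgZ// -tail_avgB// ler_norml.
rewrite -mulN1r -tail_avgZ//; apply/andP; split; apply: le_tail_avg => // r r01;
  have := H r r01; rewrite ler_norml => /andP[]; rewrite ?mulN1r//.
Qed.

Lemma tail_avg_idV x p : 0 < x -> 2 <= p ->
  (p - 1) / x <= (tail_avg x p (fun r => r))^-1 <= (p - 1) / x + 1.
Proof.
move=> x0 p2; have p1 : 1 <= p - 1 by lra.
have I0 := tail_int1_gt0 x0 p1; have IL := tail_int1_ge x0 p1.
have := tail_int_rec (p - 1) x0; rewrite subrK.
have -> : tail_avg x p (fun r => r) = tail_int x (p - 1) (fun=> 1) / tail_int x p (fun=> 1).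
  by congr (_ / _); exact: (tail_int_exprn x p 1).
move: IL I0; rewrite invf_div ler_pdivrMr//.
move: (tail_int x (p - 1) _) (tail_int x p _) (expR _) (expR_gt0 (- x)) => I J e e0 H I0 E.
have -> : J = ((p - 1) * I + e) / x by rewrite -E mulrAC divff ?mul1r// gt_eqF.
apply/andP; split.
  rewrite ler_pdivlMr// ler_pdivlMr// mulrAC divfK ?gt_eqF//; lra.
have -> : (p - 1) / x + 1 = ((p - 1) * I + I * x) / x / I by field; rewrite !gt_eqF.
by rewrite ler_pM2r ?invr_gt0// ler_pM2r ?invr_gt0// lerD2l.
Qed.

(** Moments are quotients of tail integrals with shifted exponents, so the second one telescopes
    into two first moments. *)
Lemma tail_avg_sqr x p : 0 < x -> 2 <= p ->
  tail_avg x p (fun r => r ^+ 2) = tail_avg x p (fun r => r) * tail_avg x (p - 1) (fun r => r).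
Proof.
move=> x0 p2; have p1 : 1 <= p - 1 by lra.
have I0 := tail_int1_gt0 x0 p1.
have E1 z : tail_avg x z (fun r => r) = tail_int x (z - 1) (fun=> 1) / tail_int x z (fun=> 1).
  by congr (_ / _); exact: (tail_int_exprn x z 1).
rewrite !E1 /tail_avg tail_int_exprn.
have -> : p - 2 = p - 1 - 1 by ring.
move: (tail_int x (p - 1) _) I0 (tail_int x p _)^-1 (tail_int x (p - 1 - 1) _) => I I0 J K.
by field; rewrite gt_eqF.
Qed.

Lemma tail_avg_quadratic x p A B C : 0 < x -> 1 <= p ->
  tail_avg x p (fun r => A + B * r + C * r ^+ 2) =
  A + B * tail_avg x p (fun r => r) + C * tail_avg x p (fun r => r ^+ 2).
Proof.
move=> x0 p1; have bX := @unit_bounded_id R; have b2 := unit_boundedM bX bX.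
have b1 := unit_bounded_cst A; have bB := unit_boundedZ B bX; have bC := unit_boundedZ C b2.
rewrite (tail_avgD p x0 (unit_boundedD b1 bB) bC) (tail_avgD p x0 b1 bB).
by rewrite (tail_avgZ p B x0 bX) (tail_avgZ p C x0 b2) tail_avg_cst.
Qed.

Lemma unit_bounded_quadratic A B C : unit_bounded (fun r : R => A + B * r + C * r ^+ 2).
Proof.
have bX := @unit_bounded_id R; have b2 := unit_boundedM bX bX.
by apply: unit_boundedD (unit_boundedZ C b2); apply: unit_boundedD (unit_boundedZ B bX); exact: unit_bounded_cst.
Qed.

Lemma tail_avg_le_quadratic x p f A B C : 0 < x -> 1 <= p -> unit_bounded f ->
  (forall r, 0 < r < 1 -> f r <= A + B * r + C * r ^+ 2) ->
  tail_avg x p f <= A + B * tail_avg x p (fun r => r) + C * tail_avg x p (fun r => r ^+ 2).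
Proof.
move=> x0 p1 bf H; rewrite -tail_avg_quadratic//.
by apply: le_tail_avg => //; exact: unit_bounded_quadratic.
Qed.

Lemma tail_avg_ge_quadratic x p f A B C : 0 < x -> 1 <= p -> unit_bounded f ->
  (forall r, 0 < r < 1 -> A + B * r + C * r ^+ 2 <= f r) ->
  A + B * tail_avg x p (fun r => r) + C * tail_avg x p (fun r => r ^+ 2) <= tail_avg x p f.
Proof.
move=> x0 p1 bf H; rewrite -tail_avg_quadratic//.
by apply: le_tail_avg => //; exact: unit_bounded_quadratic.
Qed.

Lemma ln_le_subr1 (t : R) : 0 < t -> ln t <= t - 1.
Proof. by move=> t0; have := @le_ln1Dx R (t - 1); rewrite (_ : 1 + (t - 1) = t); [apply; lra|ring]. Qed.

(** The inequality [ln s <= s - 1] is taken at [t / L] and [1 / L], with weights [q] and [1 - q];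
    the weighted sum of these two points is 1, so the right-hand sides add up to 0. *)
Lemma powR_le_tangent (q t : R) : 0 <= q <= 1 -> 0 < t -> t `^ q <= 1 + q * (t - 1).
Proof.
move=> /andP[q0 q1] t0; set L := 1 + q * (t - 1).
have L0 : 0 < L.
  have -> : L = (1 - q) + q * t by rewrite /L; ring.
  have [->|qp] := eqVneq q 0; first by rewrite mul0r; lra.
  by rewrite ltr_wpDl ?subr_ge0// mulr_gt0// lt_def qp.
rewrite -ler_ln ?posrE ?powR_gt0// ln_powR.
have h1 := ln_le_subr1 (divr_gt0 t0 L0); have h2 : ln L^-1 <= L^-1 - 1.
  by apply: ln_le_subr1; rewrite invr_gt0.
rewrite ln_div ?posrE// in h1; rewrite lnV ?posrE// in h2.
have e : q * (t / L) + (1 - q) / L = 1.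
  by rewrite mulrA -mulrDl (_ : q * t + (1 - q) = L) ?divff ?gt_eqF// /L; ring.
have h1' := ler_wpM2l q0 h1; have := ler_wpM2l (_ : 0 <= 1 - q) h2.
rewrite subr_ge0 => /(_ q1).
move: h1' e; move: (t / L) (L^-1) (ln t) (ln L) => A B C D; lra.
Qed.

(** After factoring out [t], the exponent [q - 1] is nonpositive: [t^(q - 1) >= 1 + (q - 1) ln t >=
    1 + (q - 1) (t - 1)]. The result is quadratic in [t], hence controlled by two moments. *)
Lemma powR_ge_tangent (q t : R) : 0 <= q <= 1 -> 0 < t -> t + (q - 1) * (t ^+ 2 - t) <= t `^ q.
Proof.
move=> /andP[q0 q1] t0.
have -> : t `^ q = t * t `^ (q - 1) by rewrite [LHS]powRE1// mulrC.
have -> : t + (q - 1) * (t ^+ 2 - t) = t * (1 + (q - 1) * (t - 1)) by ring.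
rewrite ler_pM2l// /powR gt_eqF//; apply: le_trans (expR_ge1Dx _).
by rewrite lerD2l; apply: ler_wnM2l; [rewrite subr_le0|exact: ln_le_subr1].
Qed.

End tail_avg_theory.

(** * Limits of means as k grows *)

Section tail_limits.
Context {R : realType}.
Variables (x : R).
Hypothesis x0 : 0 < x.
Implicit Types (b c q l : R) (f g h : R -> R).

Local Notation E b k f := (tail_avg x (k%:R - b) f).

Lemma near_natr_ge c : \forall k \near \oo, c <= k%:R :> R.
Proof.
exists (Num.truncn c).+1 => // k /= ck.
by rewrite (le_trans (ltW (truncnS_gt c)))// ler_nat.
Qed.

Lemma cvg_natrV : (k%:R : R)^-1 @[k --> \oo] --> (0 : R).
Proof. by rewrite -cvg_shiftS; exact: cvg_harmonic. Qed.

Lemma cvg_tail_avg_id b : k%:R * E b k (fun r => r) @[k --> \oo] --> x.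
Proof.
have h : (k%:R * E b k (fun r => r))^-1 @[k --> \oo] --> x^-1.
  apply: (@squeeze_cvgr _ _ _ _ (fun k => x^-1 - (b + 1) / x * k%:R^-1)
    (fun k => x^-1 - (b + 1) / x * k%:R^-1 + k%:R^-1)).
  - near=> k.
    have k0 : 0 < k%:R :> R by rewrite ltr0n; near: k; exact: nbhs_infty_gt.
    have k2 : 2 <= k%:R - b by rewrite lerBrDr; near: k; exact: near_natr_ge.
    have /andP[h1 h2] := tail_avg_idV x0 k2.
    rewrite invfM; move: (tail_avg _ _ _)^-1 h1 h2 => I h1 h2.
    have -> : x^-1 - (b + 1) / x * k%:R^-1 = k%:R^-1 * ((k%:R - b - 1) / x).
      by field; rewrite !gt_eqF.
    rewrite ler_pM2l ?invr_gt0// h1/=.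
    have -> : k%:R^-1 * ((k%:R - b - 1) / x) + k%:R^-1 = k%:R^-1 * ((k%:R - b - 1) / x + 1).
      by rewrite mulrDr mulr1.
    by rewrite ler_pM2l ?invr_gt0.
  - rewrite -[X in _ --> X]subr0 -(mulr0 ((b + 1) / x)); apply: cvgB; first exact: cvg_cst.
    by apply: cvgMr; exact: cvg_natrV.
  - rewrite -[X in _ --> X]addr0 -[X in _ --> X + _]subr0 -{1}(mulr0 ((b + 1) / x)).
    apply: cvgD; last exact: cvg_natrV.
    by apply: cvgB; [exact: cvg_cst|apply: cvgMr; exact: cvg_natrV].
have xV0 : x^-1 != 0 by rewrite invr_eq0 gt_eqF.
have h2 : ((k%:R * E b k (fun r => r))^-1)^-1 @[k --> \oo] --> x^-1^-1 by exact: cvgV.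
by move: h2; rewrite invrK; under eq_cvg do rewrite invrK.
Unshelve. all: by end_near. Qed.

Lemma cvg_tail_avg_sqr b : k%:R ^+ 2 * E b k (fun r => r ^+ 2) @[k --> \oo] --> x ^+ 2.
Proof.
have h : (k%:R * E b k (fun r => r)) * (k%:R * E (b + 1) k (fun r => r)) @[k --> \oo] --> x * x.
  by apply: cvgM; exact: cvg_tail_avg_id.
rewrite expr2; apply: cvg_trans h; apply: near_eq_cvg; near=> k.
have k2 : 2 <= k%:R - b by rewrite lerBrDr; near: k; exact: near_natr_ge.
rewrite (tail_avg_sqr x0 k2) opprD addrA.
by move: (tail_avg _ _ _) (tail_avg _ _ _) => A B /=; ring.
Unshelve. all: by end_near. Qed.

(** The transfer used in every regime: [c g] is the leading part of the averaged function, [h] an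
    error negligible at scale [rho]. *)
Lemma cvg_tail_avg_dominated b c d l (rho : nat -> R) f g h :
  unit_bounded f -> unit_bounded g -> unit_bounded h ->
  (forall r, 0 < r < 1 -> `|f r - c * g r| <= d * h r) ->
  (\forall k \near \oo, 0 <= rho k) ->
  rho k * E b k g @[k --> \oo] --> l -> rho k * E b k h @[k --> \oo] --> (0 : R) ->
  rho k * E b k f @[k --> \oo] --> c * l.
Proof.
move=> bf bg bh H rho0 cg ch.
have c1 : c * (rho k * E b k g) @[k --> \oo] --> c * l by exact: cvgMr.
have c2 : d * (rho k * E b k h) @[k --> \oo] --> (0 : R).
  by rewrite -[X in _ --> X](mulr0 d); exact: cvgMr.
apply: (@squeeze_cvgr _ _ _ _
  (fun k => c * (rho k * E b k g) - d * (rho k * E b k h))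
  (fun k => c * (rho k * E b k g) + d * (rho k * E b k h))).
- near=> k.
  have k1 : 1 <= k%:R - b by rewrite lerBrDr; near: k; exact: near_natr_ge.
  have r0 : 0 <= rho k by near: k.
  have := normB_tail_avg x0 k1 bf bg bh H.
  move: (tail_avg _ _ f) (tail_avg _ _ g) (tail_avg _ _ h) => F G K.
  rewrite ler_norml => /andP[h1 h2].
  have -> : c * (rho k * G) - d * (rho k * K) = rho k * (c * G - d * K) by ring.
  have -> : c * (rho k * G) + d * (rho k * K) = rho k * (c * G + d * K) by ring.
  by rewrite !ler_wpM2l//; lra.
- by rewrite -[X in _ --> X]subr0; exact: cvgB.
- by rewrite -[X in _ --> X]addr0; exact: cvgD.
Unshelve. all: by end_near. Qed.

Lemma cvg_powRN_natr m : 0 < m -> (k%:R : R) `^ (- m) @[k --> \oo] --> (0 : R).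
Proof.
move=> m0; apply/cvgr0Pnorm_lt => e e0.
pose N := e `^ (- m^-1); have N0 : 0 < N by rewrite powR_gt0.
near=> k; have Nk : N + 1 <= k%:R by near: k; exact: near_natr_ge.
have k0 : 0 < k%:R :> R by lra.
rewrite ger0_norm ?powR_ge0// powRN.
have -> : e = (N `^ m)^-1.
  by rewrite /N -powRrM mulNr mulVf ?gt_eqF// powRN powRr1 ?invrK// ltW.
rewrite ltf_pV2 ?posrE ?powR_gt0//; apply: gt0_ltr_powR; rewrite ?nnegrE ?ltW//; lra.
Unshelve. all: by end_near. Qed.

Lemma cvg_ln_natrV : (ln (k%:R : R))^-1 @[k --> \oo] --> (0 : R).
Proof.
apply/cvgr0Pnorm_lt => e e0; near=> k.
have Nk : expR (e^-1 + 1) <= k%:R by near: k; exact: near_natr_ge.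
have k0 : 0 < k%:R :> R by apply: lt_le_trans Nk; exact: expR_gt0.
have h : e^-1 + 1 <= ln k%:R by rewrite -(expRK (e^-1 + 1)) ler_ln// posrE expR_gt0.
have eV : 0 < e^-1 by rewrite invr_gt0.
rewrite gtr0_norm ?invr_gt0; last by lra.
by rewrite invf_plt ?posrE//; lra.
Unshelve. all: by end_near. Qed.

(** The rescaled variable [t = k r / x] concentrates at 1. Both tangent bounds for [t^q] at 1 are
    polynomials of degree at most two in [r], and their means tend to 1. *)
Lemma cvg_tail_avg_powR b q : 0 < q <= 1 ->
  k%:R `^ q * E b k (fun r => r `^ q) @[k --> \oo] --> x `^ q.
Proof.
move=> /andP[q0 q1]; have q01 : 0 <= q <= 1 by rewrite ltW.
have bq := unit_bounded_powR (ltW q0); have b1 := unit_bounded_cst (1 : R).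
have bX := @unit_bounded_id R; have b2 := unit_boundedM bX bX.
have h1 := cvg_tail_avg_id b; have h2 := cvg_tail_avg_sqr b.
apply: (@squeeze_cvgr _ _ _ _
  (fun k => x `^ q * ((2 - q) / x * (k%:R * E b k (fun r => r)) +
                      (q - 1) / x ^+ 2 * (k%:R ^+ 2 * E b k (fun r => r ^+ 2))))
  (fun k => x `^ q * (1 - q + q / x * (k%:R * E b k (fun r => r))))).
- near=> k.
  have k0 : 0 < k%:R :> R by rewrite ltr0n; near: k; exact: nbhs_infty_gt.
  have k1 : 1 <= k%:R - b by rewrite lerBrDr; near: k; exact: near_natr_ge.
  have S r : 0 < r -> r `^ q = (x / k%:R) `^ q * (k%:R * r / x) `^ q /\ 0 < k%:R * r / x.
    move=> r0; have t0 : 0 < k%:R * r / x by rewrite divr_gt0// mulr_gt0.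
    split=> //; rewrite -powRM ?divr_ge0 ?(ltW x0) ?(ltW k0) ?mulr_ge0 ?(ltW r0) ?(ltW k0)//.
    by congr powR; field; rewrite !gt_eqF.
  have Y0 : 0 <= (x / k%:R) `^ q by rewrite powR_ge0.
  have YE : k%:R `^ q * (x / k%:R) `^ q = x `^ q.
    by rewrite -powRM ?divr_ge0 ?(ltW x0) ?(ltW k0)//; congr powR; field; rewrite gt_eqF.
  have kq0 : 0 <= k%:R `^ q :> R by rewrite powR_ge0.
  set Y := (x / k%:R) `^ q in S Y0 YE *.
  have up : forall r : R, 0 < r < 1 -> r `^ q <= Y * (1 - q) + (Y * (q * (k%:R / x))) * r + 0 * r ^+ 2.
    move=> r /andP[r0 _]; have [-> t0] := S r r0.
    have := ler_wpM2l Y0 (powR_le_tangent q01 t0); rewrite (_ : k%:R * r / x = k%:R / x * r); last by ring.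
    move: (k%:R / x) (_ `^ q) => A B; lra.
  have lo : forall r : R, 0 < r < 1 -> 0 + (Y * ((2 - q) * (k%:R / x))) * r +
      (Y * ((q - 1) * (k%:R / x) ^+ 2)) * r ^+ 2 <= r `^ q.
    move=> r /andP[r0 _]; have [-> t0] := S r r0.
    have := ler_wpM2l Y0 (powR_ge_tangent q01 t0); rewrite (_ : k%:R * r / x = k%:R / x * r); last by ring.
    move: (k%:R / x) (_ `^ q) => A B; apply: le_trans; rewrite le_eqVlt; apply/orP; left; apply/eqP; ring.
  have := ler_wpM2l kq0 (tail_avg_le_quadratic x0 k1 bq up).
  have := ler_wpM2l kq0 (tail_avg_ge_quadratic x0 k1 bq lo).
  rewrite -YE; move: (tail_avg _ _ _) (tail_avg _ _ _) (tail_avg _ _ _) => F G H l u.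
  apply/andP; split.
    apply: le_trans l; rewrite le_eqVlt; apply/orP; left; apply/eqP.
    by move: (k%:R `^ q) k%:R k0 {S YE kq0 up lo u} => Z K K0; field; rewrite gt_eqF.
  apply: (le_trans u); rewrite le_eqVlt; apply/orP; left; apply/eqP.
  by move: (k%:R `^ q) k%:R k0 {S YE kq0 up lo u} => Z K K0; field; rewrite gt_eqF.
- rewrite -[X in _ --> X]mulr1; apply: cvgMr.
  have e : 1 = (2 - q) / x * x + (q - 1) / x ^+ 2 * x ^+ 2 by field; rewrite gt_eqF.
  by rewrite [X in _ --> X]e; apply: cvgD; apply: cvgMr.
- rewrite -[X in _ --> X]mulr1; apply: cvgMr.
  have e : 1 = 1 - q + q / x * x by field; rewrite gt_eqF.
  by rewrite [X in _ --> X]e; apply: cvgD; [exact: cvg_cst|apply: cvgMr].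
Unshelve. all: by end_near. Qed.

Lemma unit_bounded_rlnr : unit_bounded (fun r : R => r * - ln r).
Proof.
split.
  apply: measurable_funTS; apply: measurable_funM => //; apply: measurable_funN.
  exact: measurable_ln.
exists 1 => r /andP[r0 r1]; have rV : 0 < r^-1 by rewrite invr_gt0.
rewrite -lnV ?posrE// ger0_norm; last first.
  by rewrite mulr_ge0 ?(ltW r0)// ln_ge0// invf_ge1// ltW.
apply: (@le_trans _ _ (r * (r^-1 - 1))).
  by rewrite ler_pM2l// ln_le_subr1.
by rewrite mulrBr divff ?gt_eqF// mulr1; lra.
Qed.

(** Write [- ln r = ln k - ln (k r)]. The bounds [1 - 1/(k r) <= ln (k r) <= k r - 1], multiplied by
    [r], are polynomial in [r], and their contribution disappears after division by [ln k]. *)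
Lemma cvg_tail_avg_rlnr b :
  k%:R / ln k%:R * E b k (fun r => r * - ln r) @[k --> \oo] --> x.
Proof.
have h1 := cvg_tail_avg_id b; have h2 := cvg_tail_avg_sqr b; have hl := cvg_ln_natrV.
apply: (@squeeze_cvgr _ _ _ _
  (fun k => k%:R * E b k (fun r => r) -
     (ln k%:R)^-1 * (k%:R ^+ 2 * E b k (fun r => r ^+ 2) - k%:R * E b k (fun r => r)))
  (fun k => k%:R * E b k (fun r => r) + (ln k%:R)^-1 * (1 - k%:R * E b k (fun r => r)))).
- near=> k.
  have k2 : 1 < k%:R :> R by rewrite ltr1n; near: k; exact: nbhs_infty_gt.
  have k0 : 0 < k%:R :> R by apply: lt_trans k2.
  have l0 : 0 < ln k%:R :> R by exact: ln_gt0.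
  have k1 : 1 <= k%:R - b by rewrite lerBrDr; near: k; exact: near_natr_ge.
  have S (r : R) : 0 < r -> [/\ - ln r = ln k%:R - ln (k%:R * r), ln (k%:R * r) <= k%:R * r - 1 &
      - ln (k%:R * r) <= (k%:R * r)^-1 - 1].
    move=> r0; have kr0 : 0 < k%:R * r by rewrite mulr_gt0.
    split; [by rewrite lnM ?posrE//; lra|exact: ln_le_subr1|].
    by rewrite -lnV ?posrE// ln_le_subr1// invr_gt0.
  have up : forall r : R, 0 < r < 1 -> r * - ln r <= k%:R^-1 + (ln k%:R - 1) * r + 0 * r ^+ 2.
    move=> r /andP[r0 _]; have [-> _ h] := S r r0.
    have -> : k%:R^-1 + (ln k%:R - 1) * r + 0 * r ^+ 2 = r * (ln k%:R + ((k%:R * r)^-1 - 1)).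
      by move: (ln _) => L; field; rewrite !gt_eqF.
    by rewrite ler_pM2l// lerD2l.
  have lo : forall r : R, 0 < r < 1 -> 0 + (ln k%:R + 1) * r + (-1 * k%:R) * r ^+ 2 <= r * - ln r.
    move=> r /andP[r0 _]; have [-> h _] := S r r0.
    have -> : 0 + (ln k%:R + 1) * r + (-1 * k%:R) * r ^+ 2 = r * (ln k%:R - (k%:R * r - 1)) by ring.
    by rewrite ler_pM2l// lerD2l lerN2.
  have kl0 : 0 <= k%:R / ln k%:R :> R by rewrite divr_ge0 ?ltW.
  have := ler_wpM2l kl0 (tail_avg_le_quadratic x0 k1 unit_bounded_rlnr up).
  have := ler_wpM2l kl0 (tail_avg_ge_quadratic x0 k1 unit_bounded_rlnr lo).
  move: (tail_avg _ _ _) (tail_avg _ _ _) (tail_avg _ _ _) => F G H l u.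
  apply/andP; split.
    apply: le_trans l; rewrite le_eqVlt; apply/orP; left; apply/eqP.
    by move: k%:R k0 (ln k%:R) l0 {S kl0 up lo u k1 k2} => K K0 L L0; field; rewrite ?gt_eqF.
  apply: (le_trans u); rewrite le_eqVlt; apply/orP; left; apply/eqP.
  by move: k%:R k0 (ln k%:R) l0 {S kl0 up lo u k1 k2} => K K0 L L0; field; rewrite !gt_eqF.
- rewrite -[X in _ --> X]subr0; apply: cvgB => //.
  by rewrite -(mul0r (x ^+ 2 - x)); apply: cvgM => //; exact: cvgB.
- rewrite -[X in _ --> X]addr0; apply: cvgD => //.
  by rewrite -(mul0r (1 - x)); apply: cvgM => //; apply: cvgB => //; exact: cvg_cst.
Unshelve. all: by end_near. Qed.

(** The function equals [k^(- m) r (k r)^m], and [(k r)^m <= 1 + k r]; the two resulting moments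
    stay bounded at scale [k], so [k^(- m)] is gained. *)
Lemma cvg_tail_avg_powR1D b m : 0 < m <= 1 ->
  k%:R * E b k (fun r => r `^ (1 + m)) @[k --> \oo] --> (0 : R).
Proof.
move=> /andP[m0 m1]; have h1 := cvg_tail_avg_id b; have h2 := cvg_tail_avg_sqr b.
have hm := cvg_powRN_natr m0.
have bm : unit_bounded (fun r : R => r `^ (1 + m)) by apply: unit_bounded_powR; lra.
apply: (@squeeze_cvgr _ _ _ _ (fun=> 0)
  (fun k => k%:R `^ (- m) * (k%:R * E b k (fun r => r) + k%:R ^+ 2 * E b k (fun r => r ^+ 2)))).
- near=> k.
  have k0 : 0 < k%:R :> R by rewrite ltr0n; near: k; exact: nbhs_infty_gt.
  have k1 : 1 <= k%:R - b by rewrite lerBrDr; near: k; exact: near_natr_ge.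
  apply/andP; split.
    rewrite mulr_ge0 ?(ltW k0)// -(tail_avg_cst 0 x0 k1).
    by apply: le_tail_avg => //; [exact: unit_bounded_cst|move=> r _; exact: powR_ge0].
  have up : forall r : R, 0 < r < 1 -> r `^ (1 + m) <= 0 + k%:R `^ (- m) * r + (k%:R `^ (- m) * k%:R) * r ^+ 2.
    move=> r /andP[r0 _]; have t0 : 0 < k%:R * r by rewrite mulr_gt0.
    have -> : r `^ (1 + m) = k%:R `^ (- m) * (r * (k%:R * r) `^ m).
      rewrite powRM ?(ltW k0) ?(ltW r0)// mulrCA [_ * (_ * r `^ m)]mulrA -powRD; last by rewrite (gt_eqF k0) implybT.
      rewrite addNr powRr0 mul1r -{2}(powRr1 (ltW r0)) -powRD//; by rewrite (gt_eqF r0) implybT.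
    have -> : 0 + k%:R `^ (- m) * r + k%:R `^ (- m) * k%:R * r ^+ 2 =
        k%:R `^ (- m) * (r * (1 + k%:R * r)) by ring.
    rewrite ler_wpM2l ?powR_ge0// ler_pM2l//.
    have m01 : 0 <= m <= 1 by rewrite ltW.
    apply: (le_trans (powR_le_tangent m01 t0)); nra.
  have := ler_wpM2l (ltW k0) (tail_avg_le_quadratic x0 k1 bm up).
  move/le_trans; apply; rewrite le_eqVlt; apply/orP; left; apply/eqP.
  by move: (tail_avg _ _ _) (tail_avg _ _ _) => F G; ring.
- exact: cvg_cst.
- by rewrite -(mul0r (x + x ^+ 2)); apply: cvgM => //; exact: cvgD.
Unshelve. all: by end_near. Qed.

End tail_limits.

(** * Expansion of the averaged function at the origin *)

Section powR_bounds.
Context {R : realType}.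
Implicit Types (a b p q r u t : R).

(** Bernoulli's inequality, from the concave case applied to [t^b] with exponent [1 / b]. *)
Lemma powR_ge1_tangent b t : 1 <= b -> 0 < t -> 1 + b * (t - 1) <= t `^ b.
Proof.
move=> b1 t0; have b0 : 0 < b by lra.
have bV : 0 <= b^-1 <= 1 by rewrite invr_ge0 invf_le1// b1 ltW.
have := powR_le_tangent bV (powR_gt0 b t0).
rewrite -powRrM divff ?gt_eqF// powRr1 ?(ltW t0)//; move: (t `^ b) => s h.
have := ler_wpM2l (ltW b0) h.
have -> : b * (1 + b^-1 * (s - 1)) = b + s - 1 by field; rewrite gt_eqF.
lra.
Qed.

(** The power lies between [1 - b u] and [1 - u], in one order or the other. With [b = 2 alpha - 1]
    the factor [|b - 1|] is [2 |alpha - 1|], which later compensates the prefactor. *)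
Lemma onem_powR_tangent b u : 0 <= b -> 0 < u < 1 ->
  `|(1 - u) `^ b - 1 + b * u| <= `|b - 1| * u.
Proof.
move=> b0 /andP[u0 u1]; have t0 : 0 < 1 - u by lra.
have tr : (1 - u) `^ 1 = 1 - u by rewrite powRr1// ltW.
have [b1|b1] := leP 1 b.
  have h1 := powR_ge1_tangent b1 t0.
  have h2 : (1 - u) `^ b <= 1 - u by rewrite -[leRHS]tr; apply: ger_powR => //; rewrite t0; lra.
  rewrite ger0_norm; last by lra.
  rewrite ger0_norm ?subr_ge0//; nra.
have h1 : (1 - u) `^ b <= 1 + b * (1 - u - 1) by apply: powR_le_tangent => //; rewrite b0 ltW.
have h2 : 1 - u <= (1 - u) `^ b by rewrite -[leLHS]tr; apply: ger_powR; [rewrite t0; lra|exact: ltW].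
rewrite ler0_norm; last by lra.
rewrite ltr0_norm ?subr_lt0//; nra.
Qed.

End powR_bounds.

Section symbol_remainder.
Context {R : realType}.
Implicit Types (a u : R).

(** The second-order Taylor polynomial of [(1 - u)^(2 a)] at 0 minus the function itself; it
    vanishes for [0 < u < 1] at [a = 1]. *)
Definition symbol_rem a u := 1 - 2 * a * u + a * (2 * a - 1) * u ^+ 2 - (1 - u) `^ (2 * a).

Lemma is_derive_onem_powR b u : u < 1 ->
  is_derive u 1 (fun u : R => (1 - u) `^ b) (- (b * (1 - u) `^ (b - 1))).
Proof.
move=> u1; have t0 : 0 < 1 - u by lra.
have h := is_derive1_powR b t0.
have g : is_derive u 1 (fun u : R => 1 - u) (- 1).
  by apply: is_derive_eq; rewrite add0r mul1r.
have := @is_derive1_comp _ (fun t : R => t `^ b) (fun u : R => 1 - u) u _ _ h g.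
by rewrite mulrN1.
Qed.

Lemma continuous_onem_powR p u : u < 1 -> {for u, continuous (fun u : R => (1 - u) `^ p)}.
Proof.
by move=> u1; apply/differentiable_continuous/derivable1_diffP; have [] := is_derive_onem_powR p u1.
Qed.

Lemma is_derive_symbol_rem a u : u < 1 ->
  is_derive u 1 (symbol_rem a) (2 * a * ((1 - u) `^ (2 * a - 1) - 1 + (2 * a - 1) * u)).
Proof.
move=> u1; have h := is_derive_onem_powR (2 * a) u1.
by apply: is_derive_eq; rewrite /GRing.scale/= ?expr1; move: (_ `^ _) => P; ring.
Qed.

(** Mean value theorem: the derivative is [2 a] times the quantity of [onem_powR_tangent] at
    [2 a - 1], hence at most [4 a |a - 1| u] in absolute value. *)
Lemma symbol_rem_le a u : 1 / 2 < a -> 0 < u < 1 -> `|symbol_rem a u| <= 4 * a * `|a - 1| * u ^+ 2.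
Proof.
move=> a12 /andP[u0 u1].
have dR (x : R) (x1 : x < 1) := @is_derive_symbol_rem a x x1.
pose dR' (x : R) := 2 * a * ((1 - x) `^ (2 * a - 1) - 1 + (2 * a - 1) * x).
have d1 (x : R) : x \in `]0, u[%R -> is_derive x 1 (symbol_rem a) (dR' x).
  by rewrite in_itv/= => /andP[_ xu]; apply: dR; exact: lt_trans u1.
have c1 : {within `[0, u], continuous (symbol_rem a)}.
  apply: derivable_within_continuous => x; rewrite in_itv/= => /andP[_ xu].
  by have [] := dR x (le_lt_trans xu u1).
have [c] := @MVT R (symbol_rem a) dR' 0 u u0 d1 c1.
rewrite in_itv/= => /andP[c0 cu].
rewrite /dR' {2}/symbol_rem !mulr0 expr0n/= mulr0 !subr0 addr0 powR1 subrr subr0 => ->.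
have c01 : 0 < c < 1 by rewrite c0 (lt_trans cu).
have b0 : 0 <= 2 * a - 1 by lra.
have := onem_powR_tangent b0 c01; move: (_ + _) => A hA.
rewrite !normrM (gtr0_norm u0) (@ger0_norm _ 2)// (@ger0_norm _ a); last by lra.
have e : `|2 * a - 1 - 1| = 2 * `|a - 1|.
  by rewrite (_ : 2 * a - 1 - 1 = 2 * (a - 1)) ?normrM ?(@ger0_norm _ 2)//; ring.
rewrite e in hA; have n0 := normr_ge0 (a - 1); move: (`|a - 1|) (`|A|) n0 hA => N M n0 hA.
have h : M <= 2 * N * u by apply: (le_trans hA); apply: ler_wpM2l; [exact: mulr_ge0|exact: ltW].
have a0 : 0 <= 2 * a by lra.
have := ler_wpM2r (ltW u0) (ler_wpM2l a0 h); move/le_trans; apply.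
by rewrite le_eqVlt; apply/orP; left; apply/eqP; ring.
Qed.

End symbol_remainder.

(** * Truncated beta integrals near the origin *)

Section tail_beta_bounds.
Context {R : realType}.
Local Notation mu := (@lebesgue_measure R).
Implicit Types (a b p q r u t : R).

Lemma BetaE p q : Beta p q = \int[mu]_u bdens p q u.
Proof. by rewrite /Beta Rintegral_mkcond. Qed.

Lemma BetaC p q : Beta p q = Beta q p.
Proof.
rewrite !BetaE (Rintegral_onem (measurable_bdens p q)); apply: eq_Rintegral => u _.
rewrite !bdensE (_ : (0 < 1 - u < 1) = (0 < u < 1)); last by apply/idP/idP; lra.
by rewrite (_ : 1 - (1 - u) = u) 1?mulrC//; ring.
Qed.

(** The difference is the integral over []0, r[], where [(1 - u)^(q - 1) <= 1] because [1 <= q]. *)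
Lemma tail_beta_Beta p q r : 0 < p -> 1 <= q -> 0 < r < 1 ->
  0 <= Beta p q - tail_beta p q r <= r `^ p / p.
Proof.
move=> p0 q1 /andP[r0 r1]; have q0 : 0 < q by lra.
have i1 := integrable_bdens p0 q0.
have i2 := integrable_setT_restrict (measurable_itv _) (integrable_tail_beta p q0 r0).
have [i3 v3] := integrable_powR0 r0 p0.
rewrite BetaE /tail_beta Rintegral_itv_obnd_cbnd; last exact: integrable_tail_beta_oo.
rewrite [in X in _ - X]Rintegral_mkcond -RintegralB//.
have E u : bdens p q u - ((fun u => u `^ (p - 1) * (1 - u) `^ (q - 1)) \_ `[r, 1[) u =
    if 0 < u < r then u `^ (p - 1) * (1 - u) `^ (q - 1) else 0.
  rewrite restrict0E mem_setE in_itv/= bdensE.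
  have [ru|ur] := leP r u; last by rewrite andbT (lt_trans ur r1) andbT subr0.
  by rewrite (lt_le_trans r0 ru) subrr.
apply/andP; split.
  by apply: Rintegral_ge0 => u _; rewrite E; case: ifP => // _; rewrite mulr_ge0 ?powR_ge0.
rewrite -v3 [leRHS]Rintegral_mkcond; apply: le_Rintegral => //.
- exact: lebesgue_integrableB.
- exact: integrable_setT_restrict.
move=> u _; rewrite E restrict0E mem_setE in_itv/=; case: ifP => // /andP[u0 ur].
rewrite ler_piMr ?powR_ge0// -[leRHS](powRr0 (1 - u)); apply: ger_powR; last by lra.
by apply/andP; split; lra.
Qed.

Lemma integrable_itv_cst1 (c d : R) : c < d ->
  mu.-integrable `]c, d[ (EFin \o (fun u : R => 1)) /\ \int[mu]_(u in `]c, d[) 1 = d - c.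
Proof.
move=> cd; apply: (@ge0_Rintegral_oo_FTC R c d (fun=> 1) (fun u : R => u)) => //.
- by move=> u _; exact: cst_continuous.
- by apply: cvg_at_right_filter; exact: cvg_id.
- by apply: cvg_at_left_filter; exact: cvg_id.
Qed.

(** For [q] between 1 and 2 the second factor lies between [1 - u] and 1, so the integrand differs
    from [1 / u] by at most [(1 - (1 - u)) / u = 1]. *)
Lemma tail_beta0_ln q r : 1 <= q <= 2 -> 0 < r < 1 -> 0 <= - ln r - tail_beta 0 q r <= 1.
Proof.
move=> /andP[q1 q2] /andP[r0 r1]; have q0 : 0 < q by lra.
have i1 := integrable_tail_beta_oo 0 q0 r0.
have pE (u : R) : r < u -> u `^ (0 - 1) = u^-1.
  by move=> ru; rewrite sub0r powR_inv1// ltW// (lt_trans r0).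
have [i2 v2] : mu.-integrable `]r, 1[ (EFin \o (fun u => u `^ (0 - 1))) /\
    \int[mu]_(u in `]r, 1[) (u `^ (0 - 1)) = 0 - ln r.
  have dF (u : R) : r < u < 1 -> is_derive u 1 (@ln R) (u `^ (0 - 1)).
    by move=> /andP[ru _]; rewrite pE//; apply: is_derive1_ln; exact: lt_trans ru.
  apply: (ge0_Rintegral_oo_FTC r1 _ dF).
  - by move=> u /andP[ru _]; apply: continuous_powR; exact: lt_trans ru.
  - by apply: cvg_at_right_filter; exact: continuous_ln.
  - by rewrite -(@ln1 R); apply: cvg_at_left_filter; exact: continuous_ln.
  - by move=> u _; exact: powR_ge0.
have b (u : R) : r < u < 1 -> 1 - u <= (1 - u) `^ (q - 1) <= 1.
  move=> /andP[ru u1]; have u0 : 0 < u by lra.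
  apply/andP; split; last by rewrite -[leRHS](powRr0 (1 - u)); apply: ger_powR; lra.
  rewrite -[leLHS]powRr1; last by lra.
  by apply: ger_powR; lra.
rewrite -[- ln r]sub0r -v2 /tail_beta -RintegralB//.
have [i0 v0] := integrable_itv_cst1 r1.
apply/andP; split.
  apply: Rintegral_ge0 => u /=; rewrite in_itv/= => ru1; have /andP[_ h] := b u ru1.
  by rewrite subr_ge0 ler_piMr ?powR_ge0.
apply: (@le_trans _ _ (\int[mu]_(u in `]r, 1[) 1)).
  apply: le_Rintegral => //; first exact: lebesgue_integrableB.
  move=> u /=; rewrite in_itv/= => ru1; have /andP[h _] := b u ru1; move: ru1 => /andP[ru u1].
  have u0 : 0 < u by lra.
  rewrite pE// -[X in X - _]mulr1 -mulrBr mulrC ler_pdivrMr// mul1r; lra.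
by rewrite v0; lra.
Qed.
End tail_beta_bounds.

(** * Bounds for the averaged function *)

Section symbol_bounds.
Context {R : realType}.
Local Notation mu := (@lebesgue_measure R).
Implicit Types (a m r u : R).

Definition symbol_quad a : R := 2 * a * (a - 1 / 2) ^+ 2 / (a - 1).

(** The part of [gamma_symbol] without the power [r^(4 a - 2)]; its constants cancel at the origin,
    which leaves order [r]. *)
Definition symbol_low a r := - 1 - symbol_quad a * r ^+ 2 + 8 * a * (a - 1 / 2) * r + (1 - r) `^ (2 * a).

Lemma gamma_symbolE a r : gamma_symbol a r = symbol_low a r +
  r `^ (4 * a - 2) * (4 * symbol_coef a - 2 * a * tail_beta (3 - 4 * a) (2 * a) r).
Proof. by rewrite /gamma_symbol /symbol_low -/(symbol_quad a); move: (tail_beta _ _ _) (_ `^ _) (_ `^ _) => A B C; ring. Qed.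

Lemma symbol_low_le a r : 1 / 2 < a -> 0 < r < 1 ->
  `|symbol_low a r| <= (2 * a + `|symbol_quad a| + 8 * a * (a - 1 / 2)) * r.
Proof.
move=> a12 /andP[r0 r1]; have t0 : 0 < 1 - r by lra.
have h1 : 1 + 2 * a * (1 - r - 1) <= (1 - r) `^ (2 * a) by apply: powR_ge1_tangent => //; lra.
have h2 : (1 - r) `^ (2 * a) <= 1.
  by rewrite -[leRHS](powRr0 (1 - r)); apply: ger_powR; lra.
rewrite /symbol_low (_ : _ + _ = ((1 - r) `^ (2 * a) - 1) - symbol_quad a * r ^+ 2 + 8 * a * (a - 1 / 2) * r); last first.
  by move: (_ `^ _) => A; ring.
rewrite [leRHS]mulrDl [X in _ <= X + _]mulrDl; apply: (le_trans (ler_normD _ _)); apply: lerD; last first.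
  by rewrite ger0_norm// !mulr_ge0//; lra.
apply: (le_trans (ler_normB _ _)); apply: lerD.
  by rewrite ler0_norm; lra.
rewrite normrM ler_wpM2l// ger0_norm ?sqr_ge0//; nra.
Qed.

(** Here [3 - 4 a > 0], so the truncated integral is within [r^(3 - 4 a) / (3 - 4 a)] of the
    complete one; multiplied by [r^(4 a - 2)] this error is of order [r], as is [symbol_low]. *)
Lemma symbol_bound_lt34 a r : 1 / 2 < a -> a < 3 / 4 -> 0 < r < 1 ->
  `|gamma_symbol a r - (4 * symbol_coef a - 2 * a * Beta (3 - 4 * a) (2 * a)) * r `^ (4 * a - 2)|
  <= (2 * a + `|symbol_quad a| + 8 * a * (a - 1 / 2) + 2 * a / (3 - 4 * a)) * r.
Proof.
move=> a12 a34 r01; have [r0 r1] := andP r01.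
have p0 : 0 < 3 - 4 * a by lra.
have q1 : 1 <= 2 * a by lra.
have a0 : 0 < a by lra.
have /andP[h1 h2] := tail_beta_Beta p0 q1 r01.
have hl := symbol_low_le a12 r01.
rewrite gamma_symbolE; move: (tail_beta _ _ _) (Beta _ _) h1 h2 => T B h1 h2.
have e : r `^ (4 * a - 2) * r `^ (3 - 4 * a) = r.
  rewrite -powRD; last by rewrite (gt_eqF r0) implybT.
  have -> : 4 * a - 2 + (3 - 4 * a) = 1 by ring.
  by rewrite powRr1// ltW.
have := powR_ge0 r (4 * a - 2); move: (r `^ (4 * a - 2)) (r `^ (3 - 4 * a)) h2 e => P Q h2 e P0.
rewrite (_ : _ - _ = symbol_low a r + 2 * a * (P * (B - T))); last by ring.
rewrite [leRHS]mulrDl; apply: (le_trans (ler_normD _ _)); apply: lerD => //.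
rewrite ger0_norm; last by rewrite !mulr_ge0//; lra.
rewrite -[_ / _ * r]mulrA -mulrA -mulrA !ler_pM2l//.
by apply: (le_trans (ler_wpM2l P0 h2)); rewrite mulrA e mulrC.
Qed.

(** The exponent [3 - 4 a] is 0, so the truncated integral equals [- ln r] up to a bounded error;
    the power in front is [r] itself and [- 2 a] is [- 3 / 2]. *)
Lemma symbol_bound_34 r : 0 < r < 1 ->
  `|gamma_symbol (3 / 4) r - (- (3 / 2)) * (r * - ln r)| <=
  (3 / 2 + `|symbol_quad (3 / 4)| + 3 / 2 + 4 * `|symbol_coef (3 / 4 : R)| + 3 / 2) * r.
Proof.
move=> r01; have [r0 r1] := andP r01.
have a12 : 1 / 2 < 3 / 4 :> R by lra.
have hl := symbol_low_le a12 r01.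
have q12 : (1 <= (2 * (3 / 4) : R)) && ((2 * (3 / 4) : R) <= 2).
  by apply/andP; split; lra.
have := tail_beta0_ln q12 r01.
rewrite gamma_symbolE (_ : 3 - 4 * (3 / 4) = 0); last by lra.
rewrite (_ : 4 * (3 / 4) - 2 = 1); last by lra.
rewrite powRr1 ?(ltW r0)//.
move: (tail_beta _ _ _) (ln r) (symbol_low _ _) (symbol_coef _) (symbol_quad _) hl => T L S F Q hl /andP[h1 h2].
rewrite (_ : _ - _ = S + 4 * F * r + 3 / 2 * ((- L - T) * r)); last by field.
rewrite (_ : 3 / 2 + `|Q| + 3 / 2 + 4 * `|F| + 3 / 2 = 2 * (3 / 4) + `|Q| + 8 * (3 / 4) * (3 / 4 - 1 / 2) + 4 * `|F| + 3 / 2); last by field.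
rewrite [leRHS]mulrDl [X in _ <= X + _]mulrDl; apply: (le_trans (ler_normD _ _)); apply: lerD.
  apply: (le_trans (ler_normD _ _)); apply: lerD => //.
  by rewrite !normrM (@ger0_norm _ 4)// (gtr0_norm r0).
have h3 : 0 <= (- L - T) * r by apply: mulr_ge0; lra.
rewrite ger0_norm; last by apply: mulr_ge0 => //; lra.
rewrite ler_pM2l; last by lra.
by rewrite ler_piMl// ltW.
Qed.

Lemma cvg_onem_powR b : 1 <= b -> (1 - u) `^ b @[u --> (1 : R)^'-] --> (0 : R).
Proof.
move=> b1; apply: (@squeeze_cvgr _ _ _ _ (fun=> 0) (fun u : R => 1 - u)).
- near=> u.
  have u1 : u < 1 by near: u; exact: nbhs_left_lt.
  have u0 : 0 < u by near: u; exact: nbhs_left_gt.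
  rewrite powR_ge0/= -[leRHS]powRr1; last by lra.
  by apply: ger_powR; lra.
- exact: cvg_cst.
- rewrite -(subrr (1 : R)); apply: cvgB; first exact: cvg_cst.
  by apply: cvg_at_left_filter; exact: cvg_id.
Unshelve. all: by end_near. Qed.

(** The value of [gamma_symbol] at [r = 1], where [(1 - r)^(2 a)] and the truncated integral vanish:
    the boundary term of the integration from [r] to 1. *)
Definition symbol_one a : R := 8 * a * (a - 1 / 2) - 1 - symbol_quad a + 4 * symbol_coef a.

Definition rem_int a r := \int[mu]_(u in `]r, 1[) (u `^ (1 - 4 * a) * symbol_rem a u).

Lemma measurable_symbol_rem a (D : set R) : measurable_fun D (symbol_rem a).
Proof.
apply: measurable_funB; last first.
  apply: measurable_funTS; apply: (measurableT_comp (@measurable_powR R _)).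
  exact: measurable_funB.
apply: measurable_funD; first by apply: measurable_funB => //; exact: measurable_funM.
by apply: measurable_funM => //; apply: exprn_measurable.
Qed.

Lemma integrable_rem a r : 1 / 2 < a -> 0 < r < 1 ->
  mu.-integrable `]r, 1[ (EFin \o (fun u => u `^ (1 - 4 * a) * symbol_rem a u)).
Proof.
move=> a12 /andP[r0 r1].
apply: (@lebesgue_dominated_integrable R _ _ (fun u => ((1 + r `^ (1 - 4 * a)) * (4 * a * `|a - 1|)) * 1)) => //.
- by apply: measurable_funM; [exact: measurable_fun_powR|exact: measurable_symbol_rem].
- by apply: lebesgue_integrableZ => //; exact: (integrable_itv_cst1 r1).1.
move=> u /=; rewrite in_itv/= => /andP[ru u1]; have u0 : 0 < u by lra.
have u01 : 0 < u < 1 by rewrite u0.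
rewrite mulr1 normrM; apply: ler_pM => //.
  rewrite ger0_norm ?powR_ge0//; apply: powR_le1D => //; by rewrite !ltW.
apply: (le_trans (symbol_rem_le a12 u01)); rewrite ler_piMr ?mulr_ge0//; [lra|].
by rewrite expr_le1// ltW.
Qed.

Lemma powR_itv_int c r : c != 0 -> 0 < r < 1 ->
  mu.-integrable `]r, 1[ (EFin \o (fun u => u `^ (c - 1))) /\
  \int[mu]_(u in `]r, 1[) (u `^ (c - 1)) = (1 - r `^ c) / c.
Proof.
move=> c0 /andP[r0 r1].
have dF (u : R) : r < u < 1 -> is_derive u 1 (fun u => c^-1 * u `^ c) (u `^ (c - 1)).
  move=> /andP[ru _]; have u0 : 0 < u by lra.
  have := is_derive1_powR c u0 => H.
  by apply: is_derive_eq; rewrite /GRing.scale/=; field.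
have cF (u : R) : 0 < u -> {for u, continuous (fun u => c^-1 * u `^ c)}.
  by move=> u0; apply: continuousM; [exact: cst_continuous|exact: continuous_powR].
have [] := @ge0_Rintegral_oo_FTC R r 1 (fun u => u `^ (c - 1)) (fun u => c^-1 * u `^ c)
  (c^-1 * r `^ c) (c^-1 * 1 `^ c) r1 _ dF.
- by move=> u /andP[ru _]; apply: continuous_powR; lra.
- by apply: cvg_at_right_filter; exact: cF.
- by apply: cvg_at_left_filter; exact: cF.
- by move=> u _; exact: powR_ge0.
by move=> fi ->; split=> //; rewrite powR1; move: (_ `^ _) => P; field.
Qed.

(* [u ^ (2 - 4a) * symbol_low a u] has derivative
   [(4a - 2) u ^ (1 - 4a) (symbol_rem a u - 8a(a - 1) u) - 2a u ^ (2 - 4a) (1 - u) ^ (2a - 1)],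
   and the last term integrates to the tail of the beta integral. *)
Lemma gamma_symbol_rem a r : 1 / 2 < a -> a != 1 -> a != 3 / 4 -> 0 < r < 1 ->
  gamma_symbol a r = r `^ (4 * a - 2) * (symbol_one a - (4 * a - 2) *
    (rem_int a r - 8 * a * (a - 1) * ((1 - r `^ (3 - 4 * a)) / (3 - 4 * a)))).
Proof.
move=> a12 a1 a34 r01; have [r0 r1] := andP r01.
have a10 : a - 1 != 0 by rewrite subr_eq0.
have q0 : 0 < 2 * a by lra.
have c0 : 3 - 4 * a != 0 by apply/eqP => h; move/eqP: a34; apply; lra.
pose F u := u `^ (2 - 4 * a) * symbol_low a u.
pose f u := (4 * a - 2) * (u `^ (1 - 4 * a) * symbol_rem a u)
  - (4 * a - 2) * (8 * a * (a - 1)) * u `^ (3 - 4 * a - 1)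
  - 2 * a * (u `^ (3 - 4 * a - 1) * (1 - u) `^ (2 * a - 1)).
have i1 := integrable_rem a12 r01; have [i2 v2] := powR_itv_int c0 r01.
have i3 := integrable_tail_beta_oo (3 - 4 * a) q0 r0.
have j1 := lebesgue_integrableZ (4 * a - 2) (measurable_itv _) i1.
have j2 := lebesgue_integrableZ ((4 * a - 2) * (8 * a * (a - 1))) (measurable_itv _) i2.
have j3 := lebesgue_integrableZ (2 * a) (measurable_itv _) i3.
have j12 := lebesgue_integrableB (measurable_itv _) j1 j2.
have fi := lebesgue_integrableB (measurable_itv _) j12 j3.
have dL (u : R) : u < 1 -> is_derive u 1 (symbol_low a)
    (- (2 * symbol_quad a * u) + 8 * a * (a - 1 / 2) - 2 * a * (1 - u) `^ (2 * a - 1)).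
  move=> u1; have h := is_derive_onem_powR (2 * a) u1.
  by apply: is_derive_eq; rewrite /GRing.scale/= ?expr1; move: (_ `^ _) => P; ring.
have dF (u : R) : r < u < 1 -> is_derive u 1 F (f u).
  move=> /andP[ru u1]; have u0 : 0 < u by lra.
  have h := dL u u1; have g := is_derive1_powR (2 - 4 * a) u0.
  apply: is_derive_eq; rewrite /GRing.scale/= /f /symbol_low /symbol_rem /symbol_quad.
  rewrite (_ : 3 - 4 * a - 1 = 2 - 4 * a); last by ring.
  rewrite (powRE1 (2 - 4 * a) u0) (_ : 2 - 4 * a - 1 = 1 - 4 * a); last by ring.
  by move: (_ `^ _) (_ `^ _) (_ `^ _) => P Q S; field.
have cL (u : R) : u < 1 -> {for u, continuous (symbol_low a)}.
  by move=> u1; apply/differentiable_continuous/derivable1_diffP; have [] := dL u u1.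
have v : \int[mu]_(u in `]r, 1[) f u = (8 * a * (a - 1 / 2) - 1 - symbol_quad a) - F r.
  apply: (Rintegral_oo_FTC r1 _ dF _ _ fi).
  - move=> u /andP[ru u1]; have u0 : 0 < u by lra.
    have cR : {for u, continuous (symbol_rem a)}.
      by apply/differentiable_continuous/derivable1_diffP; have [] := is_derive_symbol_rem a u1.
    have cO : {for u, continuous (fun u : R => (1 - u) `^ (2 * a - 1))}.
      exact: continuous_onem_powR.
    have cP p := @continuous_powR R p u u0.
    have cc (c : R) : {for u, continuous (fun=> c)} by exact: cst_continuous.
    exact: (continuousB (continuousB (continuousM (cc _) (continuousM (cP _) cR))
      (continuousM (cc _) (cP _))) (continuousM (cc _) (continuousM (cP _) cO))).
  - by apply: cvg_at_right_filter; exact: (continuousM (@continuous_powR R (2 - 4 * a) r r0) (cL r r1)).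
  - have a2 : 1 <= 2 * a by lra.
    have l0 := cvg_onem_powR a2.
    have lp : u `^ (2 - 4 * a) @[u --> (1 : R)^'-] --> (1 : R).
      have e1 : 1 `^ (2 - 4 * a) = 1 :> R by rewrite powR1.
      by rewrite -[X in _ --> X]e1; apply: cvg_at_left_filter; exact: continuous_powR.
    have li : u @[u --> (1 : R)^'-] --> (1 : R) by apply: cvg_at_left_filter; exact: cvg_id.
    have -> : 8 * a * (a - 1 / 2) - 1 - symbol_quad a =
      1 * (- 1 - symbol_quad a * (1 * 1) + 8 * a * (a - 1 / 2) * 1 + 0) by ring.
    apply: cvgM => //; apply: cvgD => //; apply: cvgD; last by apply: cvgMr.
    by apply: cvgB; [exact: cvg_cst|apply: cvgMr; exact: cvgM].
have e : \int[mu]_(u in `]r, 1[) f u = (4 * a - 2) * rem_int a r -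
    (4 * a - 2) * (8 * a * (a - 1)) * ((1 - r `^ (3 - 4 * a)) / (3 - 4 * a)) -
    2 * a * tail_beta (3 - 4 * a) (2 * a) r.
  rewrite /f RintegralB// RintegralB// !RintegralZl//.
  by rewrite v2.
rewrite gamma_symbolE /symbol_one.
have P0 : r `^ (4 * a - 2) * F r = symbol_low a r.
  rewrite /F mulrA -powRD; last by rewrite (gt_eqF r0) implybT.
  rewrite (_ : 4 * a - 2 + (2 - 4 * a) = 0) ?powRr0 ?mul1r//; ring.
have {}v : F r = (8 * a * (a - 1 / 2) - 1 - symbol_quad a) - \int[mu]_(u in `]r, 1[) f u.
  by rewrite v opprB addrCA subrr addr0.
rewrite -P0 v e; clear.
move: (symbol_quad a) (symbol_coef a) (rem_int a r) (tail_beta _ _ _) ((1 - _) / _) (r `^ _) => A B C D E P.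
ring.
Qed.

(** Since [m <= 4 a - 3] and [r < u], [r^(4 a - 2)] is at most [r^(1 + m) u^(4 a - 3 - m)]. The
    bound on [symbol_rem] then leaves [u^(- m)], whose integral is at most [1 / (1 - m) <= 2]; this
    doubles the constant [4 a]. *)
Lemma rem_int_le a m r : 3 / 4 < a -> 0 < m <= 1 / 2 -> m <= 4 * a - 3 -> 0 < r < 1 ->
  r `^ (4 * a - 2) * `|rem_int a r| <= 8 * a * `|a - 1| * r `^ (1 + m).
Proof.
move=> a34 /andP[m0 m1] ma r01; have [r0 r1] := andP r01.
have a12 : 1 / 2 < a by lra.
have i1 := integrable_rem a12 r01.
have m10 : 1 - m != 0 by rewrite gt_eqF; lra.
have [i2 v2] := powR_itv_int m10 r01.
have P0 := powR_ge0 r (4 * a - 2).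
apply: (@le_trans _ _ (r `^ (4 * a - 2) * \int[mu]_(u in `]r, 1[) `|u `^ (1 - 4 * a) * symbol_rem a u|)).
  by rewrite ler_wpM2l// le_normr_Rintegral.
rewrite -RintegralZl//; last exact: integrable_norm.
set C := 4 * a * `|a - 1|.
have C0 : 0 <= C by rewrite !mulr_ge0//; lra.
apply: (@le_trans _ _ (\int[mu]_(u in `]r, 1[) (C * r `^ (1 + m) * u `^ (1 - m - 1)))).
  apply: le_Rintegral => //.
  - by apply: lebesgue_integrableZ => //; exact: integrable_norm.
  - exact: lebesgue_integrableZ.
  move=> u /=; rewrite in_itv/= => /andP[ru u1]; have u0 : 0 < u by lra.
  have u01 : 0 < u < 1 by rewrite u0.
  have hR := symbol_rem_le a12 u01; rewrite -/C in hR.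
  rewrite normrM (ger0_norm (powR_ge0 _ _)).
  have h1 : r `^ (4 * a - 2) = r `^ (1 + m) * r `^ (4 * a - 3 - m).
    by rewrite -powRD; [congr powR; ring|rewrite (gt_eqF r0) implybT].
  have h2 : u `^ (1 - 4 * a) * u ^+ 2 * u `^ (4 * a - 3 - m) = u `^ (1 - m - 1).
    rewrite -(powR_mulrn 2 (ltW u0)) -!powRD; first (congr powR; ring).
      by rewrite (gt_eqF u0) implybT.
    by rewrite (gt_eqF u0) implybT.
  have h3 : r `^ (4 * a - 3 - m) <= u `^ (4 * a - 3 - m).
    by apply: ge0_ler_powR; rewrite ?nnegrE ?subr_ge0// ltW.
  have k1 := powR_ge0 r (1 + m); have k2 := powR_ge0 u (1 - 4 * a).
  have k3 := powR_ge0 r (4 * a - 3 - m).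
  rewrite -h2 h1; clear h1 h2.
  move: (r `^ (1 + m)) (r `^ (4 * a - 3 - m)) (u `^ (1 - 4 * a)) (u `^ (4 * a - 3 - m)) (`|symbol_rem a u|) (normr_ge0 (symbol_rem a u)) h3 hR k1 k2 k3
    => A B E G F F0 h3 hR A0 E0 B0.
  have -> : C * A * (E * u ^+ 2 * G) = A * G * (E * (C * u ^+ 2)) by ring.
  apply: ler_pM; [exact: mulr_ge0| |exact: ler_wpM2l|exact: ler_wpM2l].
  exact: mulr_ge0.
rewrite RintegralZl// v2 -mulrA.
have -> : 8 * a * `|a - 1| * r `^ (1 + m) = C * (r `^ (1 + m) * 2) by rewrite /C; ring.
rewrite ler_wpM2l// ler_wpM2l ?powR_ge0// ler_pdivrMr; last by lra.
have := powR_ge0 r (1 - m); lra.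
Qed.

Definition psi a r : R := gamma_symbol a r / (8 * a * (a - 1)).

Definition psi_one a : R := symbol_one a / (8 * a * (a - 1)).

(** The identity [r^(4 a - 2) r^(3 - 4 a) = r] isolates the linear term, in which [a - 1] has
    cancelled explicitly. The division by [a - 1] survives only under [psi_one] and the
    remainder. *)
Lemma psiE a r : 3 / 4 < a -> a != 1 -> 0 < r < 1 ->
  psi a r - (4 * a - 2) / (4 * a - 3) * r =
  r `^ (4 * a - 2) * (psi_one a - (4 * a - 2) / (4 * a - 3)
   - (4 * a - 2) * (rem_int a r / (8 * a * (a - 1)))).
Proof.
move=> a34 a1 r01; have [r0 r1] := andP r01.
have a12 : 1 / 2 < a by lra.
have a34' : a != 3 / 4 by rewrite gt_eqF.
have e : r `^ (4 * a - 2) * r `^ (3 - 4 * a) = r.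
  rewrite -powRD; last by rewrite (gt_eqF r0) implybT.
  have -> : 4 * a - 2 + (3 - 4 * a) = 1 by ring.
  by rewrite powRr1// ltW.
rewrite /psi gamma_symbol_rem// /psi_one.
have a10 : a - 1 != 0 by rewrite subr_eq0.
have a00 : a != 0 by rewrite gt_eqF//; lra.
have c0 : 4 * a - 3 != 0 by rewrite gt_eqF//; lra.
have c1 : 3 - 4 * a != 0 by rewrite lt_eqF//; lra.
move: (rem_int a r) (symbol_one a) (r `^ (4 * a - 2)) (r `^ (3 - 4 * a)) e => A B P Q e.
rewrite -[in LHS]e; field.
by rewrite a10 a00 c0 c1.
Qed.

(** The factor [|a - 1|] in [rem_int_le] cancels the prefactor. The constant depends on [a] only
    through [psi_one] and rational functions regular at 1, so the estimate passes to the limit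
    [a -> 1]. *)
Lemma psi_bound a m r : 3 / 4 < a -> a != 1 -> 0 < m <= 1 / 2 -> m <= 4 * a - 3 -> 0 < r < 1 ->
  `|psi a r - (4 * a - 2) / (4 * a - 3) * r| <=
  (`|psi_one a| + (4 * a - 2) / (4 * a - 3) + (4 * a - 2)) * r `^ (1 + m).
Proof.
move=> a34 a1 m01 ma r01; have [r0 r1] := andP r01.
have hr := rem_int_le a34 m01 ma r01.
rewrite psiE//.
have hP : r `^ (4 * a - 2) <= r `^ (1 + m).
  by apply: ger_powR; [rewrite r0 ltW|lra].
have P0 := powR_ge0 r (4 * a - 2).
have c0 : 0 < (4 * a - 2) / (4 * a - 3) by rewrite divr_gt0//; lra.
have s0 : 0 < 4 * a - 2 by lra.
have n0 : 0 < `|a - 1| by rewrite normr_gt0 subr_eq0.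
have a0 : 0 < 8 * a by lra.
rewrite normrM (ger0_norm P0).
have hr' : r `^ (4 * a - 2) * `|rem_int a r / (8 * a * (a - 1))| <= r `^ (1 + m).
  have d0 : 0 < 8 * a * `|a - 1| by exact: mulr_gt0.
  rewrite normf_div normrM (gtr0_norm a0) mulrA ler_pdivrMr//.
  by rewrite [leRHS]mulrC.
move: (r `^ (4 * a - 2)) (r `^ (1 + m)) (rem_int a r / _) (psi_one a) hP P0 hr' => P Q A D hP P0 hr' {hr}.
move: ((4 * a - 2) / (4 * a - 3)) c0 => c c0; move: (4 * a - 2) s0 => s s0.
apply: (@le_trans _ _ (P * (`|D| + c + s * `|A|))).
  rewrite ler_wpM2l//; apply: (le_trans (ler_normB _ _)); apply: lerD.
    by apply: (le_trans (ler_normB _ _)); rewrite lerD2l gtr0_norm.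
  by rewrite normrM gtr0_norm.
rewrite !mulrDr !mulrDl; apply: lerD; first apply: lerD.
- by rewrite mulrC ler_wpM2l.
- by rewrite mulrC ler_wpM2l// ltW.
- by rewrite mulrCA ler_wpM2l// ltW.
Qed.

End symbol_bounds.

(** * The limit of the averaged function as alpha tends to 1 *)

Section exp_expansion.
Context {R : realType}.
Implicit Types (z l : R).

Lemma mvt_origin (f df : R -> R) z : (forall x : R, is_derive x 1 f (df x)) ->
  exists2 c, `|c| <= `|z| & f z - f 0 = df c * z.
Proof.
move=> d.
have cf (A : interval R) : {within [set` A], continuous f}.
  by apply: derivable_within_continuous => x _; have [] := d x.
have [z0|z0] := leP 0 z.
  have [c] := @MVT_segment R f df 0 z z0 (fun x _ => d x) (cf _).
  rewrite in_itv/= subr0 => /andP[c0 cz] e; exists c => //.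
  by rewrite !ger0_norm.
have [c] := @MVT_segment R f df z 0 (ltW z0) (fun x _ => d x) (cf _).
rewrite in_itv/= => /andP[c0 cz] e; exists c.
  by rewrite !ler0_norm ?lerN2// ltW.
by rewrite -(opprB (f 0)) e sub0r mulrN opprK.
Qed.

Lemma expR_expand1 z : `|expR z - 1| <= `|z| * expR `|z|.
Proof.
have [c cz] := mvt_origin z (@is_derive_expR R); rewrite expR0 => ->.
rewrite normrM mulrC ler_wpM2l// ger0_norm ?expR_ge0// ler_expR.
exact: le_trans (ler_norm _) cz.
Qed.

(** Each remainder has the previous one as derivative, so the mean value theorem raises the order by
    one. *)
Lemma expR_expand2 z : `|expR z - 1 - z| <= `|z| ^+ 2 * expR `|z|.
Proof.
have d (x : R) : is_derive x 1 (fun z => expR z - z) (expR x - 1).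
  by apply: is_derive_eq.
have [c cz] := mvt_origin z d; rewrite expR0 subr0.
have -> : expR z - z - 1 = expR z - 1 - z by ring.
move=> ->; rewrite normrM mulrC expr2 -mulrA ler_wpM2l//.
apply: (le_trans (expR_expand1 c)); apply: ler_pM; rewrite ?expR_ge0//.
by rewrite ler_expR.
Qed.

Lemma expR_expand3 z : `|expR z - 1 - z - z ^+ 2 / 2| <= `|z| ^+ 3 * expR `|z|.
Proof.
have d (x : R) : is_derive x 1 (fun z => expR z - z - z ^+ 2 / 2) (expR x - 1 - x).
  by apply: is_derive_eq; rewrite /GRing.scale/= ?expr1; field.
have [c cz] := mvt_origin z d; rewrite expR0 expr0n/= mul0r !subr0.
have -> : expR z - z - z ^+ 2 / 2 - 1 = expR z - 1 - z - z ^+ 2 / 2 by ring.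
move=> ->; rewrite normrM mulrC exprS -mulrA ler_wpM2l//.
apply: (le_trans (expR_expand2 c)); apply: ler_pM; rewrite ?expR_ge0//.
  by rewrite lerXn2r ?nnegrE.
by rewrite ler_expR.
Qed.

Lemma cvg_dnbhs_id (b : R) : x @[x --> b^'] --> b.
Proof. exact: nbhs_dnbhs. Qed.

Lemma cvg_dnbhs_lin (f : R -> R) b l K :
  (\forall a \near b^', `|f a - l| <= K * `|a - b|) -> f a @[a --> b^'] --> l.
Proof.
move=> h.
have c0 : K * `|a - b| @[a --> b^'] --> (0 : R).
  rewrite -[X in _ --> X](mulr0 K) -(normr0 R) -(subrr b); apply: cvgMr.
  by apply: cvg_norm; apply: cvgB; [exact: cvg_dnbhs_id|exact: cvg_cst].
apply: (@squeeze_cvgr _ _ _ _ (fun a => l - K * `|a - b|) (fun a => l + K * `|a - b|)).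
- near=> a; have : `|f a - l| <= K * `|a - b| by near: a.
  by rewrite ler_norml => /andP[h1 h2]; apply/andP; split; lra.
- by rewrite -[X in _ --> X]subr0; apply: cvgB => //; exact: cvg_cst.
- by rewrite -[X in _ --> X]addr0; apply: cvgD => //; exact: cvg_cst.
Unshelve. all: by end_near. Qed.

Lemma near_dnbhs_dist (b e : R) : 0 < e -> \forall a \near b^', `|a - b| < e.
Proof.
move=> e0; have := @cvg_dnbhs_id b; move/cvgrPdist_lt => /(_ e e0).
by apply: filterS => a; rewrite distrC.
Qed.

Lemma cvg_expR_quot1 l : (expR ((a - 1) * l) - 1) / (a - 1) @[a --> (1 : R)^'] --> l.
Proof.
apply: (@cvg_dnbhs_lin _ _ _ (l ^+ 2 * expR `|l|)); near=> a.
have a1 : a - 1 != 0 by rewrite subr_eq0; near: a; exact: nbhs_dnbhs_neq.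
have h : `|a - 1| <= 1 by apply: ltW; near: a; exact: near_dnbhs_dist.
have := expR_expand2 ((a - 1) * l).
have -> : (expR ((a - 1) * l) - 1) / (a - 1) - l = (expR ((a - 1) * l) - 1 - (a - 1) * l) / (a - 1).
  by move: (expR _) => E; field.
rewrite normf_div ler_pdivrMr ?normr_gt0// => /le_trans; apply.
have n0 := normr_ge0 (a - 1); have l0 := normr_ge0 l.
have hE : expR `|(a - 1) * l| <= expR `|l| by rewrite ler_expR normrM ler_piMl.
apply: (@le_trans _ _ (`|(a - 1) * l| ^+ 2 * expR `|l|)); first by rewrite ler_wpM2l// exprn_ge0.
rewrite normrM -(real_normK (num_real l)) le_eqVlt; apply/orP; left; apply/eqP; ring.
Unshelve. all: by end_near. Qed.

Lemma cvg_expR_quot2 l :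
  (expR ((a - 1) * l) - 1 - (a - 1) * l) / (a - 1) ^+ 2 @[a --> (1 : R)^'] --> l ^+ 2 / 2.
Proof.
apply: (@cvg_dnbhs_lin _ _ _ (`|l| ^+ 3 * expR `|l|)); near=> a.
have a1 : a - 1 != 0 by rewrite subr_eq0; near: a; exact: nbhs_dnbhs_neq.
have h : `|a - 1| <= 1 by apply: ltW; near: a; exact: near_dnbhs_dist.
have := expR_expand3 ((a - 1) * l).
have -> : (expR ((a - 1) * l) - 1 - (a - 1) * l) / (a - 1) ^+ 2 - l ^+ 2 / 2 =
    (expR ((a - 1) * l) - 1 - (a - 1) * l - ((a - 1) * l) ^+ 2 / 2) / (a - 1) ^+ 2.
  by move: (expR _) => E; field.
rewrite normf_div ler_pdivrMr ?normr_gt0 ?expf_neq0// => /le_trans; apply.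
have n0 := normr_ge0 (a - 1); have l0 := normr_ge0 l.
have hE : expR `|(a - 1) * l| <= expR `|l| by rewrite ler_expR normrM ler_piMl.
apply: (@le_trans _ _ (`|(a - 1) * l| ^+ 3 * expR `|l|)); first by rewrite ler_wpM2l// exprn_ge0.
rewrite normrX normrM le_eqVlt; apply/orP; left; apply/eqP; ring.
Unshelve. all: by end_near. Qed.

End exp_expansion.

(** * Expansion of a half beta integral at alpha = 1 *)

Section half_beta.
Context {R : realType}.


Local Notation mu := (@lebesgue_measure R).
Implicit Types (a u : R).

(** A substitute for the lower beta integral that is regular at [a = 1], with value [1/2] there; the
    pole of [symbol_coef] is then explicit. *)
Definition half_beta a := \int[mu]_(u in `]0, (1 / 2)[) ((u * (1 - u)) `^ (2 * a - 2)).

Lemma logit_bounds u : 0 < u < 1 / 2 -> 0 < u * (1 - u) < 1.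
Proof. by move=> /andP[u0 u1]; apply/andP; split; nra. Qed.

Lemma measurable_onemM (D : set R) : measurable_fun D (fun u : R => u * (1 - u)).
Proof. by apply: measurable_funM => //; exact: measurable_funB. Qed.

Lemma integrable_half_powR p : -1 < p ->
  mu.-integrable `]0, (1 / 2)[ (EFin \o (fun u => (u * (1 - u)) `^ p)).
Proof.
move=> p1; have p0 : 0 < p + 1 by lra.
have i0 := lebesgue_integrableS measurableT (measurable_itv `]0, (1 / 2)[) (@subsetT _ _) (integrable_bdens p0 p0).
apply: eq_integrable i0 => // u; rewrite inE/= in_itv/= => /andP[u0 u1].
have u2 : u < 1 by lra.
by rewrite bdensE u0 u2 /= !addrK -powRM//; lra.
Qed.

(** Integrating the derivative of [F] over []0, 1/2[] relates the two integrals, and the boundary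
    value at [1/2] accounts for the term with [2^(- 4 a)]. *)
Lemma half_betaE a : 1 / 2 < a -> a != 1 ->
  symbol_coef a = a * (2 * a - 1) * half_beta a / (4 * (a - 1)).
Proof.
move=> a12 a1; have a10 : a - 1 != 0 by rewrite subr_eq0.
have h0 : 0 < 1 / 2 :> R by lra.
have a2 : 2 * a - 1 != 0 by rewrite gt_eqF//; lra.
(* The first term produces the integrand of the lower beta integral together with
   [- 2 a u (u (1 - u))^(2 a - 2)]; the second one, with derivative
   [- a (1 - 2 u) (u (1 - u))^(2 a - 2)], removes the extra factor [u]. *)
pose F u := - (u `^ (2 * a) * (1 - u) `^ (2 * a - 2)) - a / (2 * a - 1) * (u `^ (2 * a - 1) * (1 - u) `^ (2 * a - 1)).
pose g u := u `^ (1 + 2 * a - 1) * (1 - u) `^ (- 2 + 2 * a - 1).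
pose f u := (2 * a - 2) * g u - a * (u * (1 - u)) `^ (2 * a - 2).
have i1 : mu.-integrable `]0, (1 / 2)[ (EFin \o g).
  apply: (@lebesgue_dominated_integrable R _ _ (fun=> 2 `^ `|- 2 + 2 * a - 1| * 1)) => //.
  - by have := @measurable_beta_weight R (1 + 2 * a) (- 2 + 2 * a) `]0, (1 / 2)[.
  - by apply: lebesgue_integrableZ => //; exact: (integrable_itv_cst1 h0).1.
  move=> u /=; rewrite in_itv/= => /andP[u0 u1]; rewrite ger0_norm ?mulr_ge0 ?powR_ge0//.
  rewrite [leRHS]mulrC; apply: ler_pM; rewrite ?powR_ge0//.
    by rewrite -[leRHS](powRr0 u); apply: ger_powR; lra.
  by apply: powR_half_le; lra.
have p1 : -1 < 2 * a - 2 by lra.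
have i2 := integrable_half_powR p1.
have fi : mu.-integrable `]0, (1 / 2)[ (EFin \o f).
  by apply: lebesgue_integrableB => //; apply: lebesgue_integrableZ.
have dF u : 0 < u < 1 -> is_derive u 1 F (f u).
  move=> /andP[u0 u1]; have t0 : 0 < 1 - u by lra.
  have h := is_derive_onem_powR (2 * a - 2) u1.
  have h1 := is_derive_onem_powR (2 * a - 1) u1.
  have h2 := is_derive1_powR (2 * a) u0.
  have h3 := is_derive1_powR (2 * a - 1) u0.
  apply: is_derive_eq; rewrite /GRing.scale/= /f /g.
  rewrite powRM ?(ltW u0) ?(ltW t0)//.
  have -> : 1 + 2 * a - 1 = 2 * a by ring.
  have -> : - 2 + 2 * a - 1 = 2 * a - 2 - 1 by ring.
  have -> : 2 * a - 1 - 1 = 2 * a - 2 by ring.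
  rewrite (powRE1 (2 * a) u0) (powRE1 (2 * a - 1) u0) (powRE1 (2 * a - 1) t0).
  have -> : 2 * a - 1 - 1 = 2 * a - 2 by ring.
  rewrite (powRE1 (2 * a - 2) t0).
  move: (u `^ _) ((1 - u) `^ _) => P Q; field.
  by rewrite a2.
have dF2 u (u01 : 0 < u < 1 / 2) : is_derive u 1 F (f u).
  by apply: dF; move: u01; lra.
have v : \int[mu]_(u in `]0, (1 / 2)[) f u = F (1 / 2) - 0.
  apply: (Rintegral_oo_FTC h0 _ dF2 _ _ fi).
  - move=> u /andP[u0 u1]; have t0 : u < 1 by lra.
    have cP p := @continuous_powR R p u u0.
    have cO p : {for u, continuous (fun u : R => (1 - u) `^ p)}.
      exact: continuous_onem_powR.
    have cL : {for u, continuous (fun u : R => (u * (1 - u)) `^ (2 * a - 2))}.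
      apply: (@continuous_comp _ _ _ (fun u : R => u * (1 - u)) (fun t : R => t `^ (2 * a - 2))).
        apply: continuousM; first exact: cvg_id.
        by apply: continuousB; [exact: cst_continuous|exact: cvg_id].
      by apply: continuous_powR; rewrite mulr_gt0//; lra.
    have cc (c : R) : {for u, continuous (fun=> c)} by exact: cst_continuous.
    exact: (continuousB (continuousM (cc _) (continuousM (cP _) (cO _))) (continuousM (cc _) cL)).
  - have l1 p : (1 - u) `^ p @[u --> (0 : R)^'+] --> (1 : R).
      have e1 : (1 - 0) `^ p = 1 :> R by rewrite subr0 powR1.
      rewrite -[X in _ --> X]e1; apply: cvg_at_right_filter.
      have h := @continuous_onem_powR R p 0 ltr01. exact: h.
    have l0 p : 0 < p -> u `^ p @[u --> (0 : R)^'+] --> (0 : R) by exact: powR_cvg0.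
    have e0 : 0 = - (0 * 1) - a / (2 * a - 1) * (0 * 1) :> R by ring.
    rewrite [X in _ --> X]e0.
    apply: cvgB; first by apply: cvgN; apply: cvgM; [apply: l0; lra|exact: l1].
    by apply: cvgMr; apply: cvgM; [apply: l0; lra|exact: l1].
  - apply: cvg_at_left_filter; have h1 : (0 < (1 / 2 : R)) && ((1 / 2 : R) < 1) by apply/andP; split; lra.
    by apply/differentiable_continuous/derivable1_diffP; have [] := dF _ h1.
have e : \int[mu]_(u in `]0, (1 / 2)[) f u = (2 * a - 2) * lower_beta (1 / 2) (1 + 2 * a) (- 2 + 2 * a) - a * half_beta a.
  rewrite /f RintegralB//; [|exact: lebesgue_integrableZ..].
  by rewrite !RintegralZl.
have FE : F (1 / 2) = - (4 * 2 `^ (- 4 * a) * (3 * a - 1) / (2 * a - 1)).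
  have H p : (1 / 2) `^ p = 2 `^ (- p) :> R by rewrite powR_div// powR1 powRN mul1r.
  rewrite /F (_ : 1 - 1 / 2 = 1 / 2); last by field.
  have n2 (x y : R) : 2 `^ x * 2 `^ y = 2 `^ (x + y) :> R by rewrite -powRD// pnatr_eq0 implybT.
  rewrite !H !n2; have -> : - (2 * a) + - (2 * a - 2) = - 4 * a + 2 by ring.
  have -> : - (2 * a - 1) + - (2 * a - 1) = - 4 * a + 2 by ring.
  rewrite -n2 (powR_mulrn 2 (ler0n R 2)); move: (2 `^ _) => P; field.
  by rewrite a2.
rewrite /symbol_coef; move: v; rewrite e FE subr0.
move: (lower_beta _ _ _) (half_beta a) (2 `^ _) => B H P v.
have -> : B = (a * H - 4 * P * (3 * a - 1) / (2 * a - 1)) / (2 * (a - 1)).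
  apply: (@mulfI _ (2 * a - 2)); first by rewrite (_ : 2 * a - 2 = 2 * (a - 1)) ?mulf_neq0//; ring.
  rewrite -[LHS](subrK (a * H)) v; field.
  by rewrite a10 a2.
by field; rewrite a10 a2.
Qed.

Lemma cvg_xlnx : u * ln u @[u --> (0 : R)^'+] --> (0 : R).
Proof.
apply: (@squeeze_cvgr _ _ _ _ (fun u : R => - 2 * u `^ (1 / 2)) (fun=> 0)).
- near=> u.
  have u0 : 0 < u by near: u; exact: nbhs_right_gt.
  have u1 : u < 1 by near: u; exact: nbhs_right_lt.
  have P0 := powR_gt0 (- (1 / 2)) u0; have := ln_le_subr1 P0; rewrite ln_powR => h.
  have e : u `^ (1 / 2) = u * u `^ (- (1 / 2)).
    by rewrite [RHS]mulrC (powRE1 (1 / 2) u0); congr (_ `^ _ * _); field.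
  have l0 : ln u <= 0 by rewrite ln_le0// ltW.
  apply/andP; split; last exact: (mulr_ge0_le0 (ltW u0) l0).
  rewrite e; move: (u `^ _) P0 h => P P0 h.
  by rewrite mulrCA ler_pM2l//; lra.
- rewrite -[X in _ --> X](mulr0 (- 2)); apply: cvgMr; apply: powR_cvg0; lra.
- exact: cvg_cst.
Unshelve. all: by end_near. Qed.

Definition log_logit u := ln (u * (1 - u)).

(** Twice this value, [- 2], is the first-order coefficient of [half_beta] at [a = 1]. *)
Lemma Rintegral_log_logit : mu.-integrable `]0, (1 / 2)[ (EFin \o log_logit) /\
  \int[mu]_(u in `]0, (1 / 2)[) log_logit u = -1.
Proof.
have h0 : 0 < 1 / 2 :> R by lra.
(* A primitive of [- log_logit]; the two logarithmic terms cancel at [1/2], where the value is 1. *)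
pose F (u : R) := 2 * u + (1 - u) * ln (1 - u) - u * ln u.
have dF (u : R) : 0 < u < 1 -> is_derive u 1 F (- log_logit u).
  move=> /andP[u0 u1]; have t0 : 0 < 1 - u by lra.
  have h := is_derive1_ln u0; have h1 := is_derive1_ln t0.
  have h2 : is_derive u 1 (fun u : R => 1 - u) (- 1).
    by apply: is_derive_eq; rewrite add0r mul1r.
  have h3 : is_derive u 1 (fun u : R => ln (1 - u)) ((1 - u)^-1 * - 1).
    exact: (@is_derive1_comp _ (@ln R) (fun u : R => 1 - u) u _ _ h1 h2).
  apply: is_derive_eq; rewrite /GRing.scale/= /log_logit lnM ?posrE//.
  by move: (ln u) (ln (1 - u)) => A B; field; rewrite !gt_eqF.
have dF2 (u : R) (u01 : 0 < u < 1 / 2) : is_derive u 1 F (- log_logit u).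
  by apply: dF; move: u01; lra.
have [] := @ge0_Rintegral_oo_FTC R 0 (1 / 2) (fun u => - log_logit u) F 0 (F (1 / 2)) h0 _ dF2.
- move=> u u01; have /andP[L0 _] := logit_bounds u01; apply: continuousN.
  apply: (@continuous_comp _ _ _ (fun u : R => u * (1 - u)) (@ln R)); last exact: continuous_ln.
  apply: continuousM; first exact: cvg_id.
  by apply: continuousB; [exact: cst_continuous|exact: cvg_id].
- have e0 : 0 = 2 * 0 + (1 - 0) * ln (1 - 0) - 0 :> R by rewrite !subr0 ln1 !mulr0 addr0.
  rewrite [X in _ --> X]e0.
  apply: cvgB; last exact: cvg_xlnx.
  have i0 : u @[u --> (0 : R)^'+] --> (0 : R) by apply: cvg_at_right_filter; exact: cvg_id.
  apply: cvgD; first exact: cvgMr.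
  have i1 : 1 - u @[u --> (0 : R)^'+] --> (1 - 0 : R) by apply: cvgB => //; exact: cvg_cst.
  apply: cvgM => //; apply: (continuous_cvg _ _ i1).
  by rewrite subr0; apply: continuous_ln.
- apply: cvg_at_left_filter; have h1 : (0 < (1 / 2 : R)) && ((1 / 2 : R) < 1) by apply/andP; split; lra.
  by apply/differentiable_continuous/derivable1_diffP; have [] := dF _ h1.
- by move=> u /logit_bounds /andP[L0 L1]; rewrite oppr_ge0 ln_le0// ltW.
move=> i1 v1; have i2 : mu.-integrable `]0, (1 / 2)[ (EFin \o log_logit).
  have := lebesgue_integrableZ (-1) (measurable_itv _) i1.
  by apply: eq_integrable => // u _ /=; rewrite mulN1r opprK.
split=> //.
have -> : \int[mu]_(u in `]0, (1 / 2)[) log_logit u = \int[mu]_(u in `]0, (1 / 2)[) (-1 * - log_logit u).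
  by apply: eq_Rintegral => u _; rewrite mulN1r opprK.
rewrite RintegralZl//.
rewrite v1 /F subr0 (_ : 1 - 1 / 2 = 1 / 2); last by field.
by move: (ln _) => L; field.
Qed.

(** The integrand is [e^((a - 1) 2 l)] with [l = log_logit u]; its expansion to second order passes
    under the integral by domination. Second order is required because [psi_one] contains
    [half_beta] divided by [(a - 1)^2]. *)
Lemma cvg_half_beta : exists l : R,
  (half_beta a - 1 / 2 + 2 * (a - 1)) / (a - 1) ^+ 2 @[a --> (1 : R)^'] --> l.
Proof.
have h0 : 0 < 1 / 2 :> R by lra.
have [i1 v1] := integrable_itv_cst1 h0; have [il vl] := Rintegral_log_logit.
have q0 : -1 < - (3 / 4) :> R by lra.
have i4 := integrable_half_powR q0.
pose f a u := (expR ((a - 1) * (2 * log_logit u)) - 1 - (a - 1) * (2 * log_logit u)) / (a - 1) ^+ 2.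
have E a : 1 / 2 < a -> a != 1 ->
    \int[mu]_(u in `]0, (1 / 2)[) f a u = (half_beta a - 1 / 2 + 2 * (a - 1)) / (a - 1) ^+ 2.
  move=> a12 a1; have p1 : -1 < 2 * a - 2 by lra.
  have ip := integrable_half_powR p1.
  have j1 := lebesgue_integrableB (measurable_itv _) ip i1.
  have j2 := lebesgue_integrableZ (2 * (a - 1)) (measurable_itv `]0, (1 / 2)[) il.
  have j3 := lebesgue_integrableB (measurable_itv _) j1 j2.
  transitivity (\int[mu]_(u in `]0, (1 / 2)[)
      (((a - 1) ^+ 2)^-1 * ((u * (1 - u)) `^ (2 * a - 2) - 1 - 2 * (a - 1) * log_logit u))).
    apply: eq_Rintegral => u; rewrite inE/= in_itv/= => u01.
    have /andP[L0 _] := logit_bounds u01.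
    rewrite /f /powR (gt_eqF L0) [RHS]mulrC -/(log_logit u); congr ((expR _ - _ - _) / _); ring.
  rewrite RintegralZl// RintegralB// RintegralB// RintegralZl// v1 vl -/(half_beta a).
  by move: (half_beta a) (_^-1) => H K; ring.
exists (\int[mu]_(u in `]0, (1 / 2)[) ((2 * log_logit u) ^+ 2 / 2)).
have mL (D : set R) : measurable_fun D log_logit.
  apply: (@measurableT_comp _ _ _ (measurableTypeR R) (measurableTypeR R) (measurableTypeR R) (@ln R)).
    exact: measurable_ln.
  exact: measurable_onemM.
have L : \int[mu]_(u in `]0, (1 / 2)[) f a u @[a --> (1 : R)^'] -->
    \int[mu]_(u in `]0, (1 / 2)[) ((2 * log_logit u) ^+ 2 / 2).
  (* With [l = - log_logit u] and [|a - 1| <= 1/4], the quotient is at most [4 l^2 e^(l / 2)], and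
     [l^2 <= 32 e^(l / 4)]. This gives 128 and the exponent [- 3/4], still integrable at 0. *)
  apply: (@cvg_lebesgue_dnbhs R _ _ _ (fun u => 128 * (u * (1 - u)) `^ (- (3 / 4)))) => //.
  - exact: lebesgue_integrableZ.
  - by apply: measurable_funM => //; apply: measurable_funX; exact: measurable_funM.
  - apply: nearW => a; apply: measurable_funM => //; apply: measurable_funB; last first.
      by apply: measurable_funM => //; exact: measurable_funM.
    apply: measurable_funB => //; apply: (measurableT_comp (@measurable_expR R)).
    by apply: measurable_funM => //; exact: measurable_funM.
  - near=> a; move=> u /=; rewrite in_itv/= => u01.
    have a1 : a - 1 != 0 by rewrite subr_eq0; near: a; exact: nbhs_dnbhs_neq.
    have ha : `|a - 1| <= 1 / 4.
      by apply: ltW; near: a; apply: near_dnbhs_dist; lra.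
    have /andP[L0 L1] := logit_bounds u01.
    have l0 : log_logit u <= 0 by rewrite ln_le0// ltW.
    rewrite /f normf_div ler_pdivrMr ?normr_gt0 ?expf_neq0//.
    apply: (le_trans (expR_expand2 _)).
    rewrite normrX !normrM (@ger0_norm _ 2)// (ler0_norm l0).
    have -> : (u * (1 - u)) `^ (- (3 / 4)) = expR (- log_logit u / 2) * expR (- log_logit u / 4).
      by rewrite /powR (gt_eqF L0) -expRD -/(log_logit u); congr expR; field.
    have m0 : 0 <= - log_logit u by rewrite oppr_ge0.
    move: (- log_logit u) m0 => l m0.
    have h1 : expR (`|a - 1| * (2 * l)) <= expR (l / 2) by rewrite ler_expR; nra.
    have h2 : l ^+ 2 <= 32 * expR (l / 4).
      have l4 : 0 <= l / 4 by lra.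
      have := expR_ge1Dxn 1 l4; rewrite (_ : 2`!%:R = 2)//; nra.
    have E1 := expR_ge0 (l / 2); have E2 := expR_ge0 (l / 4).
    apply: (@le_trans _ _ ((`|a - 1| * (2 * l)) ^+ 2 * expR (l / 2))).
      by rewrite ler_wpM2l// exprn_ge0// !mulr_ge0.
    move: (`|a - 1|) (normr_ge0 (a - 1)) (expR (l / 2)) (expR (l / 4)) h2 E1 E2 => w w0 A B h2 E1 E2.
    have -> : (w * (2 * l)) ^+ 2 * A = (4 * w ^+ 2 * A) * l ^+ 2 by ring.
    have -> : 128 * (A * B) * w ^+ 2 = (4 * w ^+ 2 * A) * (32 * B) by ring.
    by rewrite ler_wpM2l// !mulr_ge0// exprn_ge0.
  - move=> u _; exact: cvg_expR_quot2.
apply: cvg_trans L; apply: near_eq_cvg; near=> a.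
apply: E; last by near: a; exact: nbhs_dnbhs_neq.
have : `|a - 1| < 1 / 2 by near: a; apply: near_dnbhs_dist; lra.
by rewrite ltr_norml; lra.
Unshelve. all: by end_near. Qed.

End half_beta.

(** * Passage to the limit under the mean *)

Section psi_limit.
Context {R : realType}.
Local Notation mu := (@lebesgue_measure R).
Implicit Types (a u r : R).

(** The poles of [symbol_quad] and [symbol_coef] cancel once [1/2 - 2 (a - 1)] is taken out of
    [half_beta]; what remains apart from the second-order quotient is [(2 a + 1) (a - 1)], divisible
    as required. *)
Lemma psi_oneE a : 1 / 2 < a -> a != 1 ->
  psi_one a = (3 + 2 * (a - 1) + (half_beta a - 1 / 2 + 2 * (a - 1)) / (a - 1) ^+ 2 * (a * (2 * a - 1))) / (8 * a).
Proof.
move=> a12 a1; have a10 : a - 1 != 0 by rewrite subr_eq0.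
have a00 : a != 0 by rewrite gt_eqF//; lra.
rewrite /psi_one /symbol_one /symbol_quad half_betaE//.
by move: (half_beta a) => H; field; rewrite a00 a10.
Qed.

Lemma near_dnbhs1_itv e : 0 < e -> \forall a \near (1 : R)^', 1 - e < a < 1 + e.
Proof.
move=> e0; have := @near_dnbhs_dist R 1 e e0; apply: filterS => a.
by rewrite ltr_norml => /andP[h1 h2]; apply/andP; split; lra.
Qed.

Lemma cvg_psi_one : exists d : R, psi_one a @[a --> (1 : R)^'] --> d.
Proof.
have [l hl] := @cvg_half_beta R; have ha := @cvg_dnbhs_id R 1.
have cc (c : R) : c @[a --> (1 : R)^'] --> c by exact: cvg_cst.
have h : (3 + 2 * (a - 1) + (half_beta a - 1 / 2 + 2 * (a - 1)) / (a - 1) ^+ 2 * (a * (2 * a - 1))) / (8 * a)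
   @[a --> (1 : R)^'] --> (3 + 2 * (1 - 1) + l * (1 * (2 * 1 - 1))) / (8 * 1).
  apply: cvgM; last by apply: cvgV; [rewrite mulr1 pnatr_eq0|exact: cvgM].
  apply: cvgD; first by apply: cvgD => //; apply: cvgM => //; exact: cvgB.
  apply: cvgM => //; apply: cvgM => //; apply: cvgB => //; exact: cvgM.
exists ((3 + 2 * (1 - 1) + l * (1 * (2 * 1 - 1))) / (8 * 1)).
apply: cvg_trans h; apply: near_eq_cvg; near=> a.
have e0 : 0 < 1 / 2 :> R by lra.
have /andP[a12 _] : 1 - 1 / 2 < a < 1 + 1 / 2 by near: a; exact: near_dnbhs1_itv.
by rewrite psi_oneE//; [lra|near: a; exact: nbhs_dnbhs_neq].
Unshelve. all: by end_near. Qed.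

(** One eighth of [u^(- 3)] times the derivative of [symbol_rem a u] in [a] at 1. The ones are left
    unsimplified, in the places where [a] stands before the limit. *)
Definition rem_limit u : R :=
  u `^ (1 - 4) * ((- 2 * u + (2 * 1 + 1) * u ^+ 2 - (1 - u) ^+ 2 * (2 * ln (1 - u))) / (8 * 1)).

Lemma cvg_dnbhs1_powR (f : R -> R) (t l : R) : 0 < t ->
  f a @[a --> (1 : R)^'] --> l -> t `^ (f a) @[a --> (1 : R)^'] --> t `^ l.
Proof.
move=> t0 h; have E z : t `^ z = expR (z * ln t) by rewrite /powR gt_eqF.
rewrite E; under eq_cvg do rewrite E.
by apply: (continuous_cvg _ (@continuous_expR R _)); apply: cvgM => //; exact: cvg_cst.
Qed.

Lemma cvg_rem u : 0 < u < 1 ->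
  u `^ (1 - 4 * a) * symbol_rem a u / (8 * a * (a - 1)) @[a --> (1 : R)^'] --> rem_limit u.
Proof.
move=> /andP[u0 u1]; have t0 : 0 < 1 - u by lra.
have ha := @cvg_dnbhs_id R 1; have cc (c : R) : c @[a --> (1 : R)^'] --> c by exact: cvg_cst.
have h : u `^ (1 - 4 * a) * ((- 2 * u + (2 * a + 1) * u ^+ 2 -
    (1 - u) ^+ 2 * ((expR ((a - 1) * (2 * ln (1 - u))) - 1) / (a - 1))) / (8 * a))
    @[a --> (1 : R)^'] --> rem_limit u.
  apply: cvgM.
    have e : 1 - 4 = 1 - 4 * 1 :> R by rewrite mulr1.
    by rewrite e; apply: cvg_dnbhs1_powR => //; apply: cvgB => //; exact: cvgM.
  apply: cvgM; last by apply: cvgV; [rewrite mulr1 pnatr_eq0|exact: cvgM].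
  apply: cvgB; last by apply: cvgM => //; exact: cvg_expR_quot1.
  by apply: cvgD => //; apply: cvgM => //; apply: cvgD => //; exact: cvgM.
apply: cvg_trans h; apply: near_eq_cvg; near=> a.
have a10 : a - 1 != 0 by rewrite subr_eq0; near: a; exact: nbhs_dnbhs_neq.
have e0 : 0 < 1 / 2 :> R by lra.
have /andP[a12 _] : 1 - 1 / 2 < a < 1 + 1 / 2 by near: a; exact: near_dnbhs1_itv.
have a00 : a != 0 by rewrite gt_eqF//; lra.
have -> : symbol_rem a u = 1 - 2 * a * u + a * (2 * a - 1) * u ^+ 2 - (1 - u) ^+ 2 * expR ((a - 1) * (2 * ln (1 - u))).
  rewrite /symbol_rem -(powR_mulrn 2 (ltW t0)) /powR !(gt_eqF t0) -expRD; congr (_ - expR _); ring.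
by move: (_ `^ _) (expR _) => P E; field; rewrite a00 a10.
Unshelve. all: by end_near. Qed.

(** For [|a - 1| < 1/4] the integrand is dominated by a constant on []r, 1[]: [symbol_rem_le]
    compensates the denominator, and [u^(1 - 4 a) <= u^(- 4)]. *)
Lemma cvg_rem_int r : 0 < r < 1 ->
  rem_int a r / (8 * a * (a - 1)) @[a --> (1 : R)^'] --> \int[mu]_(u in `]r, 1[) rem_limit u.
Proof.
move=> r01; have [r0 r1] := andP r01; have e4 : 0 < 1 / 4 :> R by lra.
have L : \int[mu]_(u in `]r, 1[) (u `^ (1 - 4 * a) * symbol_rem a u / (8 * a * (a - 1)))
    @[a --> (1 : R)^'] --> \int[mu]_(u in `]r, 1[) rem_limit u.
  apply: (@cvg_lebesgue_dnbhs R _ _ _ (fun u => (1 + r `^ (- 4)) * 1)) => //.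
  - by apply: lebesgue_integrableZ => //; exact: (integrable_itv_cst1 r1).1.
  - have mO : measurable_fun `]r, 1[ (fun u : R => 1 - u) by exact: measurable_funB.
    apply: measurable_funM; first exact: measurable_fun_powR.
    apply: measurable_funM => //; apply: measurable_funB.
      by apply: measurable_funD; apply: measurable_funM => //; exact: exprn_measurable.
    apply: measurable_funM; first exact: measurable_funX.
    apply: measurable_funM => //.
    apply: (@measurableT_comp _ _ _ (measurableTypeR R) (measurableTypeR R) (measurableTypeR R) (@ln R)) => //.
  - apply: nearW => a; apply: measurable_funM => //; apply: measurable_funM.
      exact: measurable_fun_powR.
    exact: measurable_symbol_rem.
  - near=> a; move=> u /=; rewrite in_itv/= => /andP[ru u1].
    have a1 : a - 1 != 0 by rewrite subr_eq0; near: a; exact: nbhs_dnbhs_neq.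
    have /andP[al ah] : 1 - 1 / 4 < a < 1 + 1 / 4 by near: a; exact: near_dnbhs1_itv.
    have a12 : 1 / 2 < a by lra.
    have u0 : 0 < u by lra.
    have u01 : 0 < u < 1 by rewrite u0.
    have hu := symbol_rem_le a12 u01.
    have n0 : 0 < `|a - 1| by rewrite normr_gt0.
    have d0 : 0 < 8 * a * `|a - 1| by rewrite !mulr_gt0//; lra.
    rewrite -mulrA normrM; apply: ler_pM => //.
      rewrite ger0_norm ?powR_ge0//; apply: (@le_trans _ _ (u `^ (- 4))).
        by apply: ger_powR; [rewrite u0 ltW|lra].
      by apply: powR_le1D => //; rewrite !ltW.
    rewrite normf_div !normrM (@ger0_norm _ 8)// (@ger0_norm _ a); last by lra.
    rewrite ler_pdivrMr// mul1r; apply: (le_trans hu).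
    rewrite (_ : 8 * a * `|a - 1| = 4 * a * `|a - 1| * 2); last by ring.
    rewrite ler_wpM2l//; first by rewrite !mulr_ge0//; lra.
    by rewrite (@le_trans _ _ 1)// ?expr_le1// ?ltW//; lra.
  - move=> u /=; rewrite in_itv/= => /andP[ru u1]; apply: cvg_rem; rewrite u1; lra.
apply: cvg_trans L; apply: near_eq_cvg; near=> a.
have e0 : 0 < 1 / 2 :> R by lra.
have /andP[a12 _] : 1 - 1 / 2 < a < 1 + 1 / 2 by near: a; exact: near_dnbhs1_itv.
have a12' : 1 / 2 < a by lra.
rewrite -RintegralZr//; exact: integrable_rem.
Unshelve. all: by end_near. Qed.

Definition psi_limit d r : R := (4 * 1 - 2) / (4 * 1 - 3) * r + r `^ (4 * 1 - 2) *
  (d - (4 * 1 - 2) / (4 * 1 - 3) - (4 * 1 - 2) * \int[mu]_(u in `]r, 1[) rem_limit u).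

Lemma cvg_psi d r : psi_one a @[a --> (1 : R)^'] --> d -> 0 < r < 1 ->
  psi a r @[a --> (1 : R)^'] --> psi_limit d r.
Proof.
move=> hd r01; have [r0 r1] := andP r01.
have ha := @cvg_dnbhs_id R 1; have cc (c : R) : c @[a --> (1 : R)^'] --> c by exact: cvg_cst.
have h42 : 4 * a - 2 @[a --> (1 : R)^'] --> (4 * 1 - 2 : R) by apply: cvgB => //; exact: cvgM.
have h43 : (4 * a - 2) / (4 * a - 3) @[a --> (1 : R)^'] --> ((4 * 1 - 2) / (4 * 1 - 3) : R).
  apply: cvgM => //; apply: cvgV; first by rewrite gt_eqF//; lra.
  by apply: cvgB => //; exact: cvgM.
have h : (4 * a - 2) / (4 * a - 3) * r + r `^ (4 * a - 2) * (psi_one a - (4 * a - 2) / (4 * a - 3)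
   - (4 * a - 2) * (rem_int a r / (8 * a * (a - 1)))) @[a --> (1 : R)^'] --> psi_limit d r.
  apply: cvgD; first exact: cvgM.
  apply: cvgM; first exact: cvg_dnbhs1_powR.
  by apply: cvgB; [exact: cvgB|apply: cvgM => //; exact: cvg_rem_int].
apply: cvg_trans h; apply: near_eq_cvg; near=> a.
have e4 : 0 < 1 / 4 :> R by lra.
have /andP[al _] : 1 - 1 / 4 < a < 1 + 1 / 4 by near: a; exact: near_dnbhs1_itv.
have a34 : 3 / 4 < a by lra.
have a1 : a != 1 by near: a; exact: nbhs_dnbhs_neq.
by rewrite -(psiE a34 a1 r01); ring.
Unshelve. all: by end_near. Qed.

Lemma unit_bounded_psi a : 1 / 2 < a -> unit_bounded (psi a).
Proof.
move=> a12; have := unit_boundedZ (8 * a * (a - 1))^-1 (unit_bounded_symbol a12).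
by under eq_fun do rewrite mulrC.
Qed.

(** The limit of [psi_bound] with [m = 1/2], admissible for [a >= 7/8]; at [a = 1] both rational
    terms of its constant equal 2, hence the 4. *)
Lemma psi_limit_le d r : psi_one a @[a --> (1 : R)^'] --> d -> 0 < r < 1 ->
  `|psi_limit d r - 2 * r| <= (`|d| + 4) * r `^ (1 + 1 / 2).
Proof.
move=> hd r01; have hp := cvg_psi hd r01.
have ha := @cvg_dnbhs_id R 1; have cc (c : R) : c @[a --> (1 : R)^'] --> c by exact: cvg_cst.
have h42 : 4 * a - 2 @[a --> (1 : R)^'] --> (4 * 1 - 2 : R) by apply: cvgB => //; exact: cvgM.
have h43 : (4 * a - 2) / (4 * a - 3) @[a --> (1 : R)^'] --> ((4 * 1 - 2) / (4 * 1 - 3) : R).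
  apply: cvgM => //; apply: cvgV; first by rewrite gt_eqF//; lra.
  by apply: cvgB => //; exact: cvgM.
have e3 : 4 * 1 - 2 = 2 :> R by ring.
have e1 : 4 * 1 - 3 = 1 :> R by ring.
have e2 : (4 * 1 - 2) / (4 * 1 - 3) = 2 :> R by rewrite e3 e1 divr1.
have hl : `|psi a r - (4 * a - 2) / (4 * a - 3) * r| @[a --> (1 : R)^'] --> `|psi_limit d r - 2 * r|.
  by apply: cvg_norm; apply: cvgB => //; move: (h43); rewrite e2 => h43'; exact: cvgM.
have hr : (`|psi_one a| + (4 * a - 2) / (4 * a - 3) + (4 * a - 2)) * r `^ (1 + 1 / 2)
    @[a --> (1 : R)^'] --> (`|d| + 4) * r `^ (1 + 1 / 2).
  have -> : `|d| + 4 = `|d| + (4 * 1 - 2) / (4 * 1 - 3) + (4 * 1 - 2) by rewrite e2 e3; ring.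
  by apply: cvgM => //; apply: cvgD => //; apply: cvgD => //; exact: cvg_norm.
apply: (ler_cvg_to hl hr); near=> a.
have e8 : 0 < 1 / 8 :> R by lra.
have /andP[al _] : 1 - 1 / 8 < a < 1 + 1 / 8 by near: a; exact: near_dnbhs1_itv.
apply: psi_bound => //; [lra|by near: a; exact: nbhs_dnbhs_neq|by apply/andP; split; lra|lra].
Unshelve. all: by end_near. Qed.

Lemma unit_bounded_psi_limit d : psi_one a @[a --> (1 : R)^'] --> d -> unit_bounded (psi_limit d).
Proof.
move=> hd; split.
  (* Measurability passes to the pointwise limit along a sequence that tends to 1 without reaching
     it. *)
  pose t n := 1 + n.+1%:R^-1 : R.
  apply: (@measurable_fun_cvg _ (measurableTypeR R) R `]0, 1[ (fun n => psi (t n))).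
    move=> n; apply: (unit_bounded_psi _).1; rewrite /t.
    have : 0 <= n.+1%:R^-1 :> R by rewrite invr_ge0.
    by move: (n.+1%:R^-1) => v; lra.
  move=> r /=; rewrite in_itv/= => r01; have := cvg_psi hd r01; move/cvgr_dnbhsP; apply.
  split; first by move=> n; rewrite /t -subr_eq0 addrAC subrr add0r invr_eq0 pnatr_eq0.
  by rewrite -[X in _ --> X]addr0; apply: cvgD; [exact: cvg_cst|exact: cvg_harmonic].
exists (`|d| + 4 + 2) => r r01; have [r0 r1] := andP r01.
have h := psi_limit_le hd r01.
have -> : psi_limit d r = (psi_limit d r - 2 * r) + 2 * r by rewrite subrK.
apply: (le_trans (ler_normD _ _)); apply: lerD.
  apply: (le_trans h); rewrite ler_piMr ?addr_ge0//.
  by rewrite -[leRHS](powRr0 r); apply: ger_powR; [rewrite r0 ltW|lra].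
by rewrite ger0_norm; lra.
Qed.

(** The rate [xi], the exponent of the weight and the averaged function all vary with [a]; numerator
    and denominator of the mean are treated by the same dominated convergence [D]. *)
Lemma cvg_gamma_formula1 d (nu : R) (k : nat) : 0 < nu -> (3 <= k)%N ->
  psi_one a @[a --> (1 : R)^'] --> d ->
  gamma_formula a nu k @[a --> (1 : R)^'] --> tail_avg (xi 1 nu) (k%:R - 2 * 1) (psi_limit d).
Proof.
move=> nu0 k3 hd; have h12 : 1 / 2 < 1 :> R by lra.
have x0 := xi_gt0 h12 nu0; set x := xi 1 nu in x0 *.
have K3 : 3 <= k%:R :> R by rewrite (ler_nat R 3 k).
have ha := @cvg_dnbhs_id R 1; have cc (c : R) : c @[a --> (1 : R)^'] --> c by exact: cvg_cst.
have hx : xi a nu @[a --> (1 : R)^'] --> x.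
  rewrite /x /xi; apply: cvgM; first by apply: cvgM => //; exact: cvgM.
  apply: cvgV; last by apply: cvgM => //; apply: cvgB => //; exact: cvgM.
  rewrite mulf_neq0 ?gt_eqF ?pi_gt0//; lra.
have hp : k%:R - 2 * a @[a --> (1 : R)^'] --> (k%:R - 2 * 1 : R).
  by apply: cvgB => //; exact: cvgM.
have bp := unit_bounded_psi_limit hd.
have x20 : 0 < x / 2 by rewrite divr_gt0.
have D (f : R -> R -> R) (g : R -> R) M : unit_bounded g ->
    (\forall a \near (1 : R)^', unit_bounded (f a)) ->
    (\forall a \near (1 : R)^', forall r, 0 < r < 1 -> `|f a r| <= M) ->
    (forall r, 0 < r < 1 -> f a r @[a --> (1 : R)^'] --> g r) ->
    tail_int (xi a nu) (k%:R - 2 * a) (f a) @[a --> (1 : R)^'] --> tail_int x (k%:R - 2 * 1) g.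
  move=> bg bf fM fg; rewrite /tail_int.
  (* Near [a = 1] the rate is at least [x / 2] and the exponent at most [k + 1]; as [y > 1], this
     single weight dominates. *)
  apply: (@cvg_lebesgue_dnbhs R _ _ _ (fun y => M * tail_weight (x / 2) (k%:R + 1) y)) => //.
  - by apply: lebesgue_integrableZ => //; exact: integrable_tail_weight.
  - by apply: measurable_funM; [exact: measurable_tail_weight|exact: measurable_comp_inv bg.1].
  - near=> a; have bfa : unit_bounded (f a) by near: a.
    by apply: measurable_funM; [exact: measurable_tail_weight|exact: measurable_comp_inv bfa.1].
  - near=> a; move=> y /=; rewrite in_itv/= andbT => y1.
    have y01 := inv_gt1 y1; have y0 : 0 < y by apply: lt_trans y1.
    have fMa : forall r, 0 < r < 1 -> `|f a r| <= M by near: a.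
    rewrite normrM mulrC; apply: ler_pM => //; first exact: fMa.
    rewrite ger0_norm ?tail_weight_ge0//; apply: ler_pM; rewrite ?powR_ge0 ?expR_ge0//.
      have al : 1 / 2 < a.
        have e0 : 0 < 1 / 2 :> R by lra.
        have /andP[al _] : 1 - 1 / 2 < a < 1 + 1 / 2 by near: a; exact: near_dnbhs1_itv.
        lra.
      by apply: ler_powR; [exact: ltW|lra].
    rewrite ler_expR lerN2 ler_pM2r//; near: a.
    by apply: (cvgr_ge x) => //; lra.
  - move=> y /=; rewrite in_itv/= andbT => y1.
    have y01 := inv_gt1 y1; have y0 : 0 < y by apply: lt_trans y1.
    apply: cvgM; last exact: fg.
    apply: cvgM; first by apply: cvg_dnbhs1_powR => //; exact: cvgB.
    by apply: (continuous_cvg _ (@continuous_expR R _)); apply: cvgN; exact: cvgM.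
have N : tail_int (xi a nu) (k%:R - 2 * a) (psi a) @[a --> (1 : R)^'] -->
    tail_int x (k%:R - 2 * 1) (psi_limit d).
  apply: (D _ _ (`|d| + 20)) => //.
  - near=> a; apply: unit_bounded_psi.
    have e0 : 0 < 1 / 2 :> R by lra.
    have /andP[al _] : 1 - 1 / 2 < a < 1 + 1 / 2 by near: a; exact: near_dnbhs1_itv.
    lra.
  - near=> a; move=> r r01; have [r0 r1] := andP r01.
    have e8 : 0 < 1 / 8 :> R by lra.
    have /andP[al ah] : 1 - 1 / 8 < a < 1 + 1 / 8 by near: a; exact: near_dnbhs1_itv.
    have a1 : a != 1 by near: a; exact: nbhs_dnbhs_neq.
    have hD : `|psi_one a| <= `|d| + 1.
      near: a; apply: (cvgr_le `|d|); first exact: cvg_norm.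
      by rewrite ltrDl.
    have a34 : 3 / 4 < a by lra.
    have m01 : (0 < (1 / 2 : R)) && ((1 / 2 : R) <= 1 / 2) by apply/andP; split; lra.
    have ma : 1 / 2 <= 4 * a - 3 by lra.
    have hb := psi_bound a34 a1 m01 ma r01.
    have c5 : (4 * a - 2) / (4 * a - 3) <= 5 by rewrite ler_pdivrMr; lra.
    have c0 : 0 <= (4 * a - 2) / (4 * a - 3) by rewrite divr_ge0; lra.
    have -> : psi a r = (psi a r - (4 * a - 2) / (4 * a - 3) * r) + (4 * a - 2) / (4 * a - 3) * r by rewrite subrK.
    have P1 : r `^ (1 + 1 / 2) <= 1.
      by rewrite -[leRHS](powRr0 r); apply: ger_powR; [rewrite r0 ltW|lra].
    apply: (le_trans (ler_normD _ _)); apply: (@le_trans _ _ ((`|d| + 1 + 5 + 3) + 5)); last by lra.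
    apply: lerD.
      apply: (le_trans hb); apply: (@le_trans _ _ (`|psi_one a| + (4 * a - 2) / (4 * a - 3) + (4 * a - 2))).
        have s0 : 0 <= 4 * a - 2 by lra.
        by rewrite ler_piMr// (addr_ge0 (addr_ge0 (normr_ge0 _) c0) s0).
      by apply: lerD; [exact: lerD|lra].
    rewrite ger0_norm; last by rewrite mulr_ge0// ltW.
    by apply: (le_trans _ c5); rewrite ler_piMr// ltW.
  - by move=> r r01; exact: cvg_psi.
have I : tail_int (xi a nu) (k%:R - 2 * a) (fun=> 1) @[a --> (1 : R)^'] -->
    tail_int x (k%:R - 2 * 1) (fun=> 1).
  apply: (D (fun=> fun=> 1) _ 1) => //; first exact: unit_bounded_cst.
  - by apply: nearW => a; exact: unit_bounded_cst.
  - by apply: nearW => a r _; rewrite normr1.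
(* The hypothesis [3 <= k] makes the exponent [k - 2] at least 1, which gives a positive tail
   integral. *)
have I0 : tail_int x (k%:R - 2 * 1) (fun=> 1) != 0.
  by rewrite gt_eqF// tail_int1_gt0//; lra.
have L := cvgM N (cvgV I0 I).
have {}L : tail_int (xi a nu) (k%:R - 2 * a) (psi a) / tail_int (xi a nu) (k%:R - 2 * a) (fun=> 1)
   @[a --> (1 : R)^'] --> tail_avg x (k%:R - 2 * 1) (psi_limit d) by exact: L.
apply: cvg_trans L; apply: near_eq_cvg; near=> a.
have e0 : 0 < 1 / 2 :> R by lra.
have /andP[al _] : 1 - 1 / 2 < a < 1 + 1 / 2 by near: a; exact: near_dnbhs1_itv.
have a12 : 1 / 2 < a by lra.
have a1 : a != 1 by near: a; exact: nbhs_dnbhs_neq.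
rewrite gamma_formulaE// -tail_avgZ//; [|exact: xi_gt0|exact: unit_bounded_symbol].
by rewrite /tail_avg; congr (tail_int _ _ _ / _); apply/funext => r; rewrite /psi mulrC.
Unshelve. all: by end_near. Qed.

End psi_limit.

(** * The three asymptotic regimes *)

Section gamma_asymptotics.
Context {R : realType}.
Implicit Types (a nu : R).

Lemma gammaE a nu k : 1 / 2 < a -> a != 1 -> 0 < nu ->
  gamma a nu k = (8 * a * (a - 1))^-1 * tail_avg (xi a nu) (k%:R - 2 * a) (gamma_symbol a).
Proof. by move=> a12 a1 nu0; rewrite /gamma (negbTE a1) gamma_formulaE. Qed.

Lemma cvg_gamma_gt34 a nu : 3 / 4 < a -> 0 < nu ->
  k%:R * gamma a nu k @[k --> \oo] --> 8 * a * nu / (pi * (4 * a - 3)).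
Proof.
move=> a34 nu0; have a12 : 1 / 2 < a by lra.
have x0 := xi_gt0 a12 nu0; have rho0 : \forall k \near \oo, 0 <= k%:R :> R by exact: nearW.
have bX := @unit_bounded_id R.
have pi0 : pi != 0 :> R by rewrite gt_eqF// pi_gt0.
have cE : (4 * a - 2) / (4 * a - 3) * xi a nu = 8 * a * nu / (pi * (4 * a - 3)).
  have h1 : 4 * a - 3 != 0 by rewrite gt_eqF//; lra.
  have h2 : 2 * a - 1 != 0 by rewrite gt_eqF//; lra.
  by rewrite /xi; move: pi0; move: (pi : R) => P P0; field; rewrite h1 h2 P0.
have cg := cvg_tail_avg_id x0 (2 * a).
have [a1|a1] := eqVneq a 1.
  have [d hd] := @cvg_psi_one R.
  have bf := unit_bounded_psi_limit hd.
  have bh : unit_bounded (fun r : R => r `^ (1 + 1 / 2)) by apply: unit_bounded_powR; lra.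
  have H (r : R) : 0 < r < 1 -> `|psi_limit d r - 2 * r| <= (`|d| + 4) * r `^ (1 + 1 / 2).
    exact: psi_limit_le.
  have m01 : (0 < (1 / 2 : R)) && ((1 / 2 : R) <= 1) by apply/andP; split; lra.
  have ch := cvg_tail_avg_powR1D x0 (2 * a) m01.
  have L := cvg_tail_avg_dominated x0 bf bX bh H rho0 cg ch.
  have e : (4 * a - 2) / (4 * a - 3) = 2.
    by rewrite a1 (_ : 4 * 1 - 3 = 1) ?divr1; ring.
  rewrite -cE e.
  apply: cvg_trans L; apply: near_eq_cvg; near=> k.
  have k3 : (3 <= k)%N by near: k; exact: nbhs_infty_ge.
  congr (_ * _); rewrite a1 /gamma eqxx; symmetry; apply/cvg_lim => //.
  exact: cvg_gamma_formula1.
(* A positive exponent gain meeting the two constraints of [psi_bound]. *)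
pose m := Num.min (4 * a - 3) (1 / 2).
have m0 : 0 < m by rewrite lt_min; apply/andP; split; lra.
have m1 : m <= 1 / 2 by rewrite ge_min lexx orbT.
have ma : m <= 4 * a - 3 by rewrite ge_min lexx.
have m01 : 0 < m <= 1 / 2 by rewrite m0.
have m01' : 0 < m <= 1 by rewrite m0; lra.
have bf := unit_bounded_psi a12.
have bh : unit_bounded (fun r : R => r `^ (1 + m)) by apply: unit_bounded_powR; lra.
have H (r : R) : 0 < r < 1 -> `|psi a r - (4 * a - 2) / (4 * a - 3) * r| <=
    (`|psi_one a| + (4 * a - 2) / (4 * a - 3) + (4 * a - 2)) * r `^ (1 + m).
  exact: psi_bound.
have ch := cvg_tail_avg_powR1D x0 (2 * a) m01'.
have L := cvg_tail_avg_dominated x0 bf bX bh H rho0 cg ch.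
rewrite -cE; apply: cvg_trans L; apply: near_eq_cvg; near=> k.
congr (_ * _); rewrite gammaE// -tail_avgZ//; last exact: unit_bounded_symbol.
by apply: eq_tail_avg => r _; rewrite /psi mulrC.
Unshelve. all: by end_near. Qed.

Lemma cvg_gamma_34 nu : 0 < nu ->
  k%:R / ln k%:R * gamma (3 / 4) nu k @[k --> \oo] --> 6 * nu / pi.
Proof.
move=> nu0; have a12 : 1 / 2 < 3 / 4 :> R by lra.
have a1 : 3 / 4 != 1 :> R by rewrite lt_eqF//; lra.
have x0 := xi_gt0 a12 nu0.
have rho0 : \forall k \near \oo, 0 <= k%:R / ln k%:R :> R.
  near=> k; rewrite divr_ge0// ln_ge0// ler1n; near: k; exact: nbhs_infty_ge.
have bX := @unit_bounded_id R; have bf := unit_bounded_symbol a12.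
have bg := @unit_bounded_rlnr R.
have cg := cvg_tail_avg_rlnr x0 (2 * (3 / 4)).
have ch : k%:R / ln k%:R * tail_avg (xi (3 / 4) nu) (k%:R - 2 * (3 / 4)) (fun r => r) @[k --> \oo] --> (0 : R).
  rewrite -(mul0r (xi (3 / 4) nu)).
  have h := cvgM (@cvg_ln_natrV R) (cvg_tail_avg_id x0 (2 * (3 / 4))).
  have {}h : (ln k%:R)^-1 * (k%:R * tail_avg (xi (3 / 4) nu) (k%:R - 2 * (3 / 4)) (fun r => r))
     @[k --> \oo] --> 0 * xi (3 / 4) nu by exact: h.
  apply: cvg_trans h; apply: near_eq_cvg; near=> k.
  by move: (tail_avg _ _ _) (ln _)^-1 => T L; ring.
have L := cvg_tail_avg_dominated x0 bf bg bX (@symbol_bound_34 R) rho0 cg ch.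
have pi0 : pi != 0 :> R by rewrite gt_eqF// pi_gt0.
(* Here [8 alpha (alpha - 1) = - 3/2], so the prefactor and the coefficient cancel and the constant
   is [xi (3/4) nu] itself. *)
have -> : 6 * nu / pi = (8 * (3 / 4) * (3 / 4 - 1))^-1 * (- (3 / 2) * xi (3 / 4) nu).
  by rewrite /xi; move: pi0; move: (pi : R) => P P0; field; rewrite P0; lra.
have {}L : (8 * (3 / 4) * (3 / 4 - 1))^-1 * (k%:R / ln k%:R * tail_avg (xi (3 / 4) nu) (k%:R - 2 * (3 / 4)) (gamma_symbol (3 / 4)))
    @[k --> \oo] --> (8 * (3 / 4) * (3 / 4 - 1))^-1 * (- (3 / 2) * xi (3 / 4) nu) by exact: cvgMr.
apply: cvg_trans L; apply: near_eq_cvg; near=> k.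
by rewrite gammaE//= mulrCA.
Unshelve. all: by end_near. Qed.

Lemma cvg_gamma_lt34 a nu : 1 / 2 < a -> a < 3 / 4 -> 0 < nu ->
  k%:R `^ (4 * a - 2) * gamma a nu k @[k --> \oo] -->
  (8 * a * (a - 1))^-1 * ((4 * symbol_coef a - 2 * a * Beta (3 - 4 * a) (2 * a)) * xi a nu `^ (4 * a - 2)).
Proof.
move=> a12 a34 nu0; have x0 := xi_gt0 a12 nu0.
have a1 : a != 1 by rewrite lt_eqF//; lra.
have rho0 : \forall k \near \oo, 0 <= k%:R `^ (4 * a - 2) :> R by apply: nearW => k; exact: powR_ge0.
have bX := @unit_bounded_id R; have bf := unit_bounded_symbol a12.
have bg : unit_bounded (fun r : R => r `^ (4 * a - 2)) by apply: unit_bounded_powR; lra.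
have q01 : 0 < 4 * a - 2 <= 1 by apply/andP; split; lra.
have cg := cvg_tail_avg_powR x0 (2 * a) q01.
have q0 : 0 < 3 - 4 * a by lra.
have ch : k%:R `^ (4 * a - 2) * tail_avg (xi a nu) (k%:R - 2 * a) (fun r => r) @[k --> \oo] --> (0 : R).
  rewrite -(mul0r (xi a nu)).
  have h : (k%:R : R) `^ (- (3 - 4 * a)) * (k%:R * tail_avg (xi a nu) (k%:R - 2 * a) (fun r => r))
     @[k --> \oo] --> 0 * xi a nu.
    by apply: cvgM; [exact: cvg_powRN_natr|exact: cvg_tail_avg_id].
  apply: cvg_trans h; apply: near_eq_cvg; near=> k.
  have k0 : 0 < k%:R :> R by rewrite ltr0n; near: k; exact: nbhs_infty_gt.
  by rewrite mulrA (powRE1 (4 * a - 2) k0); congr (_ `^ _ * _ * _); ring.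
have L := cvg_tail_avg_dominated x0 bf bg bX (fun r => @symbol_bound_lt34 R a r a12 a34) rho0 cg ch.
have {}L : (8 * a * (a - 1))^-1 * (k%:R `^ (4 * a - 2) * tail_avg (xi a nu) (k%:R - 2 * a) (gamma_symbol a))
    @[k --> \oo] --> (8 * a * (a - 1))^-1 *
    ((4 * symbol_coef a - 2 * a * Beta (3 - 4 * a) (2 * a)) * xi a nu `^ (4 * a - 2)) by exact: cvgMr.
apply: cvg_trans L; apply: near_eq_cvg; near=> k.
by rewrite gammaE//= mulrCA.
Unshelve. all: by end_near. Qed.

(** The bound [2 <= k] is sharp at [alpha = 3/4]: the rate [ln k / k] vanishes at [k = 1]. *)
Lemma gamma_rate_neq0 a k : (2 <= k)%N -> gamma_rate a k != 0.
Proof.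
move=> k2; have k1 : 1 < k%:R :> R by rewrite ltr1n.
have k0 : 0 < k%:R :> R by apply: lt_trans k1.
rewrite /gamma_rate; case: ifP => _; first by rewrite invr_eq0 gt_eqF.
case: ifP => _; first by rewrite mulf_neq0 ?invr_eq0 ?gt_eqF// ln_gt0.
by rewrite gt_eqF// powR_gt0.
Qed.

Lemma cvg_gamma_rate a nu : 1 / 2 < a -> 0 < nu ->
  gamma a nu k / gamma_rate a k @[k --> \oo] --> gamma_const a nu.
Proof.
move=> a12 nu0; rewrite /gamma_const /gamma_rate.
have [a34|a34] := ltP (3 / 4) a.
  by under eq_cvg => k do rewrite invrK mulrC; exact: cvg_gamma_gt34.
have [->|a34'] := eqVneq a (3 / 4).
  by under eq_cvg => k do rewrite invf_div mulrC; exact: cvg_gamma_34.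
have {}a34 : a < 3 / 4 by rewrite lt_neqAle a34'.
have L := cvg_gamma_lt34 a12 a34 nu0.
have E k : k%:R `^ (4 * a - 2) * gamma a nu k = gamma a nu k / k%:R `^ (2 - 4 * a).
  by rewrite mulrC -powRN; congr (_ * _ `^ _); ring.
move: L; rewrite (eq_cvg _ _ E) BetaC /symbol_coef.
have -> : 2 * a + 1 = 1 + 2 * a by ring.
have -> : 2 * a - 2 = - 2 + 2 * a by ring.
have -> : - 4 * a = - (4 * a) by ring.
have p2 : 2 `^ (4 * a + 1) = 2 * 2 `^ (4 * a) :> R.
  by rewrite (powRE1 (4 * a + 1))// addrK mulrC.
rewrite p2 powRN.
have a10 : a - 1 != 0 by rewrite lt_eqF//; lra.
have a00 : a != 0 by rewrite gt_eqF//; lra.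
have P0 : 2 `^ (4 * a) != 0 :> R by rewrite gt_eqF// powR_gt0.
move: (2 `^ (4 * a)) P0 (lower_beta _ _ _) (Beta _ _) (xi a nu `^ _) => P P0 B B' X.
have -> // : (8 * a * (a - 1))^-1 * ((4 * (P^-1 * (3 * a - 1) / (a - 1) + (a - 1 / 2) * B) - 2 * a * B') * X) =
  ((3 * a - 1) / (2 * P * a * (a - 1) ^+ 2) + (a - 1 / 2) * B / (2 * (a - 1) * a) - B' / (4 * (a - 1))) * X.
by field; rewrite a10 a00 P0.
Qed.

End gamma_asymptotics.

Theorem proposition1p4 (R : realType) (alpha nu : R)
  (halpha : 1 / 2 < alpha) (hnu : 0 < nu) :
  exists eps : nat -> R,
    eps k @[k --> \oo] --> (0 : R) /\
    forall k : nat, (2 <= k)%N ->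
      gamma alpha nu k = (gamma_const alpha nu + eps k) * gamma_rate alpha k.
Proof.
exists (fun k => gamma alpha nu k / gamma_rate alpha k - gamma_const alpha nu); split.
  rewrite -(subrr (gamma_const alpha nu)); apply: cvgB; last exact: cvg_cst.
  exact: cvg_gamma_rate.
by move=> k k2; rewrite addrC subrK divfK// gamma_rate_neq0.
Qed.
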